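(* Let $f(z)=z+\sum_{n=2}^{\infty}a_nz^n\in\mathcal{S}^{*}_{\tau}$. Then $|H_3(1)|\leq \dfrac{1}{9}$, where $H_3(1)=a_3(a_2a_4-a_3^2)-a_4(a_4-a_2a_3)+a_5(a_3-a_2^2)$. The result is sharp.
   Context: $\mathbb{D}=\{z\in\mathbb{C}:|z|<1\}$. $\mathcal{A}$ is the class of analytic functions $f$ on $\mathbb{D}$ of the form $f(z)=z+\sum_{n\ge 2}a_nz^n$. For analytic $g,h$ on $\mathbb{D}$, $g\prec h$ means $g(z)=h(\omega(z))$ for some analytic $\omega:\mathbb{D}\to\mathbb{D}$ with $\omega(0)=0$, $|\omega(z)|\le|z|$. $\arctan$ is the principal branch. $\mathcal{S}^{*}_{\tau}=\{f\in\mathcal{A}: zf'(z)/f(z)\prec 1+\arctan z\}$. $H_3(1)$ is the third order Hankel determinant, i.e. the determinant of the $3\times 3$ matrix with rows $(1,a_2,a_3)$, $(a_2,a_3,a_4)$, $(a_3,a_4,a_5)$. A bound is sharp if it cannot be replaced by a smaller constant valid for the whole class. *)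

(* Defs.v *)
From Stdlib Require Import Reals.
From Coquelicot Require Import Coquelicot.

Open Scope R_scope.

Definition in_disk (z : C) : Prop := Cmod z < 1.

(** Functions on the disk are total functions [C -> C] whose values outside the
    disk are irrelevant: every condition below only looks at points of the open
    disk, and differentiability there is a local property. *)
Definition analytic_on_disk (g : C -> C) : Prop :=
  forall z : C, in_disk z -> ex_derive (K := C_AbsRing) (V := C_NormedModule) g z.

(** Principal argument, with values in (-PI, PI]; [Carg 0] is a junk value. *)
Definition Carg (z : C) : R :=
  if Rle_dec 0 (Im z) then acos (Re z / Cmod z) else - acos (Re z / Cmod z).

Definition Clog (z : C) : C := (ln (Cmod z), Carg z).

Definition Carctan (z : C) : C :=
  ((Clog (1 + Ci * z) - Clog (1 - Ci * z)) / (2 * Ci))%C.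

Definition subordinate (g h : C -> C) : Prop :=
  exists omega : C -> C,
    analytic_on_disk omega /\
    (forall z : C, in_disk z -> in_disk (omega z)) /\
    omega 0%C = 0%C /\
    (forall z : C, in_disk z -> Cmod (omega z) <= Cmod z) /\
    (forall z : C, in_disk z -> g z = h (omega z)).

(** [f z = z + a 2 * z^2 + a 3 * z^3 + ...] on the disk. *)
Definition normalized_expansion (f : C -> C) (a : nat -> C) : Prop :=
  a 0%nat = 0%C /\ a 1%nat = 1%C /\
  forall z : C, in_disk z ->
    is_pseries (K := C_AbsRing) (V := C_NormedModule) a z (f z).

Definition class_A (f : C -> C) : Prop :=
  analytic_on_disk f /\ exists a : nat -> C, normalized_expansion f a.

(** The function [z f'(z) / f(z)], extended to the removable singularity at the
    origin by its limit 1 (as [f 0 = 0] and [f' 0 = 1] for [f] in [class_A]). *)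
Definition zdlog (f : C -> C) (z : C) : C :=
  if Ceq_dec z 0 then 1%C else (z * C_derive f z / f z)%C.

(** Division is total, so the fact that [z f'(z) / f(z)] is defined and analytic
    on the disk, i.e. that [f] has no zero other than the origin, is explicit. *)
Definition class_S_tau (f : C -> C) : Prop :=
  class_A f /\
  (forall z : C, in_disk z -> z <> 0%C -> f z <> 0%C) /\
  subordinate (zdlog f) (fun z => (1 + Carctan z)%C).

(** The determinant of the matrix with rows (1, a 2, a 3), (a 2, a 3, a 4) and
    (a 3, a 4, a 5), expanded along its last row. *)
Definition H3_1 (a : nat -> C) : C :=
  (a 3%nat * (a 2%nat * a 4%nat - a 3%nat * a 3%nat)
   - a 4%nat * (a 4%nat - a 2%nat * a 3%nat)
   + a 5%nat * (a 3%nat - a 2%nat * a 2%nat))%C.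

(* Main.v *)
Require Import Defs.
From Stdlib Require Import Reals.
From Coquelicot Require Import Coquelicot.
From Stdlib Require Import Lra Lia Psatz List Classical ClassicalEpsilon.
Import ListNotations.
Open Scope R_scope.

(** For [f] in the class write [f z = z F z] and [z F' / F = arctan (omega z)] with a
    Schwarz function [omega z = c z + d z ^ 2 + e z ^ 3 + g z ^ 4 + ...]. Comparing
    expansions at 0 turns [144 * H3_1 a] into the polynomial [H_schwarz c d e g]
    ([H3_upper_bound]). By the Schur algorithm ([schur_parameters]) the coefficients
    [c, d, e, g] are polynomials in four parameters [c, x, y, w] of the closed unit
    disk, their conjugates included, and it remains to prove that the resulting
    expression has modulus at most 16 ([schur_parameter_bound]).

    That expression is affine in [w] and quadratic in [y]. The plain triangle
    inequality on its monomials is not sufficient: it gives about 16.8. However, the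
    two sums [u c ^ 2 + q x] and [a - 18 c ^ 2 conj x] that occur in the terms of degree
    0 and 2 in [y] cannot both consist of aligned summands, because the angles between
    their summands are supplementary. [Cmod_triangle_gain] quantifies this, and what
    is left is a polynomial inequality in [|c| ^ 2] and [|x|] on the unit square, proved by
    Bernstein coefficients ([bernstein_square_nonneg]).

    The Schur algorithm needs the Schwarz lemma for functions known to be
    differentiable only off the origin. The Schwarz function satisfies
    [omega' = q' (1 + omega ^ 2)] with [q = z F' / F], so it is twice differentiable
    ([omega_hol2]) and the maximum principle follows from the second derivative
    test: [|g| ^ 2 + eps |z| ^ 2 + eta ln (|z| ^ 2)] has a positive Laplacian, hence no
    interior maximum, and the logarithm deals with the puncture
    ([schwarz_punctured]). Scaling [omega] by [r < 1] keeps all the Schur parameters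
    in the open disk; [r] tends to 1 at the end.

    Equality holds for [omega z = z ^ 3], that is for
    [f z = z exp (int_0^z arctan (t ^ 3) / t dt)], where [a 4 = 1 / 3] and
    [a 2 = a 3 = a 5 = 0]. Its coefficients are defined by the recursion equivalent
    to [z F' = arctan (z ^ 3) F], and [F] has no zero because its product with the
    solution of the opposite equation is 1. *)

(** * Polynomial inequalities on the unit square *)

(** The polynomial of degree at most 7 with coefficient list [l]. *)
Definition poly7 (l : list R) (x : R) : R :=
  let a i := nth i l 0 in
  a 0%nat + a 1%nat * x + a 2%nat * x ^ 2 + a 3%nat * x ^ 3 + a 4%nat * x ^ 4
  + a 5%nat * x ^ 5 + a 6%nat * x ^ 6 + a 7%nat * x ^ 7.

(** Nonnegativity of the Bernstein coefficients on [0,1], in degree 7 and up to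
    positive factors, of the polynomial with coefficients [a]. *)
Definition bernstein7 (a : nat -> R) : Prop :=
  let a0 := a 0%nat in let a1 := a 1%nat in let a2 := a 2%nat in
  let a3 := a 3%nat in let a4 := a 4%nat in let a5 := a 5%nat in
  let a6 := a 6%nat in let a7 := a 7%nat in
  0 <= a0 /\ 0 <= 7 * a0 + a1 /\ 0 <= 21 * a0 + 6 * a1 + a2 /\
  0 <= 35 * a0 + 15 * a1 + 5 * a2 + a3 /\
  0 <= 35 * a0 + 20 * a1 + 10 * a2 + 4 * a3 + a4 /\
  0 <= 21 * a0 + 15 * a1 + 10 * a2 + 6 * a3 + 3 * a4 + a5 /\
  0 <= 7 * a0 + 6 * a1 + 5 * a2 + 4 * a3 + 3 * a4 + 2 * a5 + a6 /\
  0 <= a0 + a1 + a2 + a3 + a4 + a5 + a6 + a7.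

(** The combinations of four polynomials are those that [cubic_nonneg_by_thirds]
    produces. *)
Lemma bernstein7_nonneg (k0 k1 k2 k3 : R) (l0 l1 l2 l3 : list R) (x : R) :
  0 <= x <= 1 ->
  bernstein7 (fun i => k0 * nth i l0 0 + k1 * nth i l1 0 + k2 * nth i l2 0
                       + k3 * nth i l3 0) ->
  0 <= k0 * poly7 l0 x + k1 * poly7 l1 x + k2 * poly7 l2 x + k3 * poly7 l3 x.
Proof.
  intros [h0 h1]. unfold bernstein7, poly7; cbv zeta.
  set (a i := k0 * nth i l0 0 + k1 * nth i l1 0 + k2 * nth i l2 0 + k3 * nth i l3 0).
  change (fun i : nat => a i) with a.
  fold (a 0%nat) (a 1%nat) (a 2%nat) (a 3%nat) (a 4%nat) (a 5%nat) (a 6%nat) (a 7%nat).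
  intros (H0 & H1 & H2 & H3 & H4 & H5 & H6 & H7).
  assert (hy : 0 <= 1 - x) by lra.
  assert (P : forall i j b, 0 <= b -> 0 <= b * (x ^ i * (1 - x) ^ j)).
  { intros i j b hb. apply Rmult_le_pos; [exact hb|].
    apply Rmult_le_pos; apply pow_le; assumption. }
  pose proof (P 0%nat 7%nat _ H0); pose proof (P 1%nat 6%nat _ H1).
  pose proof (P 2%nat 5%nat _ H2); pose proof (P 3%nat 4%nat _ H3).
  pose proof (P 4%nat 3%nat _ H4); pose proof (P 5%nat 2%nat _ H5).
  pose proof (P 6%nat 1%nat _ H6); pose proof (P 7%nat 0%nat _ H7).
  match goal with |- 0 <= ?e => replace e with
   ( a 0%nat * (x ^ 0 * (1 - x) ^ 7) + (7 * a 0%nat + a 1%nat) * (x ^ 1 * (1 - x) ^ 6)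
   + (21 * a 0%nat + 6 * a 1%nat + a 2%nat) * (x ^ 2 * (1 - x) ^ 5)
   + (35 * a 0%nat + 15 * a 1%nat + 5 * a 2%nat + a 3%nat) * (x ^ 3 * (1 - x) ^ 4)
   + (35 * a 0%nat + 20 * a 1%nat + 10 * a 2%nat + 4 * a 3%nat + a 4%nat)
     * (x ^ 4 * (1 - x) ^ 3)
   + (21 * a 0%nat + 15 * a 1%nat + 10 * a 2%nat + 6 * a 3%nat + 3 * a 4%nat + a 5%nat)
     * (x ^ 5 * (1 - x) ^ 2)
   + (7 * a 0%nat + 6 * a 1%nat + 5 * a 2%nat + 4 * a 3%nat + 3 * a 4%nat
      + 2 * a 5%nat + a 6%nat) * (x ^ 6 * (1 - x) ^ 1)
   + (a 0%nat + a 1%nat + a 2%nat + a 3%nat + a 4%nat + a 5%nat + a 6%nat + a 7%nat)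
     * (x ^ 7 * (1 - x) ^ 0)) by (unfold a; ring) end.
  lra.
Qed.

(** A cubic is nonnegative on [0,1] as soon as its Bernstein coefficients on
    each third of [0,1] are; the hypotheses are these coefficients, up to
    positive factors. *)
Lemma cubic_nonneg_by_thirds (p0 p1 p2 p3 n : R) :
  0 <= n <= 1 ->
  0 <= p0 -> 0 <= 9 * p0 + p1 -> 0 <= 27 * p0 + 6 * p1 + p2 ->
  0 <= 27 * p0 + 9 * p1 + 3 * p2 + p3 ->
  0 <= 27 * p0 + 12 * p1 + 5 * p2 + 2 * p3 ->
  0 <= 27 * p0 + 15 * p1 + 8 * p2 + 4 * p3 ->
  0 <= 27 * p0 + 18 * p1 + 12 * p2 + 8 * p3 ->
  0 <= 27 * p0 + 21 * p1 + 16 * p2 + 12 * p3 ->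
  0 <= 27 * p0 + 24 * p1 + 21 * p2 + 18 * p3 ->
  0 <= p0 + p1 + p2 + p3 ->
  0 <= p0 + p1 * n + p2 * n ^ 2 + p3 * n ^ 3.
Proof.
  intros [h0 h1] A0 A1 A2 B0 B1 B2 C0 C1 C2 D0.
  assert (key : forall b0 b1 b2 b3 m, 0 <= m <= 1 -> 0 <= b0 -> 0 <= b1 ->
     0 <= b2 -> 0 <= b3 ->
     0 <= b0 * (1 - m) ^ 3 + b1 * (m * (1 - m) ^ 2) + b2 * (m ^ 2 * (1 - m))
          + b3 * m ^ 3).
  { intros b0 b1 b2 b3 m [m0 m1] H0 H1 H2 H3.
    assert (0 <= 1 - m) by lra.
    repeat apply Rplus_le_le_0_compat; repeat apply Rmult_le_pos;
      try assumption; try (apply pow_le; assumption); lra. }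
  destruct (Rle_dec n (1 / 3)) as [L1|L1]; [|destruct (Rle_dec n (2 / 3)) as [L2|L2]].
  - pose proof (key p0 ((9 * p0 + p1) / 3) ((27 * p0 + 6 * p1 + p2) / 9)
      ((27 * p0 + 9 * p1 + 3 * p2 + p3) / 27) (3 * n)) as K.
    assert (K' := K ltac:(lra) ltac:(lra) ltac:(lra) ltac:(lra) ltac:(lra)).
    match type of K' with 0 <= ?e => replace (p0 + p1 * n + p2 * n ^ 2 + p3 * n ^ 3)
      with e by field end; exact K'.
  - pose proof (key ((27 * p0 + 9 * p1 + 3 * p2 + p3) / 27)
      ((27 * p0 + 12 * p1 + 5 * p2 + 2 * p3) / 9)
      ((27 * p0 + 15 * p1 + 8 * p2 + 4 * p3) / 9)
      ((27 * p0 + 18 * p1 + 12 * p2 + 8 * p3) / 27) (3 * n - 1)) as K.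
    assert (K' := K ltac:(lra) ltac:(lra) ltac:(lra) ltac:(lra) ltac:(lra)).
    match type of K' with 0 <= ?e => replace (p0 + p1 * n + p2 * n ^ 2 + p3 * n ^ 3)
      with e by field end; exact K'.
  - pose proof (key ((27 * p0 + 18 * p1 + 12 * p2 + 8 * p3) / 27)
      ((27 * p0 + 21 * p1 + 16 * p2 + 12 * p3) / 9)
      ((27 * p0 + 24 * p1 + 21 * p2 + 18 * p3) / 9)
      (p0 + p1 + p2 + p3) (3 * n - 2)) as K.
    assert (K' := K ltac:(lra) ltac:(lra) ltac:(lra) ltac:(lra) ltac:(lra)).
    match type of K' with 0 <= ?e => replace (p0 + p1 * n + p2 * n ^ 2 + p3 * n ^ 3)
      with e by field end; exact K'.
Qed.

(** Nonnegativity on the unit square of a polynomial that is cubic in [n] and of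
    degree at most 7 in [x], given by its coefficient lists in [x]. *)
Lemma bernstein_square_nonneg (l0 l1 l2 l3 : list R) (n x : R) :
  0 <= n <= 1 -> 0 <= x <= 1 ->
  (let B k0 k1 k2 k3 := bernstein7 (fun i => k0 * nth i l0 0 + k1 * nth i l1 0
                                    + k2 * nth i l2 0 + k3 * nth i l3 0) in
   B 1 0 0 0 /\ B 9 1 0 0 /\ B 27 6 1 0 /\ B 27 9 3 1 /\ B 27 12 5 2 /\
   B 27 15 8 4 /\ B 27 18 12 8 /\ B 27 21 16 12 /\ B 27 24 21 18 /\ B 1 1 1 1) ->
  0 <= poly7 l0 x + poly7 l1 x * n + poly7 l2 x * n ^ 2 + poly7 l3 x * n ^ 3.
Proof.
  intros hn hx; cbv zeta. intros (H0&H1&H2&H3&H4&H5&H6&H7&H8&H9).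
  apply (bernstein7_nonneg _ _ _ _ _ _ _ _ _ hx) in H0, H1, H2, H3, H4, H5, H6, H7, H8, H9.
  apply cubic_nonneg_by_thirds; [exact hn|lra..].
Qed.

(** The condition under which the corrections to the triangle inequality that
    are used in [schur_parameter_bound] are admissible. *)
Lemma correction_admissible (n x : R) : 0 <= n <= 1 -> 0 <= x <= 1 ->
  18 * (1 - n) * (1 - x ^ 2) * (2 - x ^ 2) *
    (n * (27 * (1 - n) + 56 / 3 * n)
     + (9 * (1 - n) ^ 2 + 24 * (1 - n) * n + 18 * n ^ 2) * x)
  <= (27 * (1 - n) + 56 / 3 * n) * (9 * (1 - n) ^ 2 + 24 * (1 - n) * n + 18 * n ^ 2).
Proof.
  intros hn hx.
  pose proof (bernstein_square_nonneg
    [243; -324; 0; 486; 0; -162]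
    [-885; 108; 1458; -162; -486; 54]
    [1303; 108; -1908; -162; 636; 54]
    [-325; 108; 450; -162; -150; 54] n x hn hx) as H.
  cbv zeta in H. lapply H; clear H; [intro H|].
  - unfold poly7 in H; cbn [nth] in H. lra.
  - cbv [bernstein7 nth]; repeat split; lra.
Qed.

(** Bounds given by the triangle inequality for the terms of degree 0, 1 and 2 in
    the third Schur parameter, as functions of the moduli [c] and [x] of the first
    two. *)
Definition modA (c x : R) : R :=
  let n := c ^ 2 in let t := 1 - n in
  49 / 9 * n ^ 3 + 13 * t * n ^ 2 * x + (27 * t ^ 2 + 56 / 3 * t * n) * n * x ^ 2
  + (9 * t ^ 3 + 24 * t ^ 2 * n + 18 * t * n ^ 2) * x ^ 3 + 2 * t ^ 2 * n * x ^ 4.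

Definition modB (c x : R) : R :=
  let n := c ^ 2 in let t := 1 - n in
  t * (1 - x ^ 2) * (56 / 3 * c ^ 3 + (24 * t + 36 * n) * c * x + 4 * t * c * x ^ 2).

Definition modC (c x : R) : R :=
  let n := c ^ 2 in let t := 1 - n in
  t * (1 - x ^ 2) * (16 * t * (1 - x ^ 2) + 18 * t * x ^ 2 + 18 * n * x).

(** The bound for the coefficient of the fourth Schur parameter, apart from the
    factor [1 - y ^ 2] that contains the modulus [y] of the third one. *)
Definition modD (c x : R) : R :=
  let n := c ^ 2 in let t := 1 - n in 18 * t * (1 - x ^ 2) * (t * x + n).

(** The amount gained over the triangle inequality by [Cmod_triangle_gain]. *)
Definition gain (c x : R) : R :=
  let n := c ^ 2 in let t := 1 - n in
  36 * t ^ 2 * (1 - x ^ 2) * (2 - x ^ 2) * n * x ^ 3.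

(** Odd powers of [c] are removed by the arithmetic-geometric mean inequality,
    with weights [al] for [c x] and [be] for [c], so that only [c ^ 2] remains. *)
Lemma modB_le (c x al be : R) : 0 <= c <= 1 -> 0 <= x <= 1 -> 0 < al -> 0 < be ->
  modB c x <=
  (1 - c ^ 2) * (1 - x ^ 2) *
  (56 / 3 * c ^ 2 * (be / 2 + c ^ 2 / (2 * be))
   + (24 * (1 - c ^ 2) + 36 * c ^ 2) * (al / 2 * c ^ 2 + x ^ 2 / (2 * al))
   + 4 * (1 - c ^ 2) * (be / 2 + c ^ 2 / (2 * be)) * x ^ 2).
Proof.
  intros hc hx hal hbe. unfold modB; cbv zeta.
  assert (E1 : c <= be / 2 + c ^ 2 / (2 * be)).
  { apply Rminus_le_0.
    replace (be / 2 + c ^ 2 / (2 * be) - c) with ((be - c) ^ 2 * / (2 * be)) by (field; lra).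
    apply Rmult_le_pos; [apply pow2_ge_0 | apply Rlt_le, Rinv_0_lt_compat; lra]. }
  assert (E2 : c * x <= al / 2 * c ^ 2 + x ^ 2 / (2 * al)).
  { apply Rminus_le_0.
    replace (al / 2 * c ^ 2 + x ^ 2 / (2 * al) - c * x)
      with ((al * c - x) ^ 2 * / (2 * al)) by (field; lra).
    apply Rmult_le_pos; [apply pow2_ge_0 | apply Rlt_le, Rinv_0_lt_compat; lra]. }
  assert (0 <= 1 - c ^ 2) by nra. assert (0 <= 1 - x ^ 2) by nra.
  assert (0 <= c ^ 2) by nra. assert (0 <= x ^ 2) by nra.
  apply Rmult_le_compat_l; [apply Rmult_le_pos; assumption|].
  apply Rplus_le_compat; [apply Rplus_le_compat|].
  - replace (56 / 3 * c ^ 3) with (56 / 3 * c ^ 2 * c) by ring.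
    apply Rmult_le_compat_l; lra.
  - rewrite Rmult_assoc. apply Rmult_le_compat_l; [lra|exact E2].
  - apply Rmult_le_compat_r; [assumption|]. apply Rmult_le_compat_l; [lra|exact E1].
Qed.

(** The case [y = 1] after [modB_le], with [n = c ^ 2]. The weights 5/4 and 3/5 keep
    enough room near [n = x = 0], where equality holds. *)
Lemma poly_bound_end_even (n x : R) : 0 <= n <= 1 -> 0 <= x <= 1 ->
  49 / 9 * n ^ 3 + 13 * (1 - n) * n ^ 2 * x + (27 * (1 - n) ^ 2 + 56 / 3 * (1 - n) * n) * n * x ^ 2
  + (9 * (1 - n) ^ 3 + 24 * (1 - n) ^ 2 * n + 18 * (1 - n) * n ^ 2) * x ^ 3 + 2 * (1 - n) ^ 2 * n * x ^ 4
  + (1 - n) * (1 - x ^ 2) *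
  (56 / 3 * n * (3 / 5 / 2 + n / (2 * (3 / 5)))
   + (24 * (1 - n) + 36 * n) * (5 / 4 / 2 * n + x ^ 2 / (2 * (5 / 4)))
   + 4 * (1 - n) * (3 / 5 / 2 + n / (2 * (3 / 5))) * x ^ 2)
  + (1 - n) * (1 - x ^ 2) * (16 * (1 - n) * (1 - x ^ 2) + 18 * (1 - n) * x ^ 2 + 18 * n * x)
  - 36 * (1 - n) ^ 2 * (1 - x ^ 2) * (2 - x ^ 2) * n * x ^ 3 <= 16.
Proof.
  intros hn hx.
  pose proof (bernstein_square_nonneg
    [0; 0; 16 / 5; -9; 64 / 5]
    [57 / 5; -18; -458 / 15; 93; -148 / 15; -108; 0; 36]
    [-1661 / 90; 5; 1117 / 18; -159; -64 / 15; 216; 0; -72]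
    [317 / 18; 13; -625 / 18; 75; 4 / 3; -108; 0; 36] n x hn hx) as H.
  cbv zeta in H. lapply H; clear H; [intro H|].
  - unfold poly7 in H; cbn [nth] in H. lra.
  - cbv [bernstein7 nth]; repeat split; lra.
Qed.

(** The case [y = 0], half of the linear term being added, after [modB_le]. *)
Lemma poly_bound_start_even (n x : R) : 0 <= n <= 1 -> 0 <= x <= 1 ->
  49 / 9 * n ^ 3 + 13 * (1 - n) * n ^ 2 * x + (27 * (1 - n) ^ 2 + 56 / 3 * (1 - n) * n) * n * x ^ 2
  + (9 * (1 - n) ^ 3 + 24 * (1 - n) ^ 2 * n + 18 * (1 - n) * n ^ 2) * x ^ 3 + 2 * (1 - n) ^ 2 * n * x ^ 4
  + (1 - n) * (1 - x ^ 2) *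
  (56 / 3 * n * (1 / 2 / 2 + n / (2 * (1 / 2)))
   + (24 * (1 - n) + 36 * n) * (1 / 2 * n + x ^ 2 / (2 * 1))
   + 4 * (1 - n) * (1 / 2 / 2 + n / (2 * (1 / 2))) * x ^ 2) / 2
  + 18 * (1 - n) * (1 - x ^ 2) * ((1 - n) * x + n) <= 16.
Proof.
  intros hn hx.
  pose proof (bernstein_square_nonneg
    [16; -18; -13 / 2; 9; 13 / 2]
    [-79 / 3; 36; 4 / 3; -33; -4]
    [14; -31; 167 / 6; 21; -5 / 2]
    [62 / 9; 13; -68 / 3; 3] n x hn hx) as H.
  cbv zeta in H. lapply H; clear H; [intro H|].
  - unfold poly7 in H; cbn [nth] in H. lra.
  - cbv [bernstein7 nth]; repeat split; lra.
Qed.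

Lemma sq_unit (c : R) : 0 <= c <= 1 -> 0 <= c ^ 2 <= 1.
Proof. intros; nra. Qed.

Lemma poly_bound_end (c x : R) : 0 <= c <= 1 -> 0 <= x <= 1 ->
  modA c x + modB c x + modC c x - gain c x <= 16.
Proof.
  intros hc hx.
  pose proof (poly_bound_end_even (c ^ 2) x (sq_unit c hc) hx) as H.
  pose proof (modB_le c x (5 / 4) (3 / 5) hc hx ltac:(lra) ltac:(lra)) as H'.
  unfold modA, modC, gain; cbv zeta. lra.
Qed.

Lemma poly_bound_start (c x : R) : 0 <= c <= 1 -> 0 <= x <= 1 ->
  modA c x + modB c x / 2 + modD c x <= 16.
Proof.
  intros hc hx.
  pose proof (poly_bound_start_even (c ^ 2) x (sq_unit c hc) hx) as H.
  pose proof (modB_le c x 1 (1 / 2) hc hx ltac:(lra) ltac:(lra)) as H'.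
  unfold modA, modD; cbv zeta. lra.
Qed.

(** For the modulus [y] of the third Schur parameter the bound is interpolated
    between [y = 0] and [y = 1], by means of [y <= (1 + y ^ 2) / 2]. *)
Lemma poly_bound (c x y : R) : 0 <= c <= 1 -> 0 <= x <= 1 -> 0 <= y <= 1 ->
  modA c x + modB c x * y + (modC c x - gain c x) * y ^ 2 + modD c x * (1 - y ^ 2) <= 16.
Proof.
  intros hc hx hy.
  pose proof (poly_bound_end c x hc hx) as H1.
  pose proof (poly_bound_start c x hc hx) as H0.
  assert (hB : 0 <= modB c x).
  { unfold modB; cbv zeta.
    assert (0 <= c ^ 2 <= 1) by (apply sq_unit; exact hc).
    assert (0 <= x ^ 2 <= 1) by (apply sq_unit; exact hx).
    apply Rmult_le_pos; [apply Rmult_le_pos; lra|].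
    assert (0 <= c ^ 3) by (apply pow_le; lra).
    assert (0 <= c * x) by (apply Rmult_le_pos; lra).
    assert (0 <= c * x ^ 2) by (apply Rmult_le_pos; lra).
    nra. }
  pose proof (sq_unit y hy).
  assert (modB c x * y <= modB c x * ((1 + y ^ 2) / 2)) by
    (apply Rmult_le_compat_l; [exact hB|nra]).
  nra.
Qed.

(** * The bound in terms of Schur parameters *)

Lemma Cmult_conj_Cmod (z : C) : (z * Cconj z)%C = RtoC (Cmod z ^ 2).
Proof. symmetry; rewrite RtoC_pow. rewrite <- Cmod2_conj. now rewrite RtoC_pow. Qed.

Lemma Cmod_sqr (z : C) : Cmod z ^ 2 = Re z ^ 2 + Im z ^ 2.
Proof. apply Cmod2_alt. Qed.

(** A strengthening of the triangle inequality: [m] is controlled by the defect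
    [|a| |b| - Re (conj a b)] of alignment of [a] and [b]. *)
Lemma Cmod_triangle_gain (a b : C) (m : R) :
  0 <= m <= Cmod a + Cmod b ->
  m * (Cmod a + Cmod b) <= Cmod a * Cmod b - Re (Cconj a * b)%C ->
  Cmod (a + b) <= Cmod a + Cmod b - m.
Proof.
  intros hm h.
  pose proof (Cmod_sqr a) as Ea; pose proof (Cmod_sqr b) as Eb.
  pose proof (Cmod_sqr (a + b)) as Eab.
  rewrite re_mult, re_conj, im_conj in h. rewrite re_plus, im_plus in Eab.
  apply Rsqr_incr_0_var; [|lra]. rewrite !Rsqr_pow2. 
  nra.
Qed.

(** The determinant to be bounded, multiplied by 144, in terms of the first four
    Taylor coefficients of the Schwarz function. *)
Definition H_schwarz (c d e g : C) : C :=
  (- (49 / 9) * c ^ 6 + 13 * (c ^ 4 * d) - 27 * (c ^ 2 * d ^ 2) - 9 * d ^ 3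
   + 56 / 3 * (c ^ 3 * e) + 24 * (c * d * e) - 16 * e ^ 2 + 18 * ((d - c ^ 2) * g))%C.

(** The second, third and fourth Taylor coefficients of a Schwarz function with
    Schur parameters [c], [x], [y] and [w]; the first one is [c]. *)
Definition schur2 (c x : C) : C := ((1 - c * Cconj c) * x)%C.
Definition schur3 (c x y : C) : C :=
  ((1 - c * Cconj c) * ((1 - x * Cconj x) * y - Cconj c * x ^ 2))%C.
Definition schur4 (c x y w : C) : C :=
  ((1 - c * Cconj c) * ((1 - x * Cconj x) *
     ((1 - y * Cconj y) * w - Cconj x * y ^ 2 - 2 * Cconj c * x * y)
     + Cconj c ^ 2 * x ^ 3))%C.

(** Expansion in the powers of [y]. *)
Lemma H_schur_expand (c x y w : C) :
  let n := Cmod c ^ 2 in let t := 1 - n in let X := Cmod x in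
  let s := 1 - X ^ 2 in let v := 1 - Cmod y ^ 2 in
  H_schwarz c (schur2 c x) (schur3 c x y) (schur4 c x y w) =
  (RtoC (- (49 / 9)) * c ^ 6 + RtoC (13 * t) * (c ^ 4 * x)
   - x ^ 2 * (RtoC (t * (27 * t + 56 / 3 * n)) * c ^ 2
              + RtoC (t * (9 * t ^ 2 + 24 * t * n + 18 * n ^ 2)) * x)
   + RtoC (2 * t ^ 2) * (Cconj c ^ 2 * x ^ 4)
   + RtoC (t * s) * ((RtoC (56 / 3) * c ^ 3 + RtoC (24 * t + 36 * n) * (c * x)
                      + RtoC (- 4 * t) * (Cconj c * x ^ 2)) * y)
   - RtoC (t * s) * ((RtoC (16 * t * s + 18 * t * X ^ 2)
                      + RtoC (- 18) * (c ^ 2 * Cconj x)) * y ^ 2)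
   + RtoC (18 * t * s * v) * ((RtoC t * x - c ^ 2) * w))%C.
Proof.
  cbv zeta. unfold H_schwarz, schur2, schur3, schur4.
  pose proof (Cmult_conj_Cmod c) as Ec; pose proof (Cmult_conj_Cmod x) as Ex;
  pose proof (Cmult_conj_Cmod y) as Ey.
  rewrite ?RtoC_mult, ?RtoC_plus, ?RtoC_minus, ?RtoC_opp, ?RtoC_mult, ?RtoC_plus,
   ?RtoC_minus.
  repeat progress rewrite ?RtoC_mult, ?RtoC_plus, ?RtoC_minus, ?RtoC_opp, ?(RtoC_pow (1 - _)),
    ?(RtoC_pow (Cmod _ ^ 2)), ?RtoC_div by lra.
  rewrite <- Ec, <- Ex, <- Ey.
  field.
Qed.

Lemma Cmod_RtoC_nonneg (r : R) : 0 <= r -> Cmod (RtoC r) = r.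
Proof. intro h. rewrite Cmod_R. apply Rabs_pos_eq, h. Qed.

(** The triangle inequality on [H_schur_expand], corrected by [Cmod_triangle_gain]
    for the two sums between parentheses in the terms of degree 0 and 2 in [y]. *)
Lemma schur_parameter_bound (c x y w : C) :
  Cmod c <= 1 -> Cmod x <= 1 -> Cmod y <= 1 -> Cmod w <= 1 ->
  Cmod (H_schwarz c (schur2 c x) (schur3 c x y) (schur4 c x y w)) <= 16.
Proof.
  intros hc hx hy hw.
  eapply Rle_trans; [|apply (poly_bound (Cmod c) (Cmod x) (Cmod y));
    split; try assumption; apply Cmod_ge_0].
  rewrite H_schur_expand; cbv zeta.
  unfold modA, modB, modC, modD, gain; cbv zeta.
  pose proof (Cmod_ge_0 c); pose proof (Cmod_ge_0 x);
  pose proof (Cmod_ge_0 y); pose proof (Cmod_ge_0 w).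
  set (p := (c ^ 2)%C).
  assert (hp : Cmod p = Cmod c ^ 2) by (unfold p; apply Cmod_pow).
  assert (hp0 := Cmod_ge_0 p).
  assert (hrho := re_le_Cmod (Cconj p * x)%C).
  rewrite Cmod_mult, Cmod_conj, hp in hrho. apply Rabs_le_between in hrho.
  set (rho := Re (Cconj p * x)%C) in *.
  assert (hrho' : Re (p * Cconj x)%C = rho).
  { unfold rho. rewrite !re_mult, !re_conj, !im_conj. ring. }
  set (n := Cmod c ^ 2) in *.
  assert (hn : 0 <= n <= 1) by (apply sq_unit; lra).
  set (X := Cmod x) in *. set (t := 1 - n). set (s := 1 - X ^ 2).
  assert (hX2 : 0 <= X ^ 2 <= 1) by (apply sq_unit; lra).
  assert (ht : 0 <= t <= 1) by (unfold t; lra).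
  assert (hs : 0 <= s <= 1) by (unfold s; lra).
  set (v := 1 - Cmod y ^ 2).
  assert (hy2 : 0 <= Cmod y ^ 2 <= 1) by (apply sq_unit; lra).
  assert (hv : 0 <= v <= 1) by (unfold v; lra).
  set (u := t * (27 * t + 56 / 3 * n)). set (q := t * (9 * t ^ 2 + 24 * t * n + 18 * n ^ 2)).
  assert (htn : 0 <= t * n) by (apply Rmult_le_pos; lra).
  assert (hu : 0 <= u) by (unfold u; apply Rmult_le_pos; lra).
  assert (hq : 0 <= q) by (unfold q; apply Rmult_le_pos; nra).
  set (a := 16 * t * s + 18 * t * X ^ 2).
  assert (ha : 0 <= a) by (unfold a; assert (0 <= t * s) by nra; assert (0 <= t * X ^ 2) by nra; lra).
  assert (hnX : 0 <= n * X) by nra.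
  assert (hd : 0 <= n * X - rho) by lra.
  assert (hd' : 0 <= n * X + rho) by lra.
  assert (hsX : 36 * (s * (2 - X ^ 2) * X) <= 27 + 24 * X).
  { assert (48 * X - 72 * X ^ 3 <= 27) by (pose proof (pow2_ge_0 (2 * X - 1)); nra).
    assert (0 <= s * X) by nra. unfold s in *. nra. }
  assert (hs2 : 0 <= s * (2 - X ^ 2) <= 2) by (split; [apply Rmult_le_pos|]; nra).
  (* The angles of the two corrected sums are supplementary: the first correction
     is proportional to [n * X - rho], the second one to [n * X + rho]. *)
  assert (T1 : Cmod (RtoC u * p + RtoC q * x) <=
     u * n + q * X - 18 * t ^ 2 * (s * (2 - X ^ 2)) * (n * X - rho)).
  { assert (E1 : Cmod (RtoC u * p)%C = u * n) by
      (rewrite Cmod_mult, Cmod_RtoC_nonneg, hp; auto).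
    assert (E2 : Cmod (RtoC q * x)%C = q * X) by
      (rewrite Cmod_mult, Cmod_RtoC_nonneg; auto).
    assert (ht2 : 0 <= t ^ 2) by (apply pow_le; lra).
    rewrite <- E1, <- E2. apply Cmod_triangle_gain; rewrite E1, E2.
    - split.
      + apply Rmult_le_pos; [|exact hd]. apply Rmult_le_pos; lra.
      + apply Rle_trans with (t ^ 2 * n * (36 * (s * (2 - X ^ 2) * X))).
        * replace (t ^ 2 * n * (36 * (s * (2 - X ^ 2) * X))) with
            (18 * t ^ 2 * (s * (2 - X ^ 2)) * (2 * (n * X))) by ring.
          apply Rmult_le_compat_l; [apply Rmult_le_pos; lra|lra].
        * apply Rle_trans with (t ^ 2 * n * (27 + 24 * X)).
          { apply Rmult_le_compat_l; [apply Rmult_le_pos; lra|exact hsX]. }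
          unfold u, q.
          assert (0 <= t * n ^ 2) by (apply Rmult_le_pos; [lra|apply pow_le; lra]).
          assert (0 <= t ^ 3 * X) by (apply Rmult_le_pos; [apply pow_le|]; lra).
          assert (0 <= t * n ^ 2 * X) by (apply Rmult_le_pos; lra).
          nra.
    - replace (Re (Cconj (RtoC u * p) * (RtoC q * x))%C) with (u * q * rho).
      2:{ unfold rho. rewrite Cmult_conj, ?re_mult, ?im_mult, ?re_conj, ?im_conj. simpl. ring. }
      pose proof (correction_admissible n X hn ltac:(lra)) as K.
      apply (Rmult_le_compat_l (t ^ 2 * (n * X - rho))) in K; [|apply Rmult_le_pos; lra].
      fold t in K. fold s in K. unfold u, q. lra. }
  assert (T2 : Cmod (RtoC a + RtoC (- 18) * (p * Cconj x)) <=
     a + 18 * n * X - 18 * X ^ 2 * t * (2 - X ^ 2) * (n * X + rho)).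
  { assert (E1 : Cmod (RtoC a) = a) by (apply Cmod_RtoC_nonneg; auto).
    assert (E2 : Cmod (RtoC (- 18) * (p * Cconj x))%C = 18 * n * X).
    { rewrite !Cmod_mult, Cmod_conj, Cmod_R, hp, Rabs_left by lra. fold X; ring. }
    assert (hX3 : 0 <= X ^ 2 * (2 - X ^ 2) <= 1) by nra.
    assert (hk : 0 <= X ^ 2 * t * (2 - X ^ 2)) by (apply Rmult_le_pos; nra).
    assert (hk' : X ^ 2 * t * (2 - X ^ 2) <= t) by nra.
    eapply Rle_trans; [apply (Cmod_triangle_gain _ _
      (18 * X ^ 2 * t * (2 - X ^ 2) * (n * X + rho))) | rewrite E1, E2; lra]; rewrite E1, E2.
    - split.
      + apply Rmult_le_pos; [lra|exact hd'].
      + apply Rle_trans with (18 * t * (2 * (n * X))).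
        * apply Rle_trans with (18 * t * (n * X + rho)); [|nra].
          apply Rmult_le_compat_r; lra.
        * assert (4 * (t * n) <= 1) by (unfold t; pose proof (pow2_ge_0 (2 * n - 1)); nra).
          assert (36 * (t * n) * X <= 9 * X) by nra.
          assert (16 * t <= a) by (unfold a, s; nra).
          assert (16 * X <= 16 * t + 18 * n * X) by (unfold t; nra).
          lra.
    - replace (Re (Cconj (RtoC a) * (RtoC (- 18) * (p * Cconj x)))%C) with (- 18 * a * rho).
      2:{ rewrite <- hrho'. rewrite ?re_mult, ?im_mult, ?re_conj, ?im_conj. simpl. ring. }
      assert (K : 18 * X ^ 2 * t * (2 - X ^ 2) * (a + 18 * n * X) <= 18 * a).
      { apply Rle_trans with (18 * (X ^ 2 * (2 - X ^ 2)) * (t * (a + 18 * n * X))); [right; ring|].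
        assert (K1 : 18 * (X ^ 2 * (2 - X ^ 2)) * X <= 16 + 2 * X ^ 2).
        { assert (X ^ 2 * (2 - X ^ 2) * X <= X ^ 2 * (2 - X ^ 2) * ((1 + X ^ 2) / 2)) by
            (apply Rmult_le_compat_l; nra).
          nra. }
        assert (K2 : 18 * (X ^ 2 * (2 - X ^ 2)) * X * (n * t) <= n * a).
        { apply Rle_trans with ((16 + 2 * X ^ 2) * (n * t)).
          - apply Rmult_le_compat_r; nra.
          - right; unfold a, s; ring. }
        assert (K3 : X ^ 2 * (2 - X ^ 2) * (t * a) <= 1 * (t * a)) by
          (apply Rmult_le_compat_r; nra).
        unfold t in *. nra. }
      apply (Rmult_le_compat_r (n * X + rho)) in K; [lra|exact hd']. }
  assert (Tri : forall z1 z2 z3 z4 z5 z6 z7 : C,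
     Cmod (z1 + z2 - z3 + z4 + z5 - z6 + z7) <=
     Cmod z1 + Cmod z2 + Cmod z3 + Cmod z4 + Cmod z5 + Cmod z6 + Cmod z7).
  { intros. unfold Cminus.
    repeat (eapply Rle_trans; [apply Cmod_triangle|apply Rplus_le_compat_r]).
    all: rewrite ?Cmod_opp; try apply Rle_refl.
    repeat (eapply Rle_trans; [apply Cmod_triangle|apply Rplus_le_compat]);
      rewrite ?Cmod_opp; lra. }
  eapply Rle_trans; [apply Tri|].
  assert (hts : 0 <= t * s) by (apply Rmult_le_pos; lra).
  assert (htsv : 0 <= t * s * v) by (apply Rmult_le_pos; lra).
  assert (Z1 : Cmod (RtoC (- (49 / 9)) * c ^ 6) = 49 / 9 * n ^ 3).
  { rewrite Cmod_mult, Cmod_R, Cmod_pow, Rabs_left by lra. unfold n; ring. }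
  assert (Z2 : Cmod (RtoC (13 * t) * (c ^ 4 * x)) = 13 * t * n ^ 2 * X).
  { rewrite !Cmod_mult, Cmod_R, Cmod_pow, Rabs_pos_eq by lra. unfold n, X; ring. }
  assert (Z3 : Cmod (x ^ 2 * (RtoC u * p + RtoC q * x)) <=
     X ^ 2 * (u * n + q * X - 18 * t ^ 2 * (s * (2 - X ^ 2)) * (n * X - rho))).
  { rewrite Cmod_mult, Cmod_pow. apply Rmult_le_compat_l; [apply hX2|exact T1]. }
  assert (Z4 : Cmod (RtoC (2 * t ^ 2) * (Cconj c ^ 2 * x ^ 4)) = 2 * t ^ 2 * n * X ^ 4).
  { assert (0 <= t ^ 2) by (apply pow_le; lra).
    rewrite !Cmod_mult, Cmod_R, !Cmod_pow, Cmod_conj, Rabs_pos_eq by lra.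
    unfold n, X; ring. }
  assert (Z5 : Cmod (RtoC (t * s) * ((RtoC (56 / 3) * c ^ 3 + RtoC (24 * t + 36 * n) * (c * x)
                 + RtoC (- 4 * t) * (Cconj c * x ^ 2)) * y)) <=
     t * s * (56 / 3 * Cmod c ^ 3 + (24 * t + 36 * n) * Cmod c * X
              + 4 * t * Cmod c * X ^ 2) * Cmod y).
  { rewrite !Cmod_mult, Cmod_R, Rabs_pos_eq, <- Rmult_assoc by lra.
    apply Rmult_le_compat_r; [lra|]. apply Rmult_le_compat_l; [lra|].
    eapply Rle_trans; [apply Cmod_triangle|].
    eapply Rle_trans; [apply Rplus_le_compat_r, Cmod_triangle|].
    rewrite !Cmod_mult, !Cmod_R, !Cmod_pow, Cmod_conj.
    rewrite (Rabs_pos_eq (56 / 3)), (Rabs_pos_eq (24 * t + 36 * n)),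
      (Rabs_left1 (- 4 * t)) by lra.
    fold X. lra. }
  assert (Z6 : Cmod (RtoC (t * s) * ((RtoC a + RtoC (- 18) * (p * Cconj x)) * y ^ 2)) <=
     t * s * (a + 18 * n * X - 18 * X ^ 2 * t * (2 - X ^ 2) * (n * X + rho)) * Cmod y ^ 2).
  { rewrite !Cmod_mult, Cmod_R, Cmod_pow, Rabs_pos_eq, <- Rmult_assoc by lra.
    apply Rmult_le_compat_r; [lra|]. apply Rmult_le_compat_l; [lra|]. exact T2. }
  assert (Z7 : Cmod (RtoC (18 * t * s * v) * ((RtoC t * x - p) * w)) <=
     18 * t * s * v * (t * X + n)).
  { rewrite !Cmod_mult, Cmod_R, Rabs_pos_eq by lra.
    apply Rmult_le_compat_l; [lra|].
    rewrite <- (Rmult_1_r (t * X + n)).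
    apply Rmult_le_compat; try apply Cmod_ge_0; [|exact hw].
    unfold Cminus. eapply Rle_trans; [apply Cmod_triangle|].
    rewrite Cmod_opp, Cmod_mult, Cmod_R, Rabs_pos_eq, hp by lra. fold X; lra. }
  (* the correction of the term of degree 0 in [y] is weakened by the factor
     [Cmod y ^ 2], so that it can be added to that of the term of degree 2 *)
  assert (Z8 : X ^ 2 * (18 * t ^ 2 * (s * (2 - X ^ 2)) * (n * X - rho)) * Cmod y ^ 2
     <= X ^ 2 * (18 * t ^ 2 * (s * (2 - X ^ 2)) * (n * X - rho))).
  { rewrite <- Rmult_1_r. apply Rmult_le_compat_l; [|lra].
    apply Rmult_le_pos; [lra|]. apply Rmult_le_pos; [|exact hd].
    apply Rmult_le_pos; [|lra]. assert (0 <= t ^ 2) by (apply pow_le; lra). lra. }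
  rewrite Z1, Z2, Z4.
  eapply Rle_trans; [repeat apply Rplus_le_compat;
    first [exact Z3|exact Z5|exact Z6|exact Z7|apply Rle_refl]|].
  unfold u, q, a, v in *. fold X t s. lra.
Qed.

(** * Complex differentiation *)

Lemma Cmod_minus_triangle (a b : C) : Cmod (a - b) <= Cmod a + Cmod b.
Proof. unfold Cminus; rewrite <- (Cmod_opp b); apply Cmod_triangle. Qed.

Lemma Cmod_minus_sym (a b : C) : Cmod (a - b) = Cmod (b - a).
Proof. rewrite <- Cmod_opp. f_equal; ring. Qed.

(** [phi h] tends to [l] when [h] tends to 0. The value at [h = 0] is included, so that
    [phi 0 = l]. *)
Definition lim0 (phi : C -> C) (l : C) : Prop :=
  forall eps, 0 < eps -> exists del, 0 < del /\
    forall h : C, Cmod h < del -> Cmod (phi h - l) < eps.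

(** [l] is the complex derivative of [f] at [z], in terms of the modulus. *)
Definition cdiff (f : C -> C) (z l : C) : Prop :=
  forall eps, 0 < eps -> exists del, 0 < del /\
    forall h : C, Cmod h < del -> Cmod (f (z + h) - f z - h * l)%C <= eps * Cmod h.

Lemma lim0_const (l : C) : lim0 (fun _ => l) l.
Proof.
  intros eps He; exists 1; split; [lra|]; intros h _.
  replace (l - l)%C with (RtoC 0) by ring. rewrite Cmod_0; lra.
Qed.

Lemma lim0_id : lim0 (fun h => h) 0%C.
Proof.
  intros eps He; exists eps; split; [lra|]; intros h Hh.
  replace (h - 0)%C with h by ring. exact Hh.
Qed.

Lemma lim0_plus (f g : C -> C) (a b : C) :
  lim0 f a -> lim0 g b -> lim0 (fun h => f h + g h)%C (a + b)%C.
Proof.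
  intros Hf Hg eps He.
  destruct (Hf (eps / 2) ltac:(lra)) as (d1 & P1 & H1).
  destruct (Hg (eps / 2) ltac:(lra)) as (d2 & P2 & H2).
  exists (Rmin d1 d2); split; [apply Rmin_pos; assumption|]; intros h Hh.
  pose proof (Rmin_l d1 d2); pose proof (Rmin_r d1 d2).
  replace (f h + g h - (a + b))%C with ((f h - a) + (g h - b))%C by ring.
  eapply Rle_lt_trans; [apply Cmod_triangle|].
  specialize (H1 h ltac:(lra)); specialize (H2 h ltac:(lra)); lra.
Qed.

Lemma lim0_mult (f g : C -> C) (a b : C) :
  lim0 f a -> lim0 g b -> lim0 (fun h => f h * g h)%C (a * b)%C.
Proof.
  intros Hf Hg eps He.
  pose proof (Cmod_ge_0 a) as Ha; pose proof (Cmod_ge_0 b) as Hb.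
  set (e := Rmin 1 (eps / (2 * (1 + Cmod a + Cmod b)))).
  assert (He' : 0 < eps / (2 * (1 + Cmod a + Cmod b))) by (apply Rdiv_lt_0_compat; lra).
  assert (Pe : 0 < e) by (apply Rmin_pos; lra).
  assert (Le1 : e <= 1) by apply Rmin_l.
  assert (Le2 : e * (1 + Cmod a + Cmod b) <= eps / 2).
  { apply Rle_trans with (eps / (2 * (1 + Cmod a + Cmod b)) * (1 + Cmod a + Cmod b)).
    - apply Rmult_le_compat_r; [lra|apply Rmin_r].
    - right; field; lra. }
  destruct (Hf e Pe) as (d1 & P1 & H1). destruct (Hg e Pe) as (d2 & P2 & H2).
  exists (Rmin d1 d2); split; [apply Rmin_pos; assumption|]; intros h Hh.
  pose proof (Rmin_l d1 d2); pose proof (Rmin_r d1 d2).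
  specialize (H1 h ltac:(lra)); specialize (H2 h ltac:(lra)).
  replace (f h * g h - a * b)%C with
    ((f h - a) * (g h - b) + (a * (g h - b) + (f h - a) * b))%C by ring.
  eapply Rle_lt_trans; [apply Cmod_triangle|].
  eapply Rle_lt_trans; [apply Rplus_le_compat_l, Cmod_triangle|].
  rewrite !Cmod_mult.
  pose proof (Cmod_ge_0 (f h - a)); pose proof (Cmod_ge_0 (g h - b)).
  nra.
Qed.

Lemma lim0_inv (f : C -> C) (a : C) :
  a <> 0%C -> lim0 f a -> lim0 (fun h => / f h)%C (/ a)%C.
Proof.
  intros Na Hf eps He.
  assert (Pa : 0 < Cmod a) by (apply Cmod_gt_0; exact Na).
  set (e := Rmin (Cmod a / 2) (eps * (Cmod a * Cmod a) / 4)).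
  assert (0 < Cmod a * Cmod a) by nra.
  assert (Pe : 0 < e) by (apply Rmin_pos; [lra|]; apply Rmult_lt_0_compat; [|lra]; nra).
  destruct (Hf e Pe) as (d & P & H1). exists d; split; [exact P|]; intros h Hh.
  specialize (H1 h Hh).
  assert (e <= Cmod a / 2) by apply Rmin_l.
  assert (e <= eps * (Cmod a * Cmod a) / 4) by apply Rmin_r.
  assert (Hfh : Cmod a / 2 <= Cmod (f h)).
  { pose proof (Cmod_triangle (f h) (a - f h)) as T.
    replace (f h + (a - f h))%C with a in T by ring.
    rewrite (Cmod_minus_sym a) in T. lra. }
  assert (Nf : f h <> 0%C) by (apply Cmod_gt_0; lra).
  replace (/ f h - / a)%C with (- ((f h - a) * / (f h * a)))%C by (field; auto).
  rewrite Cmod_opp, Cmod_mult, Cmod_inv, Cmod_mult by (apply Cmult_neq_0; auto).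
  apply Rmult_lt_reg_r with (Cmod (f h) * Cmod a); [nra|].
  rewrite Rmult_assoc, Rinv_l by nra. nra.
Qed.

Lemma lim0_comp (f g : C -> C) (l : C) :
  lim0 f l -> lim0 g 0%C -> lim0 (fun h => f (g h)) l.
Proof.
  intros Hf Hg eps He. destruct (Hf eps He) as (d & P & H).
  destruct (Hg d P) as (d' & P' & H'). exists d'; split; [exact P'|]; intros h Hh.
  apply H. specialize (H' h Hh). replace (g h - 0)%C with (g h) in H' by ring. exact H'.
Qed.

(** Caratheodory's form of differentiability. *)
Lemma cdiff_slope (f : C -> C) (z l : C) :
  cdiff f z l <-> exists phi, lim0 phi l /\ exists del, 0 < del /\
    forall h : C, Cmod h < del -> f (z + h)%C = (f z + h * phi h)%C.
Proof.
  split.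
  - intro H. exists (fun h => if Ceq_dec h 0 then l else ((f (z + h) - f z) / h)%C).
    split; [|exists 1; split; [lra|]].
    + intros eps He. destruct (H (eps / 2) ltac:(lra)) as (d & P & Hd).
      exists d; split; [exact P|]; intros h Hh. destruct (Ceq_dec h 0) as [E|N].
      * replace (l - l)%C with (RtoC 0) by ring. rewrite Cmod_0; lra.
      * assert (Ph : 0 < Cmod h) by (apply Cmod_gt_0; exact N).
        replace ((f (z + h)%C - f z) / h - l)%C
          with ((f (z + h)%C - f z - h * l) / h)%C by (field; exact N).
        rewrite Cmod_div by exact N. specialize (Hd h Hh).
        apply Rle_lt_trans with (eps / 2); [|lra].
        apply Rmult_le_reg_r with (Cmod h); [exact Ph|].
        unfold Rdiv at 1; rewrite Rmult_assoc, Rinv_l by lra. lra.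
    + intros h _. destruct (Ceq_dec h 0) as [E|N].
      * rewrite E, Cplus_0_r. ring.
      * field; exact N.
  - intros (phi & Hl & del & Pd & E) eps He. destruct (Hl eps He) as (d & P & Hd).
    exists (Rmin d del); split; [apply Rmin_pos; assumption|]; intros h Hh.
    pose proof (Rmin_l d del); pose proof (Rmin_r d del).
    rewrite E by lra. replace (f z + h * phi h - f z - h * l)%C with ((phi h - l) * h)%C by ring.
    rewrite Cmod_mult. apply Rmult_le_compat_r; [apply Cmod_ge_0|].
    apply Rlt_le, Hd; lra.
Qed.

Lemma cdiff_lim0 (f : C -> C) (z l : C) : cdiff f z l -> lim0 (fun h => f (z + h)%C) (f z).
Proof.
  intro H; apply cdiff_slope in H; destruct H as (phi & Hl & del & Pd & E).
  assert (L : lim0 (fun h => f z + h * phi h)%C (f z + 0 * l)%C).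
  { apply lim0_plus; [apply lim0_const|]. apply lim0_mult; [apply lim0_id|exact Hl]. }
  intros eps He. destruct (L eps He) as (d & P & Hd).
  exists (Rmin d del); split; [apply Rmin_pos; assumption|]; intros h Hh.
  pose proof (Rmin_l d del); pose proof (Rmin_r d del).
  rewrite E by lra. specialize (Hd h ltac:(lra)).
  replace (f z + 0 * l)%C with (f z) in Hd by ring. exact Hd.
Qed.

Lemma cdiff_ext_loc (f g : C -> C) (z l : C) (del : R) :
  0 < del -> (forall h : C, Cmod h < del -> f (z + h)%C = g (z + h)%C) ->
  cdiff f z l -> cdiff g z l.
Proof.
  intros Pd E H eps He. destruct (H eps He) as (d & P & Hd).
  exists (Rmin d del); split; [apply Rmin_pos; assumption|]; intros h Hh.
  pose proof (Rmin_l d del); pose proof (Rmin_r d del).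
  assert (E0 : f z = g z).
  { specialize (E 0%C). rewrite Cmod_0, Cplus_0_r in E. auto. }
  rewrite <- E, <- E0 by lra. apply Hd; lra.
Qed.

Lemma cdiff_unique (f : C -> C) (z a b : C) : cdiff f z a -> cdiff f z b -> a = b.
Proof.
  intros Ha Hb. apply Ceq_minus. apply Cmod_eq_0.
  destruct (Rle_lt_or_eq_dec 0 (Cmod (a - b)) (Cmod_ge_0 _)) as [P|]; [exfalso|auto].
  destruct (Ha (Cmod (a - b) / 4) ltac:(lra)) as (d1 & P1 & H1).
  destruct (Hb (Cmod (a - b) / 4) ltac:(lra)) as (d2 & P2 & H2).
  set (r := Rmin d1 d2 / 2).
  assert (Pm : 0 < Rmin d1 d2) by (apply Rmin_pos; assumption).
  pose proof (Rmin_l d1 d2); pose proof (Rmin_r d1 d2).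
  assert (Er : Cmod (RtoC r) = r) by (rewrite Cmod_R; apply Rabs_pos_eq; unfold r; lra).
  specialize (H1 (RtoC r)); specialize (H2 (RtoC r)). rewrite Er in H1, H2.
  specialize (H1 ltac:(unfold r; lra)); specialize (H2 ltac:(unfold r; lra)).
  pose proof (Cmod_minus_triangle (f (z + r)%C - f z - r * b) (f (z + r)%C - f z - r * a)) as T.
  replace (f (z + r)%C - f z - r * b - (f (z + r)%C - f z - r * a))%C
    with (r * (a - b))%C in T by ring.
  rewrite Cmod_mult, Er in T.
  assert (0 < r) by (unfold r; lra). nra.
Qed.

Lemma cdiff_const (k z : C) : cdiff (fun _ => k) z 0%C.
Proof.
  apply cdiff_slope. exists (fun _ => 0%C); split; [apply lim0_const|].
  exists 1; split; [lra|]; intros; ring.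
Qed.

Lemma cdiff_id (z : C) : cdiff (fun w => w) z 1%C.
Proof.
  apply cdiff_slope. exists (fun _ => 1%C); split; [apply lim0_const|].
  exists 1; split; [lra|]; intros; ring.
Qed.

Lemma cdiff_plus (f g : C -> C) (z a b : C) :
  cdiff f z a -> cdiff g z b -> cdiff (fun w => f w + g w)%C z (a + b)%C.
Proof.
  intros Hf Hg. apply cdiff_slope in Hf as (p & Lp & d1 & P1 & E1).
  apply cdiff_slope in Hg as (q & Lq & d2 & P2 & E2).
  apply cdiff_slope. exists (fun h => p h + q h)%C; split; [apply lim0_plus; assumption|].
  exists (Rmin d1 d2); split; [apply Rmin_pos; assumption|]; intros h Hh.
  pose proof (Rmin_l d1 d2); pose proof (Rmin_r d1 d2).
  rewrite E1, E2 by lra. ring.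
Qed.

Lemma cdiff_mult (f g : C -> C) (z a b : C) :
  cdiff f z a -> cdiff g z b -> cdiff (fun w => f w * g w)%C z (a * g z + f z * b)%C.
Proof.
  intros Hf Hg. assert (Cg := cdiff_lim0 _ _ _ Hg).
  apply cdiff_slope in Hf as (p & Lp & d1 & P1 & E1).
  apply cdiff_slope in Hg as (q & Lq & d2 & P2 & E2).
  apply cdiff_slope. exists (fun h => p h * g (z + h) + f z * q h)%C; split.
  - apply lim0_plus; apply lim0_mult; try assumption. apply lim0_const.
  - exists (Rmin d1 d2); split; [apply Rmin_pos; assumption|]; intros h Hh.
    pose proof (Rmin_l d1 d2); pose proof (Rmin_r d1 d2).
    rewrite E1, E2 by lra. ring.
Qed.

Lemma cdiff_inv (f : C -> C) (z a : C) :
  f z <> 0%C -> cdiff f z a -> cdiff (fun w => / f w)%C z (- a * (/ f z * / f z))%C.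
Proof.
  intros Nz Hf. assert (Cf := cdiff_lim0 _ _ _ Hf).
  assert (Pz : 0 < Cmod (f z)) by (apply Cmod_gt_0; exact Nz).
  apply cdiff_slope in Hf as (p & Lp & d1 & P1 & E1).
  destruct (Cf (Cmod (f z)) Pz) as (d2 & P2 & H2).
  apply cdiff_slope. exists (fun h => (-1 * p h) * (/ f (z + h) * / f z))%C; split.
  - replace (- a * (/ f z * / f z))%C with ((-1 * a) * (/ f z * / f z))%C by ring.
    apply lim0_mult; apply lim0_mult; try assumption; try apply lim0_const.
    apply lim0_inv; assumption.
  - exists (Rmin d1 d2); split; [apply Rmin_pos; assumption|]; intros h Hh.
    pose proof (Rmin_l d1 d2); pose proof (Rmin_r d1 d2).
    assert (N : f (z + h)%C <> 0%C).
    { intro E. specialize (H2 h ltac:(lra)). rewrite E in H2.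
      replace (0 - f z)%C with (- f z)%C in H2 by ring. rewrite Cmod_opp in H2. lra. }
    rewrite E1 in N |- * by lra. field; auto.
Qed.

Lemma cdiff_comp (f g : C -> C) (z a b : C) :
  cdiff f (g z) a -> cdiff g z b -> cdiff (fun w => f (g w)) z (b * a)%C.
Proof.
  intros Hf Hg.
  apply cdiff_slope in Hf as (p & Lp & d1 & P1 & E1).
  apply cdiff_slope in Hg as (q & Lq & d2 & P2 & E2).
  assert (L : lim0 (fun h => h * q h)%C 0%C).
  { replace (RtoC 0) with (0 * b)%C by ring. apply lim0_mult; [apply lim0_id|exact Lq]. }
  destruct (L d1 P1) as (d3 & P3 & H3).
  apply cdiff_slope. exists (fun h => q h * p (h * q h))%C; split.
  - apply lim0_mult; [exact Lq|]. apply (lim0_comp p (fun h => h * q h)%C); assumption.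
  - exists (Rmin d2 d3); split; [apply Rmin_pos; assumption|]; intros h Hh.
    pose proof (Rmin_l d2 d3); pose proof (Rmin_r d2 d3).
    specialize (H3 h ltac:(lra)). replace (h * q h - 0)%C with (h * q h)%C in H3 by ring.
    rewrite E2, E1 by lra. ring.
Qed.

(** Agreement with [is_derive] over the field of complex numbers. *)
Lemma is_derive_cdiff (f : C -> C) (z l : C) :
  is_derive (K := C_AbsRing) (V := C_NormedModule) f z l <-> cdiff f z l.
Proof.
  split.
  - intros [_ H] eps He.
    specialize (H z (fun P HP => HP) (mkposreal eps He)).
    destruct H as [d Hd]. exists d; split; [apply cond_pos|]; intros h Hh.
    assert (E1 : ((z + h) - z)%C = h) by ring.
    specialize (Hd (z + h)%C).
    assert (B : ball (M := AbsRing_UniformSpace C_AbsRing) z d (z + h)%C).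
    { change (Cmod ((z + h) - z)%C < d). rewrite E1. exact Hh. }
    specialize (Hd B). cbv beta in Hd.
    change (Cmod ((f (z + h)%C - f z) - ((z + h) - z) * l)%C
            <= eps * Cmod ((z + h) - z)%C) in Hd.
    rewrite E1 in Hd. exact Hd.
  - intros H. split; [apply (is_linear_scal_l (K := C_AbsRing) (V := C_NormedModule))|].
    intros x Hx. apply (is_filter_lim_locally_unique (K := C_AbsRing)
      (V := AbsRing_NormedModule C_AbsRing)) in Hx.
    subst x. intros eps. destruct (H eps (cond_pos eps)) as (d & P & Hd).
    exists (mkposreal d P). intros y Hy.
    change (Cmod (y - z)%C < d) in Hy.
    change (Cmod ((f y - f z) - (y - z) * l)%C <= eps * Cmod (y - z)%C).
    assert (E1 : forall u v : C, (v + (u - v))%C = u) by (intros; ring).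
    specialize (Hd (y - z)%C Hy). rewrite E1 in Hd. exact Hd.
Qed.

(** * The maximum principle on the punctured disk *)

(** The punctured unit disk. *)
Definition pdisk (z : C) : Prop := z <> 0%C /\ Cmod z < 1.

(** Functions with one, respectively two, complex derivatives on the punctured disk. *)
Definition hol1 (f : C -> C) : Prop :=
  exists f1, forall z, pdisk z -> cdiff f z (f1 z).
Definition hol2 (f : C -> C) : Prop :=
  exists f1, (forall z, pdisk z -> cdiff f z (f1 z)) /\ hol1 f1.

Lemma hol1_const (k : C) : hol1 (fun _ => k).
Proof. exists (fun _ => 0%C). intros; apply cdiff_const. Qed.

Lemma hol1_plus (f g : C -> C) : hol1 f -> hol1 g -> hol1 (fun z => f z + g z)%C.
Proof.
  intros [f1 Hf] [g1 Hg]. exists (fun z => f1 z + g1 z)%C. intros; apply cdiff_plus; auto.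
Qed.

Lemma hol1_mult (f g : C -> C) : hol1 f -> hol1 g -> hol1 (fun z => f z * g z)%C.
Proof.
  intros [f1 Hf] [g1 Hg]. exists (fun z => f1 z * g z + f z * g1 z)%C.
  intros; apply cdiff_mult; auto.
Qed.

Lemma hol1_inv (f : C -> C) :
  (forall z, pdisk z -> f z <> 0%C) -> hol1 f -> hol1 (fun z => / f z)%C.
Proof.
  intros N [f1 Hf]. exists (fun z => - f1 z * (/ f z * / f z))%C.
  intros; apply cdiff_inv; auto.
Qed.

Lemma hol2_hol1 (f : C -> C) : hol2 f -> hol1 f.
Proof. intros (f1 & H & _). exists f1; exact H. Qed.

Lemma hol2_const (k : C) : hol2 (fun _ => k).
Proof. exists (fun _ => 0%C). split; [intros; apply cdiff_const|apply hol1_const]. Qed.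

Lemma hol2_id : hol2 (fun z => z).
Proof. exists (fun _ => 1%C). split; [intros; apply cdiff_id|apply hol1_const]. Qed.

Lemma hol2_plus (f g : C -> C) : hol2 f -> hol2 g -> hol2 (fun z => f z + g z)%C.
Proof.
  intros (f1 & Hf & Hf1) (g1 & Hg & Hg1). exists (fun z => f1 z + g1 z)%C.
  split; [intros; apply cdiff_plus; auto|apply hol1_plus; auto].
Qed.

Lemma hol2_mult (f g : C -> C) : hol2 f -> hol2 g -> hol2 (fun z => f z * g z)%C.
Proof.
  intros Hf Hg. assert (If := hol2_hol1 _ Hf). assert (Ig := hol2_hol1 _ Hg).
  destruct Hf as (f1 & Hf & Hf1). destruct Hg as (g1 & Hg & Hg1).
  exists (fun z => f1 z * g z + f z * g1 z)%C.
  split; [intros; apply cdiff_mult; auto|apply hol1_plus; apply hol1_mult; auto].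
Qed.

Lemma hol2_inv (f : C -> C) :
  (forall z, pdisk z -> f z <> 0%C) -> hol2 f -> hol2 (fun z => / f z)%C.
Proof.
  intros N Hf. assert (If := hol1_inv _ N (hol2_hol1 _ Hf)).
  destruct Hf as (f1 & Hf & Hf1).
  exists (fun z => - 1 * f1 z * (/ f z * / f z))%C. split.
  - intros z Hz. replace (- 1 * f1 z)%C with (- f1 z)%C by ring. apply cdiff_inv; auto.
  - apply hol1_mult; apply hol1_mult; auto using hol1_const.
Qed.

Lemma pdisk_near (z h : C) : pdisk z -> Cmod h < Rmin (Cmod z) (1 - Cmod z) -> pdisk (z + h)%C.
Proof.
  intros [Nz Lz] Hh. pose proof (Rmin_l (Cmod z) (1 - Cmod z)).
  pose proof (Rmin_r (Cmod z) (1 - Cmod z)). split.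
  - intro E0. assert (h = (- z)%C) by (rewrite <- (Cplus_0_l (- z)%C), <- E0; ring).
    subst h. rewrite Cmod_opp in Hh. lra.
  - eapply Rle_lt_trans; [apply Cmod_triangle|lra].
Qed.

Lemma hol2_ext (f g : C -> C) : (forall z, pdisk z -> f z = g z) -> hol2 f -> hol2 g.
Proof.
  intros E (f1 & Hf & Hf1). exists f1; split; [|exact Hf1]. intros z Hz.
  assert (Pz : 0 < Cmod z) by (apply Cmod_gt_0, Hz).
  apply (cdiff_ext_loc f _ _ _ (Rmin (Cmod z) (1 - Cmod z))).
  - apply Rmin_pos; [exact Pz|]. pose proof (proj2 Hz). lra.
  - intros h Hh. apply E, pdisk_near; assumption.
  - apply Hf, Hz.
Qed.

(** Restriction of a complex derivative to a line. *)
Lemma cdiff_line (f : C -> C) (z u l : C) (t : R) :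
  cdiff f (z + RtoC t * u)%C l ->
  is_derive (fun s : R => Re (f (z + RtoC s * u)%C)) t (Re (u * l)%C) /\
  is_derive (fun s : R => Im (f (z + RtoC s * u)%C)) t (Im (u * l)%C).
Proof.
  intro H.
  assert (Key : forall P : C -> R, (forall w, Rabs (P w) <= Cmod w) ->
     (forall a b, P (a - b)%C = P a - P b) -> (forall (r : R) a, P (RtoC r * a)%C = r * P a) ->
     is_derive (fun s : R => P (f (z + RtoC s * u)%C)) t (P (u * l)%C)).
  { intros P HP HPm HPs. apply is_derive_Reals. intros eps He.
    pose proof (Cmod_ge_0 u) as Hu.
    set (e := eps / (2 * (1 + Cmod u))).
    assert (Pe : 0 < e) by (apply Rdiv_lt_0_compat; lra).
    destruct (H e Pe) as (d & Pd & Hd).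
    assert (Pd' : 0 < d / (1 + Cmod u)) by (apply Rdiv_lt_0_compat; lra).
    exists (mkposreal _ Pd'). intros h Nh Hh. simpl in Hh.
    specialize (Hd (RtoC h * u)%C). rewrite Cmod_mult, Cmod_R in Hd.
    assert (Hlt : Rabs h * Cmod u < d).
    { apply Rle_lt_trans with (Rabs h * (1 + Cmod u)).
      - apply Rmult_le_compat_l; [apply Rabs_pos|lra].
      - apply Rmult_lt_reg_r with (/ (1 + Cmod u)); [apply Rinv_0_lt_compat; lra|].
        rewrite Rmult_assoc, Rinv_r by lra. lra. }
    specialize (Hd Hlt).
    replace (z + RtoC t * u + RtoC h * u)%C with (z + RtoC (t + h) * u)%C in Hd
      by (rewrite RtoC_plus; ring).
    assert (Ph : 0 < Rabs h) by (apply Rabs_pos_lt; exact Nh).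
    replace ((P (f (z + RtoC (t + h) * u)%C) - P (f (z + RtoC t * u)%C)) / h - P (u * l)%C)
      with (P (f (z + RtoC (t + h) * u)%C - f (z + RtoC t * u)%C - RtoC h * u * l)%C / h).
    2:{ rewrite !HPm. replace (RtoC h * u * l)%C with (RtoC h * (u * l))%C by ring.
        rewrite HPs. field; exact Nh. }
    unfold Rdiv; rewrite Rabs_mult, Rabs_inv.
    apply Rmult_lt_reg_r with (Rabs h); [exact Ph|].
    rewrite Rmult_assoc, Rinv_l, Rmult_1_r by lra.
    eapply Rle_lt_trans; [apply HP|]. eapply Rle_lt_trans; [exact Hd|].
    assert (e * (1 + Cmod u) = eps / 2) by (unfold e; field; lra).
    assert (e * Cmod u <= eps / 2) by nra. nra. }
  split; apply Key.
  - apply re_le_Cmod.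
  - intros; unfold Cminus; rewrite re_plus, re_opp; ring.
  - intros; apply re_scal_l.
  - intro w. eapply Rle_trans; [apply Rmax_r|apply Rmax_Cmod].
  - intros; unfold Cminus; rewrite im_plus, im_opp; ring.
  - intros; apply im_scal_l.
Qed.

Lemma Cmod_Ci : Cmod Ci = 1.
Proof.
  unfold Cmod, Ci; simpl. replace (0 * (0 * 1) + 1 * (1 * 1)) with 1 by ring. apply sqrt_1.
Qed.

Lemma derive_zero_unit_interval (P : R -> R) :
  (forall t, Rabs t <= 1 -> is_derive P t 0) -> P 1 = P 0.
Proof.
  intro HP. assert (Hone : Rabs (1 - 0) <= 1) by (rewrite Rabs_pos_eq; lra).
  destruct (MVT_cor4 P (fun _ => 0) 0 1
    ltac:(intros c Hc; apply HP; now rewrite Rminus_0_r in Hc) 1 Hone) as (c & Ec & _). lra.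
Qed.

Lemma second_derivative_at_max (h k : R -> R) (m del : R) :
  0 < del -> (forall t, Rabs t < del -> is_derive h t (k t)) ->
  is_derive k 0 m -> (forall t, Rabs t < del -> h t <= h 0) -> m <= 0.
Proof.
  intros Pd Hh Hk Hmax. apply Rnot_lt_le; intro Pm.
  assert (R0 : Rabs 0 < del) by (rewrite Rabs_R0; exact Pd).
  assert (k0 : k 0 = 0).
  { assert (D := Hh 0 R0). apply is_derive_Reals in D.
    apply (deriv_maximum h (- del) del 0 (exist _ _ D)); try lra.
    intros x H1 H2. apply Hmax. apply Rabs_def1; lra. }
  apply is_derive_Reals in Hk. destruct (Hk (m / 2) ltac:(lra)) as [d Hd].
  pose proof (cond_pos d) as Pd'.
  set (t := Rmin del d / 2).
  assert (Pmin : 0 < Rmin del d) by (apply Rmin_pos; assumption).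
  pose proof (Rmin_l del d); pose proof (Rmin_r del d).
  destruct (MVT_cor2 h k 0 t) as (c & Ec & Hc).
  - unfold t; lra.
  - intros c Hc. apply is_derive_Reals, Hh. apply Rabs_def1; unfold t in Hc; lra.
  - assert (Pc : 0 < k c).
    { assert (Nc : c <> 0) by lra.
      specialize (Hd c Nc). rewrite Rplus_0_l, k0, Rminus_0_r in Hd.
      assert (Lc : Rabs c < d) by (apply Rabs_def1; unfold t in Hc; lra).
      specialize (Hd Lc). apply Rabs_def2 in Hd.
      assert (m / 2 < k c / c) by lra.
      replace (k c) with (k c / c * c) by (field; exact Nc). apply Rmult_lt_0_compat; lra. }
    assert (h t <= h 0) by (apply Hmax, Rabs_def1; unfold t; lra).
    assert (0 < k c * (t - 0)) by (apply Rmult_lt_0_compat; lra). lra.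
Qed.

(** The function [|g| ^ 2 + eps |z| ^ 2 + eta ln (|z| ^ 2)]. For a holomorphic [g] its
    Laplacian is [4 |g'| ^ 2 + 4 eps] off the origin. *)
Definition subharm (g : C -> C) (eps eta : R) (z : C) : R :=
  Re (g z) ^ 2 + Im (g z) ^ 2 + eps * (Re z ^ 2 + Im z ^ 2)
  + eta * ln (Re z ^ 2 + Im z ^ 2).

Lemma norm2_pos (z : C) : z <> 0%C -> 0 < Re z ^ 2 + Im z ^ 2.
Proof.
  intro N. rewrite <- Cmod_sqr. apply pow_lt. apply Cmod_gt_0; exact N.
Qed.

(** First derivative of [subharm] along a line, [a] and [b] standing for the real
    and imaginary parts of [g]. *)
Lemma subharm_line (a b a1 b1 : R -> R) (x y p q eps eta t : R) :
  is_derive a t (a1 t) -> is_derive b t (b1 t) -> 0 < (x + t * p) ^ 2 + (y + t * q) ^ 2 ->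
  is_derive (fun s => a s ^ 2 + b s ^ 2 + eps * ((x + s * p) ^ 2 + (y + s * q) ^ 2)
                      + eta * ln ((x + s * p) ^ 2 + (y + s * q) ^ 2)) t
    (2 * (a t * a1 t + b t * b1 t) + 2 * eps * ((x + t * p) * p + (y + t * q) * q)
     + 2 * eta * ((x + t * p) * p + (y + t * q) * q) / ((x + t * p) ^ 2 + (y + t * q) ^ 2)).
Proof.
  intros Ha Hb Hp. auto_derive.
  - repeat split; try (eexists; eassumption). lra.
  - rewrite (is_derive_unique (fun s : R => a s) _ _ Ha), (is_derive_unique (fun s : R => b s) _ _ Hb).
    field. nra.
Qed.

(** The second derivative at the base point. *)
Lemma subharm_line2 (a b a1 b1 : R -> R) (a2 b2 x y p q eps eta : R) :
  is_derive a 0 (a1 0) -> is_derive b 0 (b1 0) ->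
  is_derive a1 0 a2 -> is_derive b1 0 b2 -> 0 < x ^ 2 + y ^ 2 ->
  is_derive (fun t => 2 * (a t * a1 t + b t * b1 t)
       + 2 * eps * ((x + t * p) * p + (y + t * q) * q)
       + 2 * eta * ((x + t * p) * p + (y + t * q) * q)
         / ((x + t * p) ^ 2 + (y + t * q) ^ 2)) 0
    (2 * (a1 0 ^ 2 + b1 0 ^ 2 + a 0 * a2 + b 0 * b2) + 2 * eps * (p ^ 2 + q ^ 2)
     + 2 * eta * (p ^ 2 + q ^ 2) / (x ^ 2 + y ^ 2)
     - 4 * eta * (x * p + y * q) ^ 2 / (x ^ 2 + y ^ 2) ^ 2).
Proof.
  intros Ha Hb Ha1 Hb1 Hp. auto_derive.
  - repeat split; try (eexists; eassumption). rewrite !Rmult_0_l, !Rplus_0_r. nra.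
  - rewrite (is_derive_unique (fun s : R => a s) _ _ Ha), (is_derive_unique (fun s : R => b s) _ _ Hb),
     (is_derive_unique (fun s : R => a1 s) _ _ Ha1), (is_derive_unique (fun s : R => b1 s) _ _ Hb1).
    rewrite !Rmult_0_l, !Rplus_0_r. field. nra.
Qed.

(** [subharm] has no local maximum: the second derivatives in the directions 1 and
    [Ci] would both be nonpositive, but their sum is the Laplacian. *)
Lemma subharm_no_max (g g1 g2 : C -> C) (eps eta del : R) (z : C) :
  0 < eps -> 0 < del -> pdisk z ->
  (forall h, Cmod h < del -> pdisk (z + h)%C) ->
  (forall w, pdisk w -> cdiff g w (g1 w)) -> (forall w, pdisk w -> cdiff g1 w (g2 w)) ->
  (forall h, Cmod h < del -> subharm g eps eta (z + h)%C <= subharm g eps eta z) -> False.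
Proof.
  intros Pe Pd Hz Hloc Hg Hg1 Hmax.
  assert (Dir : forall u : C, Cmod u = 1 ->
    2 * (Re (u * g1 z)%C ^ 2 + Im (u * g1 z)%C ^ 2
         + Re (g z) * Re (u * (u * g2 z))%C + Im (g z) * Im (u * (u * g2 z))%C)
    + 2 * eps * (Re u ^ 2 + Im u ^ 2)
    + 2 * eta * (Re u ^ 2 + Im u ^ 2) / (Re z ^ 2 + Im z ^ 2)
    - 4 * eta * (Re z * Re u + Im z * Im u) ^ 2 / (Re z ^ 2 + Im z ^ 2) ^ 2 <= 0).
  { intros u Hu.
    assert (Hsmall : forall t : R, Rabs t < del -> Cmod (RtoC t * u) < del).
    { intros t Ht. rewrite Cmod_mult, Cmod_R, Hu, Rmult_1_r. exact Ht. }
    assert (Hcoord : forall t : R, Re (z + RtoC t * u)%C = Re z + t * Re u /\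
        Im (z + RtoC t * u)%C = Im z + t * Im u).
    { intro t. rewrite re_plus, im_plus, re_scal_l, im_scal_l. auto. }
    assert (Ez : (z + RtoC 0 * u)%C = z) by ring.
    set (a := fun t : R => Re (g (z + RtoC t * u)%C)).
    set (b := fun t : R => Im (g (z + RtoC t * u)%C)).
    set (a1 := fun t : R => Re (u * g1 (z + RtoC t * u)%C)%C).
    set (b1 := fun t : R => Im (u * g1 (z + RtoC t * u)%C)%C).
    assert (D1 : forall t, Rabs t < del -> is_derive a t (a1 t) /\ is_derive b t (b1 t)).
    { intros t Ht. apply cdiff_line, Hg, Hloc, Hsmall, Ht. }
    assert (H00 : Rabs 0 < del) by (rewrite Rabs_R0; exact Pd).
    assert (D2 : is_derive a1 0 (Re (u * (u * g2 z))%C) /\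
                 is_derive b1 0 (Im (u * (u * g2 z))%C)).
    { apply (cdiff_line (fun w => u * g1 w)%C z u (u * g2 z)%C 0).
      rewrite Ez. pose proof (cdiff_mult _ _ z _ _ (cdiff_const u z) (Hg1 z Hz)) as K.
      cbv beta in K. replace (u * g2 z)%C with (0 * g1 z + u * g2 z)%C by ring. exact K. }
    assert (Hn := norm2_pos z (proj1 Hz)).
    pose proof (subharm_line2 a b a1 b1 _ _ (Re z) (Im z) (Re u) (Im u) eps eta
      (proj1 (D1 0 H00)) (proj2 (D1 0 H00)) (proj1 D2) (proj2 D2) Hn) as K2.
    apply (second_derivative_at_max (fun t => subharm g eps eta (z + RtoC t * u)%C)
      _ _ del Pd) in K2.
    - unfold a, b, a1, b1 in K2. rewrite Ez in K2. exact K2.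
    - intros t Ht. destruct (D1 t Ht) as [Da Db].
      assert (Hnt := norm2_pos _ (proj1 (Hloc _ (Hsmall t Ht)))).
      destruct (Hcoord t) as [-> ->] in Hnt.
      eapply is_derive_ext; [|exact (subharm_line a b a1 b1 _ _ _ _ eps eta t Da Db Hnt)].
      intro s. unfold subharm. destruct (Hcoord s) as [-> ->]. reflexivity.
    - intros t Ht. rewrite Ez. apply Hmax, Hsmall, Ht. }
  assert (Hn := norm2_pos z (proj1 Hz)).
  pose proof (Dir 1%C Cmod_1) as K1.
  pose proof (Dir Ci Cmod_Ci) as K2. clear Dir.
  rewrite ?re_mult, ?im_mult in K1, K2.
  rewrite ?re_mult, ?im_mult in K1, K2. simpl Re in K1, K2. simpl Im in K1, K2.
  change (Re 1%C) with 1 in K1. change (Im 1%C) with 0 in K1.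
  change (Re Ci) with 0 in K2. change (Im Ci) with 1 in K2.
  set (x := Re z) in *. set (y := Im z) in *.
  set (N := x ^ 2 + y ^ 2) in *.
  (* the logarithm is harmonic, and the second derivatives of [g] cancel *)
  assert (E : 4 * eta / N - 4 * eta * x ^ 2 / N ^ 2 - 4 * eta * y ^ 2 / N ^ 2 = 0).
  { replace (4 * eta / N) with (4 * eta * N / N ^ 2) by (field; lra).
    unfold Rdiv. rewrite <- !Rmult_minus_distr_r. unfold N at 1. ring. }
  pose proof (pow2_ge_0 (Re (g1 z))). pose proof (pow2_ge_0 (Im (g1 z))).
  replace (2 * eta * (1 ^ 2 + 0 ^ 2) / N) with (2 * eta / N) in K1 by (field; lra).
  replace (2 * eta * (0 ^ 2 + 1 ^ 2) / N) with (2 * eta / N) in K2 by (field; lra).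
  replace (4 * eta * (x * 1 + y * 0) ^ 2 / N ^ 2) with (4 * eta * x ^ 2 / N ^ 2) in K1
    by (field; lra).
  replace (4 * eta * (x * 0 + y * 1) ^ 2 / N ^ 2) with (4 * eta * y ^ 2 / N ^ 2) in K2
    by (field; lra).
  lra.
Qed.

Lemma Cmod_lt_coord (z : C) (d : R) :
  Rabs (Re z) < d / 2 -> Rabs (Im z) < d / 2 -> Cmod z < d.
Proof.
  intros H1 H2. pose proof (Rabs_pos (Re z)).
  apply Rabs_def2 in H1. apply Rabs_def2 in H2.
  apply Rsqr_incrst_0; try (try apply Cmod_ge_0; lra).
  rewrite !Rsqr_pow2, Cmod_sqr. nra.
Qed.

Lemma coord_le_Cmod (z : C) : Rabs (Re z) <= Cmod z /\ Rabs (Im z) <= Cmod z.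
Proof.
  split; [apply re_le_Cmod|]. eapply Rle_trans; [apply Rmax_r|apply Rmax_Cmod].
Qed.

(** A bounded set has a uniform positive radius on which an estimate that holds
    locally holds globally. *)
Lemma bounded_uniform (K : C -> Prop) (P : R -> C -> Prop) (B : R) :
  (forall z, K z -> Cmod z <= B) ->
  (forall d d' w, 0 < d' <= d -> P d w -> P d' w) ->
  (forall z, exists d, 0 < d /\ forall w, K w -> Cmod (w - z) < d -> P d w) ->
  exists d, 0 < d /\ forall w, K w -> P d w.
Proof.
  intros HB Hmono Hloc.
  set (del := fun x y : R => constructive_indefinite_description _ (Hloc (x, y))).
  assert (Pdel : forall x y, 0 < proj1_sig (del x y) / 2).
  { intros x y. destruct (del x y) as (d & Pd & Hd); simpl. lra. }
  destruct (compactness_value_2d (- B) B (- B) B (fun x y => mkposreal _ (Pdel x y)))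
    as [d Hd].
  exists d; split; [apply cond_pos|]. intros w Kw. pose proof (HB w Kw) as Bw.
  destruct (coord_le_Cmod w) as [H1 H2].
  apply NNPP. intro NP.
  apply (Hd (Re w) (Im w)).
  - apply Rabs_le_between; lra.
  - apply Rabs_le_between; lra.
  - intros (u & v & _ & _ & Hu & Hv & Hle). simpl in Hu, Hv, Hle. apply NP.
    destruct (del u v) as (d' & Pd' & Hd'); simpl in *.
    apply Hmono with d'; [pose proof (cond_pos d); lra|]. apply Hd'; [exact Kw|].
    apply Cmod_lt_coord; destruct w as [a b]; simpl in *; assumption.
Qed.

(** An upper semicontinuous function attains its maximum on a nonempty compact set. *)
Lemma usc_attains_max (K : C -> Prop) (V : C -> R) (B : R) (z0 : C) :
  K z0 -> (forall z, K z -> Cmod z <= B) ->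
  (forall z, ~ K z -> exists d, 0 < d /\ forall w, Cmod (w - z) < d -> ~ K w) ->
  (forall z, K z -> forall e, 0 < e -> exists d, 0 < d /\
     forall w, K w -> Cmod (w - z) < d -> V w < V z + e) ->
  exists m, K m /\ forall z, K z -> V z <= V m.
Proof.
  intros K0 HB Hcl Husc.
  destruct (bounded_uniform K (fun d w => V w <= / d) B HB) as (d0 & P0 & H0).
  { intros d d' w [Pd' Hle] Hw.
    eapply Rle_trans; [exact Hw|]. apply Rinv_le_contravar; assumption. }
  { intro z. destruct (classic (K z)) as [Kz|NK].
    - destruct (Husc z Kz 1 ltac:(lra)) as (d & Pd & Hd).
      set (M := Rmax 1 (V z + 1)). assert (1 <= M) by apply Rmax_l.
      assert (V z + 1 <= M) by apply Rmax_r.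
      exists (Rmin d (/ M)); split.
      { apply Rmin_pos; [exact Pd|apply Rinv_0_lt_compat; lra]. }
      intros w Kw Hw. pose proof (Rmin_l d (/ M)). pose proof (Rmin_r d (/ M)).
      specialize (Hd w Kw ltac:(lra)). apply Rle_trans with (/ / M);
      [rewrite Rinv_inv; lra|]. apply Rinv_le_contravar; [|assumption].
      apply Rmin_pos; [exact Pd|apply Rinv_0_lt_compat; lra].
    - destruct (Hcl z NK) as (d & Pd & Hd). exists d; split; [exact Pd|].
      intros w Kw Hw. exfalso; exact (Hd w Hw Kw). }
  destruct (completeness (fun r => exists z, K z /\ V z = r)) as [S [Sub Slub]].
  { exists (/ d0). intros r (z & Kz & <-). apply H0, Kz. }
  { exists (V z0), z0; auto. }
  apply NNPP; intro NM.
  assert (Hlt : forall z, K z -> V z < S).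
  { intros z Kz. destruct (Rle_lt_or_eq_dec (V z) S) as [|E]; [apply Sub; eauto|assumption|].
    exfalso; apply NM. exists z; split; [exact Kz|]. intros w Kw. rewrite E.
    apply Sub; eauto. }
  destruct (bounded_uniform K (fun d w => V w <= S - d) B HB) as (d1 & P1 & H1).
  { intros; lra. }
  { intro z. destruct (classic (K z)) as [Kz|NK].
    - specialize (Hlt z Kz). set (e := (S - V z) / 2).
      destruct (Husc z Kz e ltac:(unfold e; lra)) as (d & Pd & Hd).
      exists (Rmin d e); split; [apply Rmin_pos; unfold e; lra|].
      intros w Kw Hw. pose proof (Rmin_l d e). pose proof (Rmin_r d e).
      specialize (Hd w Kw ltac:(lra)). unfold e in *. lra.
    - destruct (Hcl z NK) as (d & Pd & Hd). exists d; split; [exact Pd|].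
      intros w Kw Hw. exfalso; exact (Hd w Hw Kw). }
  assert (S <= S - d1) by (apply Slub; intros r (z & Kz & <-); apply H1, Kz).
  lra.
Qed.

Lemma lim0_coord (f : C -> C) (l : C) (e : R) :
  lim0 f l -> 0 < e -> exists d, 0 < d /\
    forall h, Cmod h < d -> Rabs (Re (f h) - Re l) < e /\ Rabs (Im (f h) - Im l) < e.
Proof.
  intros H He. destruct (H e He) as (d & Pd & Hd). exists d; split; [exact Pd|].
  intros h Hh. specialize (Hd h Hh). destruct (coord_le_Cmod (f h - l)%C) as [H1 H2].
  unfold Cminus in H1, H2, Hd.
  rewrite re_plus, re_opp in H1. rewrite im_plus, im_opp in H2.
  unfold Rminus. lra.
Qed.

(** The real-valued counterpart of [lim0]. *)
Definition cont0 (V : C -> R) (v : R) : Prop :=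
  forall e, 0 < e -> exists d, 0 < d /\ forall h, Cmod h < d -> Rabs (V h - v) < e.

Lemma cont0_comp (F : R -> R) (V : C -> R) (v : R) :
  continuity_pt F v -> cont0 V v -> cont0 (fun h => F (V h)) (F v).
Proof.
  intros HF HV e He. destruct (HF e He) as (d & Pd & Hd).
  destruct (HV d Pd) as (d' & Pd' & Hd'). exists d'; split; [exact Pd'|].
  intros h Hh. specialize (Hd' h Hh). destruct (Req_dec (V h) v) as [E|N].
  - rewrite E, Rminus_diag, Rabs_R0. exact He.
  - apply Hd. split; [split; [exact I|auto]|exact Hd'].
Qed.

Lemma cont0_plus (V W : C -> R) (v w : R) :
  cont0 V v -> cont0 W w -> cont0 (fun h => V h + W h) (v + w).
Proof.
  intros HV HW e He. destruct (HV (e / 2) ltac:(lra)) as (d & Pd & Hd).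
  destruct (HW (e / 2) ltac:(lra)) as (d' & Pd' & Hd').
  exists (Rmin d d'); split; [apply Rmin_pos; assumption|]. intros h Hh.
  pose proof (Rmin_l d d'). pose proof (Rmin_r d d').
  specialize (Hd h ltac:(lra)). specialize (Hd' h ltac:(lra)).
  replace (V h + W h - (v + w)) with ((V h - v) + (W h - w)) by ring.
  eapply Rle_lt_trans; [apply Rabs_triang|lra].
Qed.

Lemma subharm_continuous (g : C -> C) (eps eta : R) (z l : C) :
  z <> 0%C -> cdiff g z l ->
  cont0 (fun h => subharm g eps eta (z + h)%C) (subharm g eps eta z).
Proof.
  intros Nz Hg.
  assert (Lg := cdiff_lim0 _ _ _ Hg). assert (Li := cdiff_lim0 _ _ _ (cdiff_id z)).
  cbv beta in Li.
  assert (Cre : forall f m, lim0 f m -> cont0 (fun h => Re (f h)) (Re m)).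
  { intros f m H e He. destruct (lim0_coord f m e H He) as (d & Pd & Hd).
    exists d; split; [exact Pd|]. intros; apply Hd; assumption. }
  assert (Cim : forall f m, lim0 f m -> cont0 (fun h => Im (f h)) (Im m)).
  { intros f m H e He. destruct (lim0_coord f m e H He) as (d & Pd & Hd).
    exists d; split; [exact Pd|]. intros; apply Hd; assumption. }
  assert (Sq : forall V v, cont0 V v -> cont0 (fun h => V h ^ 2) (v ^ 2)).
  { intros V v. apply (cont0_comp (fun x => x ^ 2)). reg. }
  assert (Sc : forall k V v, cont0 V v -> cont0 (fun h => k * V h) (k * v)).
  { intros k V v. apply (cont0_comp (fun x => k * x)). reg. }
  unfold subharm. repeat apply cont0_plus.
  - apply Sq, Cre, Lg.
  - apply Sq, Cim, Lg.
  - apply Sc, cont0_plus; apply Sq; [apply Cre, Li|apply Cim, Li].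
  - apply Sc. apply (cont0_comp ln).
    + apply derivable_continuous_pt. exists (/ (Re z ^ 2 + Im z ^ 2)).
      apply derivable_pt_lim_ln, norm2_pos, Nz.
    + apply cont0_plus; apply Sq; [apply Cre, Li|apply Cim, Li].
Qed.

(** On an annulus, [subharm] is bounded by its values on the boundary circles. *)
Lemma subharm_annulus (g : C -> C) (eps eta r1 r2 M : R) (z : C) :
  hol2 g -> 0 < eps -> 0 < r1 -> r2 < 1 ->
  (forall w, Cmod w = r1 \/ Cmod w = r2 -> subharm g eps eta w <= M) ->
  r1 <= Cmod z <= r2 -> subharm g eps eta z <= M.
Proof.
  intros (g1 & Hg & g2 & Hg1) Pe P1 L2 HM Hz.
  assert (Hpd : forall w, r1 <= Cmod w <= r2 -> pdisk w).
  { intros w Hw; split; [apply Cmod_gt_0|]; lra. }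
  assert (Hnear : forall w h, Cmod w - Cmod h <= Cmod (w + h) <= Cmod w + Cmod h).
  { intros w h; split; [|apply Cmod_triangle].
    pose proof (Cmod_minus_triangle (w + h) h) as T.
    replace (w + h - h)%C with w in T by ring. lra. }
  destruct (usc_attains_max (fun w => r1 <= Cmod w <= r2) (subharm g eps eta) r2 z)
    as (m & Km & Hm).
  - exact Hz.
  - intros w Hw; lra.
  - intros w Hw.
    assert (Hw' : Cmod w < r1 \/ r2 < Cmod w) by lra.
    exists (Rmax (r1 - Cmod w) (Cmod w - r2)). split.
    + destruct Hw'; [eapply Rlt_le_trans; [|apply Rmax_l]|eapply Rlt_le_trans; [|apply Rmax_r]]; lra.
    + intros w' Hd. specialize (Hnear w (w' - w)%C).
      replace (w + (w' - w))%C with w' in Hnear by ring.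
      unfold Rmax in Hd. destruct (Rle_dec (r1 - Cmod w) (Cmod w - r2)); lra.
  - intros w Hw e He.
    destruct (subharm_continuous g eps eta w (g1 w) (proj1 (Hpd w Hw))
      (Hg w (Hpd w Hw)) e He) as (d & Pd & Hd).
    exists d; split; [exact Pd|]. intros w' _ Hlt. specialize (Hd _ Hlt).
    replace (w + (w' - w))%C with w' in Hd by ring. apply Rabs_def2 in Hd. lra.
  - eapply Rle_trans; [apply Hm, Hz|].
    destruct (Req_dec (Cmod m) r1); [apply HM; auto|].
    destruct (Req_dec (Cmod m) r2); [apply HM; auto|].
    exfalso.
    set (del := Rmin (Cmod m - r1) (r2 - Cmod m)).
    assert (Pd : 0 < del) by (apply Rmin_pos; lra).
    assert (Hin : forall h, Cmod h < del -> r1 <= Cmod (m + h) <= r2).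
    { intros h Hh. pose proof (Rmin_l (Cmod m - r1) (r2 - Cmod m)).
      pose proof (Rmin_r (Cmod m - r1) (r2 - Cmod m)). specialize (Hnear m h).
      unfold del in Hh. lra. }
    apply (subharm_no_max g g1 g2 eps eta del m Pe Pd (Hpd m Km)); auto.
Qed.

(** A function [g] that is bounded near 0 and such that [z g(z)] is bounded by
    [rho] is bounded by [rho]: the logarithm in [subharm] takes care of the
    singularity at 0, and the three parameters tend to their limits. *)
Lemma schwarz_punctured (g : C -> C) (rho K d0 : R) :
  hol2 g -> 0 <= rho -> 0 < d0 ->
  (forall z, pdisk z -> Cmod z * Cmod (g z) <= rho) ->
  (forall z, pdisk z -> Cmod z < d0 -> Cmod (g z) <= K) ->
  forall z, pdisk z -> Cmod (g z) <= rho.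
Proof.
  intros Hg Hrho Pd0 Hb HK z Hz.
  assert (Pz : 0 < Cmod z) by (apply Cmod_gt_0, Hz). assert (Lz := proj2 Hz).
  assert (Esub : forall eps eta w, subharm g eps eta w =
     Cmod (g w) ^ 2 + eps * Cmod w ^ 2 + eta * ln (Cmod w ^ 2)).
  { intros. unfold subharm. rewrite !Cmod_sqr. ring. }
  assert (Step : forall r eps eta, Cmod z < r < 1 -> 0 < eps -> 0 < eta ->
     Cmod (g z) ^ 2 <= rho ^ 2 / r ^ 2 + eps + eta * - ln (Cmod z ^ 2)).
  { intros r eps eta Hr Pe Pt.
    assert (Pr : 0 < r) by lra.
    set (k := exp (- (K ^ 2 / eta))).
    assert (Pk : 0 < k) by apply exp_pos.
    set (r1 := Rmin (Rmin (d0 / 2) (Cmod z)) k).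
    assert (P1 : 0 < r1) by (repeat apply Rmin_pos; lra).
    assert (B1 : r1 <= d0 / 2) by (eapply Rle_trans; [apply Rmin_l|apply Rmin_l]).
    assert (B2 : r1 <= Cmod z) by (eapply Rle_trans; [apply Rmin_l|apply Rmin_r]).
    assert (B3 : r1 <= k) by apply Rmin_r.
    assert (Hrr : 0 <= rho ^ 2 / r ^ 2).
    { apply Rmult_le_pos; [apply pow2_ge_0|]. apply Rlt_le, Rinv_0_lt_compat, pow_lt, Pr. }
    assert (HM := subharm_annulus g eps eta r1 r (rho ^ 2 / r ^ 2 + eps) z Hg Pe P1
      (proj2 Hr)).
    rewrite !Esub in HM. 
    assert (0 <= eps * Cmod z ^ 2) by (apply Rmult_le_pos; [lra|apply pow2_ge_0]).
    cut (Cmod (g z) ^ 2 + eps * Cmod z ^ 2 + eta * ln (Cmod z ^ 2) <= rho ^ 2 / r ^ 2 + eps);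
      [lra|].
    apply HM; [|lra]. intros w Hw. rewrite Esub.
    assert (Hpw : pdisk w).
    { split; [apply Cmod_gt_0|]; destruct Hw; lra. }
    pose proof (Cmod_ge_0 (g w)) as Hg0.
    destruct Hw as [E|E].
    - specialize (HK w Hpw ltac:(lra)). rewrite E in *.
      assert (Cmod (g w) ^ 2 <= K ^ 2) by (apply pow_incr; lra).
      assert (r1 ^ 2 <= r1) by nra.
      assert (ln (r1 ^ 2) <= - (K ^ 2 / eta)).
      { rewrite <- (ln_exp (- (K ^ 2 / eta))). apply ln_le; [apply pow_lt; exact P1|].
        fold k; lra. }
      assert (eta * ln (r1 ^ 2) <= eta * - (K ^ 2 / eta)) by (apply Rmult_le_compat_l; lra).
      replace (eta * - (K ^ 2 / eta)) with (- K ^ 2) in * by (field; lra).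
      assert (eps * r1 ^ 2 <= eps * 1) by (apply Rmult_le_compat_l; nra).
      lra.
    - specialize (Hb w Hpw). rewrite E in *.
      assert (Cmod (g w) ^ 2 <= rho ^ 2 / r ^ 2).
      { replace (rho ^ 2 / r ^ 2) with ((rho / r) ^ 2) by (field; lra).
        apply pow_incr; split; [exact Hg0|].
        apply Rmult_le_reg_l with r; [exact Pr|].
        replace (r * (rho / r)) with rho by (field; lra). exact Hb. }
      assert (ln (r ^ 2) <= 0).
      { rewrite <- ln_1. apply ln_le; [apply pow_lt; exact Pr|nra]. }
      assert (eta * ln (r ^ 2) <= 0) by nra.
      assert (eps * r ^ 2 <= eps * 1) by (apply Rmult_le_compat_l; nra).
      lra. }
  assert (Step2 : forall r, Cmod z < r < 1 -> Cmod (g z) ^ 2 <= rho ^ 2 / r ^ 2).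
  { intros r Hr. apply le_epsilon. intros e He.
    assert (Hl : 0 <= - ln (Cmod z ^ 2)).
    { assert (ln (Cmod z ^ 2) <= ln 1) by (apply ln_le; [apply pow_lt; exact Pz|nra]).
      rewrite ln_1 in *. lra. }
    set (L := - ln (Cmod z ^ 2)) in *.
    assert (Pt : 0 < e / (2 * (1 + L))) by (apply Rdiv_lt_0_compat; lra).
    pose proof (Step r (e / 2) (e / (2 * (1 + L))) Hr ltac:(lra) Pt) as S1. fold L in S1.
    assert (e / (2 * (1 + L)) * (1 + L) = e / 2) by (field; lra). nra. }
  apply Rnot_lt_le; intro Hlt.
  set (q := rho / Cmod (g z)).
  assert (Eq : q * Cmod (g z) = rho) by (unfold q; field; lra).
  assert (q < 1) by nra.
  set (r := Rmax ((1 + q) / 2) ((1 + Cmod z) / 2)).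
  assert (r < 1) by (apply Rmax_lub_lt; lra).
  assert ((1 + q) / 2 <= r) by apply Rmax_l.
  assert ((1 + Cmod z) / 2 <= r) by apply Rmax_r.
  specialize (Step2 r ltac:(lra)).
  assert (Pr : 0 < r) by lra.
  apply (Rmult_le_compat_r (r ^ 2)) in Step2; [|apply pow_le; lra].
  replace (rho ^ 2 / r ^ 2 * r ^ 2) with (rho ^ 2) in Step2 by (field; lra).
  assert (rho < Cmod (g z) * r) by nra.
  nra.
Qed.

(** * Expansions at the origin *)

(** [f z = O(z ^ n)] as [z] tends to 0, the value at 0 being ignored. *)
Definition bigO (n : nat) (f : C -> C) : Prop :=
  exists K d, 0 < d /\ forall z : C, z <> 0%C -> Cmod z < d -> Cmod (f z) <= K * Cmod z ^ n.

Lemma bigO_ext_loc (n : nat) (f g : C -> C) (d : R) :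
  0 < d -> (forall z : C, z <> 0%C -> Cmod z < d -> f z = g z) -> bigO n f -> bigO n g.
Proof.
  intros Pd E (K & d' & Pd' & H). exists K, (Rmin d d'). split; [apply Rmin_pos; assumption|].
  intros z Nz Hz. pose proof (Rmin_l d d'). pose proof (Rmin_r d d').
  rewrite <- E by (auto; lra). apply H; auto; lra.
Qed.

Lemma bigO_ext (n : nat) (f g : C -> C) : (forall z : C, z <> 0%C -> f z = g z) -> bigO n f -> bigO n g.
Proof. intros E. apply (bigO_ext_loc n f g 1); auto; lra. Qed.

Lemma bigO_plus (n : nat) (f g : C -> C) : bigO n f -> bigO n g -> bigO n (fun z => f z + g z)%C.
Proof.
  intros (K & d & Pd & H) (K' & d' & Pd' & H').
  exists (K + K'), (Rmin d d'). split; [apply Rmin_pos; assumption|].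
  intros z Nz Hz. pose proof (Rmin_l d d'). pose proof (Rmin_r d d').
  eapply Rle_trans; [apply Cmod_triangle|].
  specialize (H z Nz ltac:(lra)). specialize (H' z Nz ltac:(lra)). lra.
Qed.

Lemma bigO_mult (m n : nat) (f g : C -> C) :
  bigO m f -> bigO n g -> bigO (m + n) (fun z => f z * g z)%C.
Proof.
  intros (K & d & Pd & H) (K' & d' & Pd' & H').
  exists (K * K'), (Rmin d d'). split; [apply Rmin_pos; assumption|].
  intros z Nz Hz. pose proof (Rmin_l d d'). pose proof (Rmin_r d d').
  specialize (H z Nz ltac:(lra)). specialize (H' z Nz ltac:(lra)).
  rewrite Cmod_mult, pow_add.
  replace (K * K' * (Cmod z ^ m * Cmod z ^ n)) with ((K * Cmod z ^ m) * (K' * Cmod z ^ n)) by ring.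
  apply Rmult_le_compat; auto using Cmod_ge_0.
Qed.

Lemma bigO_const (k : C) : bigO 0 (fun _ => k).
Proof. exists (Cmod k), 1. split; [lra|]. intros; simpl; lra. Qed.

Lemma bigO_id : bigO 1 (fun z => z).
Proof. exists 1, 1. split; [lra|]. intros; simpl; lra. Qed.

Lemma bigO_scal (n : nat) (k : C) (f : C -> C) : bigO n f -> bigO n (fun z => k * f z)%C.
Proof. apply (bigO_mult 0 n (fun _ => k) f (bigO_const k)). Qed.

Lemma bigO_minus (n : nat) (f g : C -> C) : bigO n f -> bigO n g -> bigO n (fun z => f z - g z)%C.
Proof.
  intros Hf Hg. apply (bigO_ext n (fun z => f z + -1 * g z)%C); [intros; ring|].
  apply bigO_plus; [exact Hf|apply bigO_scal, Hg].
Qed.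

Lemma bigO_le (m n : nat) (f : C -> C) : (m <= n)%nat -> bigO n f -> bigO m f.
Proof.
  intros Hmn (K & d & Pd & H). exists (Rabs K), (Rmin 1 d). split; [apply Rmin_pos; lra|].
  intros z Nz Hz. pose proof (Rmin_l 1 d). pose proof (Rmin_r 1 d).
  eapply Rle_trans; [apply H; auto; lra|].
  pose proof (Cmod_ge_0 z).
  apply Rle_trans with (Rabs K * Cmod z ^ n).
  - apply Rmult_le_compat_r; [apply pow_le; lra|apply Rle_abs].
  - apply Rmult_le_compat_l; [apply Rabs_pos|].
    replace n with (m + (n - m))%nat by lia. rewrite pow_add.
    rewrite <- (Rmult_1_r (Cmod z ^ m)) at 2.
    apply Rmult_le_compat_l; [apply pow_le; lra|].
    rewrite <- (pow1 (n - m)). apply pow_incr; lra.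
Qed.

Lemma bigO_pow (n : nat) : bigO n (fun z => z ^ n)%C.
Proof. exists 1, 1. split; [lra|]. intros; rewrite Cmod_pow; lra. Qed.

(** Multiples of [z ^ n] by a bounded function. *)
Lemma bigO_pow_mult (n : nat) (f : C -> C) : bigO 0 f -> bigO n (fun z => z ^ n * f z)%C.
Proof.
  intro H. replace n with (n + 0)%nat at 1 by lia. apply bigO_mult; [apply bigO_pow|exact H].
Qed.

Lemma bigO_div_id (n : nat) (f : C -> C) : bigO (S n) f -> bigO n (fun z => f z / z)%C.
Proof.
  intros (K & d & Pd & H). exists K, d. split; [exact Pd|]. intros z Nz Hz.
  assert (0 < Cmod z) by (apply Cmod_gt_0; exact Nz).
  rewrite Cmod_div by exact Nz. specialize (H z Nz Hz). simpl in H.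
  apply Rmult_le_reg_r with (Cmod z); [assumption|].
  unfold Rdiv; rewrite Rmult_assoc, Rinv_l by lra. lra.
Qed.

(** If [f] tends to [l <> 0] then [/ f] is bounded near 0. *)
Lemma bigO_inv (f : C -> C) (l : C) :
  l <> 0%C -> bigO 1 (fun z => f z - l)%C -> bigO 0 (fun z => / f z)%C.
Proof.
  intros Nl (K & d & Pd & H).
  assert (Pl : 0 < Cmod l) by (apply Cmod_gt_0; exact Nl).
  pose proof (Rabs_pos K) as HK.
  assert (Pe : 0 < Cmod l / (2 * (1 + Rabs K))) by (apply Rdiv_lt_0_compat; lra).
  exists (2 / Cmod l), (Rmin d (Cmod l / (2 * (1 + Rabs K)))).
  split; [apply Rmin_pos; assumption|]. intros z Nz Hz.
  pose proof (Rmin_l d (Cmod l / (2 * (1 + Rabs K)))).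
  pose proof (Rmin_r d (Cmod l / (2 * (1 + Rabs K)))).
  specialize (H z Nz ltac:(lra)). simpl in H. rewrite Rmult_1_r in H.
  assert (0 < Cmod z) by (apply Cmod_gt_0; exact Nz).
  assert (B : (1 + Rabs K) * Cmod z <= Cmod l / 2).
  { replace (Cmod l / 2) with ((1 + Rabs K) * (Cmod l / (2 * (1 + Rabs K)))) by (field; lra).
    apply Rmult_le_compat_l; lra. }
  assert (K * Cmod z <= Rabs K * Cmod z) by (apply Rmult_le_compat_r; [lra|apply Rle_abs]).
  assert (B2 : Cmod l / 2 <= Cmod (f z)).
  { pose proof (Cmod_minus_triangle (f z) (f z - l)) as T.
    replace (f z - (f z - l))%C with l in T by ring. lra. }
  assert (Nf : f z <> 0%C) by (apply Cmod_gt_0; lra).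
  rewrite Cmod_inv by exact Nf. simpl. rewrite Rmult_1_r.
  replace (2 / Cmod l) with (/ (Cmod l / 2)) by (field; lra).
  apply Rinv_le_contravar; lra.
Qed.

(** The value of the constant term is a limit, hence is bounded like the function. *)
Lemma bigO_limit_bound (f : C -> C) (l : C) (B : R) :
  bigO 1 (fun z => f z - l)%C -> (forall z, pdisk z -> Cmod (f z) <= B) -> Cmod l <= B.
Proof.
  intros (K & d & Pd & H) HB. apply le_epsilon. intros e He.
  pose proof (Rabs_pos K).
  set (r := Rmin (Rmin (d / 2) (1 / 2)) (e / (1 + Rabs K))).
  assert (Pr : 0 < r) by (repeat apply Rmin_pos; try lra; apply Rdiv_lt_0_compat; lra).
  assert (B1 : r <= d / 2) by (eapply Rle_trans; [apply Rmin_l|apply Rmin_l]).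
  assert (B2 : r <= 1 / 2) by (eapply Rle_trans; [apply Rmin_l|apply Rmin_r]).
  assert (B3 : r <= e / (1 + Rabs K)) by apply Rmin_r.
  assert (Er : Cmod (RtoC r) = r) by (rewrite Cmod_R; apply Rabs_pos_eq; lra).
  assert (Nr : RtoC r <> 0%C) by (apply Cmod_gt_0; lra).
  specialize (H (RtoC r) Nr ltac:(lra)).
  specialize (HB (RtoC r)). rewrite Er in H. simpl in H.
  assert (Cmod (f (RtoC r)) <= B) by (apply HB; split; [exact Nr|lra]).
  pose proof (Cmod_minus_triangle (f (RtoC r)) (f (RtoC r) - l)) as T.
  replace (f (RtoC r) - (f (RtoC r) - l))%C with l in T by ring.
  assert (Rabs K * r <= e).
  { apply Rle_trans with ((1 + Rabs K) * (e / (1 + Rabs K))); [|right; field; lra].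
    apply Rmult_le_compat; lra. }
  assert (K * r <= Rabs K * r) by (apply Rmult_le_compat_r; [lra|apply Rle_abs]).
  lra.
Qed.

(** * The Schur algorithm *)

(** Two points at distance at most [rho] from 0 have pseudo-hyperbolic distance at
    most [2 rho / (1 + rho ^ 2)]. *)
Lemma pseudo_hyperbolic (a b : C) (rho : R) :
  Cmod a <= rho -> Cmod b <= rho -> rho < 1 ->
  (1 + rho ^ 2) * Cmod (a - b) <= 2 * rho * Cmod (1 - Cconj b * a).
Proof.
  intros Ha Hb Hr. pose proof (Cmod_ge_0 a) as Pa; pose proof (Cmod_ge_0 b) as Pb.
  set (P := Cmod (a - b)); set (Q := Cmod (1 - Cconj b * a)).
  assert (PP : 0 <= P) by apply Cmod_ge_0. assert (PQ : 0 <= Q) by apply Cmod_ge_0.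
  assert (E : Q ^ 2 - P ^ 2 = (1 - Cmod a ^ 2) * (1 - Cmod b ^ 2)).
  { unfold P, Q. rewrite !Cmod_sqr. unfold Cminus.
    rewrite ?re_plus, ?im_plus, ?re_opp, ?im_opp, ?re_mult, ?im_mult, ?re_conj, ?im_conj.
    change (Re 1%C) with 1. change (Im 1%C) with 0. ring. }
  assert (HQ : Q <= 1 + rho ^ 2).
  { unfold Q. eapply Rle_trans; [apply Cmod_minus_triangle|].
    rewrite Cmod_1, Cmod_mult, Cmod_conj. nra. }
  assert (Ha2 : 1 - rho ^ 2 <= 1 - Cmod a ^ 2) by nra.
  assert (Hb2 : 1 - rho ^ 2 <= 1 - Cmod b ^ 2) by nra.
  assert (H1 : (1 - rho ^ 2) ^ 2 <= Q ^ 2 - P ^ 2).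
  { rewrite E. simpl. rewrite Rmult_1_r. apply Rmult_le_compat; nra. }
  assert (HQ2 : Q ^ 2 <= (1 + rho ^ 2) ^ 2) by (apply pow_incr; lra).
  apply Rsqr_incr_0_var; [|apply Rmult_le_pos; nra].
  rewrite !Rsqr_pow2, !Rpow_mult_distr.
  assert ((1 - rho ^ 2) ^ 2 * Q ^ 2 <= (Q ^ 2 - P ^ 2) * (1 + rho ^ 2) ^ 2).
  { apply Rmult_le_compat; try assumption; apply pow2_ge_0. }
  nra.
Qed.

Lemma bigO_quadratic (a b c : C) : bigO 0 (fun z => a + b * z + c * z ^ 2)%C.
Proof.
  repeat apply bigO_plus; try apply bigO_const.
  - apply (bigO_le 0 1); [lia|]. apply bigO_scal, bigO_id.
  - apply (bigO_le 0 2); [lia|]. apply bigO_scal, bigO_pow.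
Qed.

(** One step of the algorithm: the Schwarz quotient [((phi - c0) / (1 - conj c0 phi)) / z]
    of a function with value [c0] at the origin. *)
Definition schur_next (phi : C -> C) (c0 z : C) : C :=
  ((phi z - c0) / (z * (1 - Cconj c0 * phi z)))%C.

Lemma one_minus_neq0 (w : C) : Cmod w < 1 -> (1 - w)%C <> 0%C.
Proof.
  intros H E. assert (w = 1%C) by (replace w with (1 - (1 - w))%C by ring; rewrite E; ring).
  subst w. rewrite Cmod_1 in H. lra.
Qed.

Lemma conj_prod_lt1 (a b : C) (rho : R) : Cmod a <= rho -> Cmod b <= rho -> rho < 1 ->
  Cmod (Cconj a * b) < 1.
Proof.
  intros Ha Hb Hr. rewrite Cmod_mult, Cmod_conj.
  pose proof (Cmod_ge_0 a); pose proof (Cmod_ge_0 b). nra.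
Qed.

(** A bound [rho < 1] leads to another bound less than 1, which excludes the
    degenerate case of a unimodular parameter. *)
Lemma schur_next_bound (phi : C -> C) (rho : R) (c0 : C) :
  hol2 phi -> 0 <= rho < 1 -> (forall z, pdisk z -> Cmod (phi z) <= rho) ->
  bigO 1 (fun z => phi z - c0)%C ->
  hol2 (schur_next phi c0) /\
  (forall z, pdisk z -> Cmod (schur_next phi c0 z) <= 2 * rho / (1 + rho ^ 2)).
Proof.
  intros Hphi Hrho HB HO.
  assert (Hc : Cmod c0 <= rho) by (apply (bigO_limit_bound phi); assumption).
  assert (Nden : forall z, pdisk z -> (1 - Cconj c0 * phi z)%C <> 0%C).
  { intros z Hz. apply one_minus_neq0, (conj_prod_lt1 _ _ rho); auto; lra. }
  assert (Hol : hol2 (schur_next phi c0)).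
  { apply (hol2_ext (fun z => (phi z + -1 * c0) * / (z * (1 + (-1 * Cconj c0) * phi z)))%C).
    - intros z Hz. unfold schur_next, Cdiv.
      replace (phi z + -1 * c0)%C with (phi z - c0)%C by ring.
      now replace (1 + (-1 * Cconj c0) * phi z)%C with (1 - Cconj c0 * phi z)%C by ring.
    - apply hol2_mult; [apply hol2_plus; auto using hol2_const|].
      apply (hol2_inv (fun z => z * (1 + (-1 * Cconj c0) * phi z))%C).
      + intros z Hz. apply Cmult_neq_0; [apply Hz|].
        replace (1 + (-1 * Cconj c0) * phi z)%C with (1 - Cconj c0 * phi z)%C by ring; auto.
      + apply hol2_mult; [apply hol2_id|]. apply hol2_plus; [apply hol2_const|].
        apply hol2_mult; [apply hol2_const|exact Hphi]. }
  split; [exact Hol|].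
  assert (Prho : 0 < 1 + rho ^ 2) by nra.
  assert (HO2 : bigO 0 (schur_next phi c0)).
  { apply (bigO_ext 0 (fun z => ((phi z - c0) / z) * / (1 - Cconj c0 * phi z))%C).
    - intros z Nz. unfold schur_next, Cdiv. destruct (Ceq_dec (1 - Cconj c0 * phi z) 0) as [E|N].
      + rewrite E, Cmult_0_r.
        (* the inverse of 0 is 0 *)
        assert (E0 : (/ 0)%C = 0%C).
        { unfold Cinv; simpl. unfold Rdiv. rewrite Ropp_0, !Rmult_0_l. reflexivity. }
        rewrite E0. ring.
      + field; auto.
    - apply (bigO_mult 0 0); [apply bigO_div_id, HO|].
      apply (bigO_inv _ (1 - Cconj c0 * c0)%C).
      + apply one_minus_neq0, (conj_prod_lt1 _ _ rho); auto; lra.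
      + apply (bigO_ext 1 (fun z => (- Cconj c0) * (phi z - c0))%C); [intros; ring|].
        apply bigO_scal, HO. }
  destruct HO2 as (K & d & Pd & HK).
  apply (schwarz_punctured (schur_next phi c0) _ K d Hol); [|exact Pd| |].
  - apply Rmult_le_pos; [lra|]. apply Rlt_le, Rinv_0_lt_compat, Prho.
  - intros z Hz. specialize (Nden z Hz).
    assert (Pz : 0 < Cmod z) by (apply Cmod_gt_0, Hz).
    assert (Pn : 0 < Cmod (1 - Cconj c0 * phi z)) by (apply Cmod_gt_0, Nden).
    unfold schur_next. rewrite Cmod_div by (apply Cmult_neq_0; [apply Hz|exact Nden]).
    rewrite Cmod_mult.
    pose proof (pseudo_hyperbolic (phi z) c0 rho (HB z Hz) Hc (proj2 Hrho)) as PH.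
    apply Rmult_le_reg_r with ((1 + rho ^ 2) * Cmod (1 - Cconj c0 * phi z)).
    { apply Rmult_lt_0_compat; assumption. }
    match goal with |- ?l <= ?r =>
      replace l with ((1 + rho ^ 2) * Cmod (phi z - c0)) by (field; lra);
      replace r with (2 * rho * Cmod (1 - Cconj c0 * phi z)) by (field; lra) end.
    exact PH.
  - intros z [Nz _] Hz. specialize (HK z Nz Hz). simpl in HK. rewrite Rmult_1_r in HK. exact HK.
Qed.

(** Effect of one step on the expansion at 0: the new coefficients solve a
    triangular system. The order [m] of the remainder decreases by one, and
    coefficients beyond it are arbitrary. *)
Lemma schur_next_expand (phi : C -> C) (c0 c1 c2 c3 x0 x1 x2 : C) (m : nat) :
  (m <= 3)%nat -> Cmod c0 < 1 ->
  bigO (S m) (fun z => phi z - (c0 + c1 * z + c2 * z ^ 2 + c3 * z ^ 3))%C ->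
  (c1 = (1 - c0 * Cconj c0) * x0)%C ->
  (c2 = (1 - c0 * Cconj c0) * x1 - Cconj c0 * (x0 * c1))%C ->
  (c3 = (1 - c0 * Cconj c0) * x2 - Cconj c0 * (x1 * c1 + x0 * c2))%C ->
  bigO m (fun z => schur_next phi c0 z - (x0 + x1 * z + x2 * z ^ 2))%C.
Proof.
  intros Hm Hc HO E1 E2 E3.
  set (Phi := fun z : C => (c0 + c1 * z + c2 * z ^ 2 + c3 * z ^ 3)%C) in *.
  set (P := fun z : C => (x0 + x1 * z + x2 * z ^ 2)%C).
  assert (HO1 : bigO 1 (fun z => phi z - c0)%C).
  { apply (bigO_ext 1 (fun z => (phi z - Phi z) + z ^ 1 * (c1 + c2 * z + c3 * z ^ 2))%C).
    - intros; unfold Phi; ring.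
    - apply bigO_plus; [apply (bigO_le 1 (S m)); [lia|exact HO]|].
      apply bigO_pow_mult. apply bigO_quadratic. }
  assert (HOP : bigO 0 P).
  { apply bigO_quadratic. }
  assert (Nl : (1 - Cconj c0 * c0)%C <> 0%C).
  { apply one_minus_neq0, (conj_prod_lt1 _ _ (Cmod c0)); lra. }
  assert (HD : bigO 1 (fun z => (1 - Cconj c0 * phi z) - (1 - Cconj c0 * c0))%C).
  { apply (bigO_ext 1 (fun z => (- Cconj c0) * (phi z - c0))%C); [intros; ring|].
    apply bigO_scal, HO1. }
  assert (HI := bigO_inv _ _ Nl HD).
  (* the numerator of the difference, [z] times the denominator being cleared *)
  assert (HN : bigO (S m) (fun z => phi z - c0 - z * P z * (1 - Cconj c0 * phi z))%C).
  { set (Q := fun z : C => (Cconj c0 * ((x0 * c3 + x1 * c2 + x2 * c1) + (x1 * c3 + x2 * c2) * z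
                 + x2 * c3 * z ^ 2))%C).
    apply (bigO_ext (S m) (fun z => (phi z - Phi z) + (Cconj c0 * z * P z) * (phi z - Phi z)
                                    + z ^ 4 * Q z)%C).
    - intros z _. unfold Phi, P, Q. rewrite E3, E2, E1. ring.
    - apply bigO_plus; [apply bigO_plus; [exact HO|]|].
      + apply (bigO_mult 0 (S m)); [|exact HO]. apply (bigO_mult 0 0); [|exact HOP].
        apply bigO_scal, (bigO_le 0 1); [lia|apply bigO_id].
      + apply (bigO_le (S m) 4); [lia|]. apply bigO_pow_mult.
        apply bigO_scal. apply bigO_quadratic. }
  (* near 0 the denominator does not vanish *)
  assert (HNZ : exists d, 0 < d /\ forall z : C, z <> 0%C -> Cmod z < d ->
             (1 - Cconj c0 * phi z)%C <> 0%C).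
  { destruct HD as (K & d & Pd & H). assert (Pl : 0 < Cmod (1 - Cconj c0 * c0)) by
      (apply Cmod_gt_0; exact Nl).
    pose proof (Rabs_pos K).
    exists (Rmin d (Cmod (1 - Cconj c0 * c0) / (1 + Rabs K))).
    assert (0 < Cmod (1 - Cconj c0 * c0) / (1 + Rabs K)) by (apply Rdiv_lt_0_compat; lra).
    split; [apply Rmin_pos; assumption|].
    intros z Nz Hz E. pose proof (Rmin_l d (Cmod (1 - Cconj c0 * c0) / (1 + Rabs K))).
    pose proof (Rmin_r d (Cmod (1 - Cconj c0 * c0) / (1 + Rabs K))).
    specialize (H z Nz ltac:(lra)). rewrite E in H.
    replace (0 - (1 - Cconj c0 * c0))%C with (- (1 - Cconj c0 * c0))%C in H by ring.
    rewrite Cmod_opp in H. simpl in H. rewrite Rmult_1_r in H.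
    assert (Pz : 0 < Cmod z) by (apply Cmod_gt_0; exact Nz).
    assert ((1 + Rabs K) * Cmod z < Cmod (1 - Cconj c0 * c0)).
    { apply Rlt_le_trans with ((1 + Rabs K) * (Cmod (1 - Cconj c0 * c0) / (1 + Rabs K))).
      - apply Rmult_lt_compat_l; lra.
      - right; field; lra. }
    pose proof (Rle_abs K). nra. }
  destruct HNZ as (d & Pd & HNZ).
  apply (bigO_ext_loc m (fun z => ((phi z - c0 - z * P z * (1 - Cconj c0 * phi z)) / z)
                                  * / (1 - Cconj c0 * phi z))%C _ d Pd).
  - intros z Nz Hz. unfold schur_next. fold (P z). field; auto.
  - replace m with (m + 0)%nat by lia. apply bigO_mult; [|exact HI].
    replace (m + 0)%nat with m by lia. apply bigO_div_id, HN.
Qed.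

(** The first Taylor coefficients of a function bounded by [rho < 1] are given by
    Schur parameters in the unit disk. *)
Lemma schur_parameters (phi : C -> C) (rho : R) (c d e g : C) :
  hol2 phi -> 0 <= rho < 1 -> (forall z, pdisk z -> Cmod (phi z) <= rho) ->
  bigO 4 (fun z => phi z - (c + d * z + e * z ^ 2 + g * z ^ 3))%C ->
  exists x y w, Cmod c <= 1 /\ Cmod x <= 1 /\ Cmod y <= 1 /\ Cmod w <= 1 /\
    d = schur2 c x /\ e = schur3 c x y /\ g = schur4 c x y w.
Proof.
  assert (Next : forall r, 0 <= r < 1 -> 0 <= 2 * r / (1 + r ^ 2) < 1).
  { intros r Hr. assert (0 < 1 + r ^ 2) by nra. split.
    - apply Rmult_le_pos; [lra|]. apply Rlt_le, Rinv_0_lt_compat; lra.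
    - apply Rmult_lt_reg_r with (1 + r ^ 2); [lra|].
      unfold Rdiv; rewrite Rmult_assoc, Rinv_l by lra. nra. }
  assert (First : forall m f c0 c1 c2 c3, bigO (S m) (fun z => f z - (c0 + c1 * z + c2 * z ^ 2 + c3 * z ^ 3))%C ->
     bigO 1 (fun z => f z - c0)%C).
  { intros m f c0 c1 c2 c3 H.
    apply (bigO_ext 1 (fun z => (f z - (c0 + c1 * z + c2 * z ^ 2 + c3 * z ^ 3))
             + z ^ 1 * (c1 + c2 * z + c3 * z ^ 2))%C).
    - intros; ring.
    - apply bigO_plus; [apply (bigO_le 1 (S m)); [lia|exact H]|].
      apply bigO_pow_mult. apply bigO_quadratic. }
  assert (Nz : forall u : C, Cmod u < 1 -> (1 - u * Cconj u)%C <> 0%C).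
  { intros u Hu. apply one_minus_neq0. rewrite Cmult_comm. apply (conj_prod_lt1 _ _ (Cmod u)); lra. }
  intros Hphi Hrho HB HO.
  assert (F0 := First _ _ _ _ _ _ HO).
  assert (Hc : Cmod c <= rho) by (apply (bigO_limit_bound phi); assumption).
  assert (Nc := Nz c ltac:(lra)).
  set (t := (1 - c * Cconj c)%C) in *.
  set (x0 := (d / t)%C). set (x1 := ((e + Cconj c * (x0 * d)) / t)%C).
  set (x2 := ((g + Cconj c * (x1 * d + x0 * e)) / t)%C).
  assert (H1 := schur_next_expand phi c d e g x0 x1 x2 3 (le_n _) ltac:(lra) HO
    ltac:(unfold x0; fold t; field; exact Nc) ltac:(unfold x1; fold t; field; exact Nc)
    ltac:(unfold x2; fold t; field; exact Nc)).
  destruct (schur_next_bound phi rho c Hphi Hrho HB F0) as [Hol1 HB1].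
  assert (Hr1 := Next rho Hrho). set (rho1 := 2 * rho / (1 + rho ^ 2)) in *.
  set (phi1 := schur_next phi c) in *.
  (* the next steps use fewer coefficients, so that the last ones are free *)
  assert (Ext : forall f a b c' n, bigO n (fun z => f z - (a + b * z + c' * z ^ 2))%C ->
    forall k, (n <= 3)%nat -> bigO n (fun z => f z - (a + b * z + c' * z ^ 2 + k * z ^ 3))%C).
  { intros f a b c' n H k Hn.
    apply (bigO_ext n (fun z => (f z - (a + b * z + c' * z ^ 2)) + z ^ 3 * (- k))%C); [intros; ring|].
    apply bigO_plus; [exact H|]. apply (bigO_le n 3); [lia|]. apply bigO_pow_mult, bigO_const. }
  assert (Ext2 : forall f a b c' n, bigO n (fun z => f z - (a + b * z + c' * z ^ 2))%C ->
    forall k k', (n <= 2)%nat -> bigO n (fun z => f z - (a + b * z + k * z ^ 2 + k' * z ^ 3))%C).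
  { intros f a b c' n H k k' Hn.
    apply (bigO_ext n (fun z => (f z - (a + b * z + c' * z ^ 2)) + z ^ 2 * ((c' - k) + (- k') * z))%C);
      [intros; ring|].
    apply bigO_plus; [exact H|]. apply (bigO_le n 2); [lia|]. apply bigO_pow_mult.
    apply bigO_plus; [apply bigO_const|]. apply (bigO_le 0 1); [lia|]. apply bigO_scal, bigO_id. }
  set (s := (1 - x0 * Cconj x0)%C).
  assert (F1' : bigO 1 (fun z => phi1 z - x0)%C) by
    (apply (First 2%nat _ _ x1 x2 0%C), Ext; [exact H1|lia]).
  assert (Hx : Cmod x0 <= rho1) by (apply (bigO_limit_bound phi1); assumption).
  assert (Ns := Nz x0 ltac:(lra)). fold s in Ns.
  set (y0 := (x1 / s)%C). set (y1 := ((x2 + Cconj x0 * (y0 * x1)) / s)%C).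
  assert (H2 := schur_next_expand phi1 x0 x1 x2 (- (Cconj x0 * (y1 * x1 + y0 * x2))) y0 y1 0%C
    2 ltac:(lia) ltac:(lra) (Ext _ _ _ _ _ H1 _ ltac:(lia))
    ltac:(unfold y0; fold s; field; exact Ns) ltac:(unfold y1; fold s; field; exact Ns)
    ltac:(ring)).
  destruct (schur_next_bound phi1 rho1 x0 Hol1 Hr1 HB1 F1') as [Hol2 HB2].
  assert (Hr2 := Next rho1 Hr1). set (rho2 := 2 * rho1 / (1 + rho1 ^ 2)) in *.
  set (phi2 := schur_next phi1 x0) in *.
  assert (F2' : bigO 1 (fun z => phi2 z - y0)%C) by
    (apply (First 1%nat _ _ y1 0%C 0%C), Ext; [exact H2|lia]).
  assert (Hy : Cmod y0 <= rho2) by (apply (bigO_limit_bound phi2); assumption).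
  set (v := (1 - y0 * Cconj y0)%C).
  assert (Nv := Nz y0 ltac:(lra)). fold v in Nv.
  set (w := (y1 / v)%C).
  assert (H3 := schur_next_expand phi2 y0 y1 (- (Cconj y0 * (w * y1)))
    (- (Cconj y0 * (0 * y1 + w * (- (Cconj y0 * (w * y1)))))) w 0%C 0%C 1 ltac:(lia) ltac:(lra)
    (Ext2 _ _ _ _ _ H2 _ _ ltac:(lia)) ltac:(unfold w; fold v; field; exact Nv)
    ltac:(ring) ltac:(ring)).
  destruct (schur_next_bound phi2 rho2 y0 Hol2 Hr2 HB2 F2') as [Hol3 HB3].
  assert (Hr3 := Next rho2 Hr2).
  assert (Hw : Cmod w <= 2 * rho2 / (1 + rho2 ^ 2)).
  { apply (bigO_limit_bound (schur_next phi2 y0)); [|exact HB3].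
    apply (bigO_ext 1 (fun z => schur_next phi2 y0 z - (w + 0 * z + 0 * z ^ 2))%C);
      [intros; ring|exact H3]. }
  exists x0, y0, w. repeat split; try lra.
  - unfold schur2, x0; fold t; field; exact Nc.
  - assert (Ex1 : x1 = (s * y0)%C) by (unfold y0; field; exact Ns).
    assert (Ed : d = (t * x0)%C) by (unfold x0; field; exact Nc).
    assert (Ee : e = (t * x1 - Cconj c * (x0 * d))%C) by (unfold x1; field; exact Nc).
    unfold schur3; fold t s. rewrite Ee, Ex1, Ed. ring.
  - assert (Ex1 : x1 = (s * y0)%C) by (unfold y0; field; exact Ns).
    assert (Ed : d = (t * x0)%C) by (unfold x0; field; exact Nc).
    assert (Ee : e = (t * x1 - Cconj c * (x0 * d))%C) by (unfold x1; field; exact Nc).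
    assert (Ey1 : y1 = (v * w)%C) by (unfold w; field; exact Nv).
    assert (Ex2 : x2 = (s * y1 - Cconj x0 * (y0 * x1))%C) by (unfold y1; field; exact Ns).
    assert (Eg : g = (t * x2 - Cconj c * (x1 * d + x0 * e))%C) by (unfold x2; field; exact Nc).
    unfold schur4; fold t s v. rewrite Eg, Ex2, Ee, Ey1, Ex1, Ed. unfold t, s. ring.
Qed.

(** * Complex power series *)

(** Convergence of a complex series, through its real and imaginary parts. *)
Definition cser (u : nat -> C) (l : C) : Prop :=
  is_series (fun n => Re (u n)) (Re l) /\ is_series (fun n => Im (u n)) (Im l).

Lemma sum_n_coord (u : nat -> C) (n : nat) :
  Re (sum_n (G := C_AbelianMonoid) u n) = sum_n (fun k => Re (u k)) n /\
  Im (sum_n (G := C_AbelianMonoid) u n) = sum_n (fun k => Im (u k)) n.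
Proof.
  induction n as [|n [IH1 IH2]].
  - rewrite !sum_O. auto.
  - rewrite !sum_Sn. change (plus (sum_n u n) (u (S n))) with (sum_n u n + u (S n))%C.
    rewrite re_plus, im_plus, IH1, IH2. auto.
Qed.

(** Agreement with [is_series] in the normed space of complex numbers. *)
Lemma is_series_cser (u : nat -> C) (l : C) :
  is_series (K := C_AbsRing) (V := C_NormedModule) u l <-> cser u l.
Proof.
  split.
  - intro H. assert (H' := proj1 (filterlim_locally (U := C_UniformSpace) _ _) H).
    split; apply (proj2 (filterlim_locally (U := R_UniformSpace) _ _)); intro eps;
      (eapply filter_imp; [|exact (H' eps)]); intros n [B1 B2];
      destruct (sum_n_coord u n) as [E1 E2].
    + exact (eq_ind _ (fun x => ball (M := R_UniformSpace) (Re l) eps x) B1 _ E1).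
    + exact (eq_ind _ (fun x => ball (M := R_UniformSpace) (Im l) eps x) B2 _ E2).
  - intros [H1 H2]. apply (proj2 (filterlim_locally (U := C_UniformSpace) _ _)). intro eps.
    assert (K1 := proj1 (filterlim_locally (U := R_UniformSpace) _ _) H1 eps).
    assert (K2 := proj1 (filterlim_locally (U := R_UniformSpace) _ _) H2 eps).
    generalize (filter_and _ _ K1 K2). apply filter_imp. intros n [B1 B2].
    destruct (sum_n_coord u n) as [E1 E2]. split.
    + exact (eq_ind_r (fun x => ball (M := R_UniformSpace) (Re l) eps x) B1 E1).
    + exact (eq_ind_r (fun x => ball (M := R_UniformSpace) (Im l) eps x) B2 E2).
Qed.

Lemma C_eq_coord (a b : C) : Re a = Re b -> Im a = Im b -> a = b.
Proof. destruct a, b; simpl; intros; subst; reflexivity. Qed.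

Lemma cser_unique (u : nat -> C) (l m : C) : cser u l -> cser u m -> l = m.
Proof.
  intros [H1 H2] [K1 K2]. apply is_series_unique in H1, H2, K1, K2.
  apply C_eq_coord; congruence.
Qed.

Lemma cser_ext (u v : nat -> C) (l : C) : (forall n, u n = v n) -> cser u l -> cser v l.
Proof.
  intros E [H1 H2]; split; (eapply is_series_ext; [|eassumption]); intro n; simpl;
    rewrite E; reflexivity.
Qed.

Lemma cser_plus (u v : nat -> C) (l m : C) :
  cser u l -> cser v m -> cser (fun n => u n + v n)%C (l + m)%C.
Proof.
  intros [H1 H2] [K1 K2]; split.
  - rewrite re_plus. eapply is_series_ext; [|exact (is_series_plus _ _ _ _ H1 K1)].
    intro n; simpl. reflexivity.
  - rewrite im_plus. eapply is_series_ext; [|exact (is_series_plus _ _ _ _ H2 K2)].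
    intro n; simpl. reflexivity.
Qed.

Lemma cser_scal (k : C) (u : nat -> C) (l : C) : cser u l -> cser (fun n => k * u n)%C (k * l)%C.
Proof.
  intros [H1 H2].
  assert (A1 := is_series_scal_l (Re k) _ _ H1). assert (A2 := is_series_scal_l (Im k) _ _ H2).
  assert (B1 := is_series_scal_l (Re k) _ _ H2). assert (B2 := is_series_scal_l (Im k) _ _ H1).
  split.
  - rewrite re_mult. eapply is_series_ext; [|exact (is_series_minus _ _ _ _ A1 A2)].
    intro n. rewrite re_mult. reflexivity.
  - rewrite im_mult. eapply is_series_ext; [|exact (is_series_plus _ _ _ _ B1 B2)].
    intro n. rewrite im_mult. reflexivity.
Qed.

Lemma cser_incr_1 (u : nat -> C) (l : C) : cser (fun n => u (S n)) l -> cser u (u 0%nat + l)%C.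
Proof.
  intros [H1 H2]; split.
  - rewrite re_plus. apply is_series_decr_1. 
    match goal with |- is_series _ ?e => replace e with (Re l) end; [exact H1|].
    unfold plus, opp; simpl. ring.
  - rewrite im_plus. apply is_series_decr_1.
    match goal with |- is_series _ ?e => replace e with (Im l) end; [exact H2|].
    unfold plus, opp; simpl. ring.
Qed.

Lemma is_series_nonneg (v : nat -> R) (L : R) :
  (forall n, 0 <= v n) -> is_series v L -> 0 <= L.
Proof.
  intros Hv H. apply (is_lim_seq_le (fun _ => 0) (sum_n v) 0 L);
    [|apply is_lim_seq_const|exact H].
  induction n as [|n IH]; [rewrite sum_O; apply Hv|].
  rewrite sum_Sn. specialize (Hv (S n)). unfold plus; simpl. lra.
Qed.

(** The triangle inequality for series. *)
Lemma cser_le (u : nat -> C) (v : nat -> R) (l : C) (L : R) :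
  cser u l -> (forall n, Cmod (u n) <= v n) -> is_series v L -> Cmod l <= L.
Proof.
  intros [H1 H2] Hle Hv.
  assert (A : is_series (fun n => Re l * Re (u n) + Im l * Im (u n)) (Cmod l ^ 2)).
  { rewrite Cmod_sqr. replace (Re l ^ 2 + Im l ^ 2) with (Re l * Re l + Im l * Im l) by ring.
    exact (is_series_plus _ _ _ _ (is_series_scal_l (Re l) _ _ H1)
             (is_series_scal_l (Im l) _ _ H2)). }
  assert (B := is_series_scal_l (Cmod l) _ _ Hv).
  assert (C1 : Cmod l ^ 2 <= Cmod l * L).
  { apply (is_lim_seq_le (sum_n (fun n => Re l * Re (u n) + Im l * Im (u n)))
            (sum_n (fun n => Cmod l * v n)) (Cmod l ^ 2) (Cmod l * L)); [|exact A|exact B].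
    intro n. apply sum_n_m_le. intro k.
    pose proof (re_le_Cmod (Cconj l * u k)%C) as R1.
    rewrite Cmod_mult, Cmod_conj in R1.
    rewrite re_mult, re_conj, im_conj in R1. apply Rabs_le_between in R1.
    apply Rle_trans with (Cmod l * Cmod (u k)); [lra|].
    apply Rmult_le_compat_l; [apply Cmod_ge_0|apply Hle]. }
  assert (0 <= L).
  { apply (is_series_nonneg v); [|exact Hv].
    intro n. eapply Rle_trans; [apply Cmod_ge_0|apply Hle]. }
  pose proof (Cmod_ge_0 l). destruct (Req_dec (Cmod l) 0); [lra|].
  apply Rmult_le_reg_l with (Cmod l); lra.
Qed.

(** Domination by a convergent series. *)
Lemma cser_dominated (u : nat -> C) (v : nat -> R) :
  (forall n, Cmod (u n) <= v n) -> ex_series v ->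
  cser u (Series (fun n => Re (u n)), Series (fun n => Im (u n))).
Proof.
  intros Hle Hv; split; simpl; apply Series_correct;
    apply (ex_series_le (K := R_AbsRing) (V := R_CompleteNormedModule) _ v); try exact Hv;
    intro n; (eapply Rle_trans; [|apply Hle]); apply coord_le_Cmod.
Qed.

(** Coefficient sequences of power series that converge in the unit disk, through
    Cauchy's estimates. *)
Definition adm (a : nat -> C) : Prop :=
  forall r, 0 <= r < 1 -> exists K, forall n, Cmod (a n) * r ^ n <= K.

(** The sum of a power series, defined everywhere but meaningful where it converges. *)
Definition cps (a : nat -> C) (z : C) : C :=
  (Series (fun n => Re (a n * z ^ n)%C), Series (fun n => Im (a n * z ^ n)%C)).

Lemma adm_summable (a : nat -> C) (r : R) :
  adm a -> 0 <= r < 1 -> ex_series (fun n => Cmod (a n) * r ^ n).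
Proof.
  intros Ha Hr. destruct (Ha ((1 + r) / 2) ltac:(lra)) as [K HK].
  set (q := r / ((1 + r) / 2)).
  assert (Hq : 0 <= q < 1).
  { unfold q; split.
    - apply Rmult_le_pos; [lra|]. apply Rlt_le, Rinv_0_lt_compat; lra.
    - apply Rmult_lt_reg_r with ((1 + r) / 2); [lra|].
      unfold Rdiv at 1; rewrite Rmult_assoc, Rinv_l by lra. lra. }
  apply (ex_series_le (K := R_AbsRing) (V := R_CompleteNormedModule) _ (fun n => K * q ^ n)).
  - intro n. change (Rabs (Cmod (a n) * r ^ n) <= K * q ^ n).
    rewrite Rabs_pos_eq by (apply Rmult_le_pos; [apply Cmod_ge_0|apply pow_le; lra]).
    replace r with ((1 + r) / 2 * q) at 1 by (unfold q; field; lra).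
    rewrite Rpow_mult_distr, <- Rmult_assoc.
    apply Rmult_le_compat_r; [apply pow_le; lra|apply HK].
  - assert (Aq : Rabs q < 1) by (apply Rabs_def1; lra).
    exact (ex_series_scal_l K _ (ex_series_geom q Aq)).
Qed.

Lemma cps_term_bound (a : nat -> C) (z : C) (r : R) (n : nat) :
  Cmod z <= r -> Cmod (a n * z ^ n) <= Cmod (a n) * r ^ n.
Proof.
  intro H. rewrite Cmod_mult, Cmod_pow. apply Rmult_le_compat_l; [apply Cmod_ge_0|].
  apply pow_incr; split; [apply Cmod_ge_0|exact H].
Qed.

Lemma cps_correct (a : nat -> C) (z : C) :
  adm a -> Cmod z < 1 -> cser (fun n => a n * z ^ n)%C (cps a z).
Proof.
  intros Ha Hz. apply (cser_dominated _ (fun n => Cmod (a n) * Cmod z ^ n)).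
  - intro n. apply cps_term_bound, Rle_refl.
  - apply adm_summable; [exact Ha|]. split; [apply Cmod_ge_0|exact Hz].
Qed.

Lemma cps_unique (a : nat -> C) (z l : C) :
  adm a -> Cmod z < 1 -> cser (fun n => a n * z ^ n)%C l -> cps a z = l.
Proof. intros Ha Hz H. eapply cser_unique; [apply cps_correct|]; eassumption. Qed.

Lemma adm_bound (a : nat -> C) (M : R) : (forall n, Cmod (a n) <= M) -> adm a.
Proof.
  intros H r Hr. exists M. intro n.
  apply Rle_trans with (Cmod (a n) * 1); [|rewrite Rmult_1_r; apply H].
  apply Rmult_le_compat_l; [apply Cmod_ge_0|]. rewrite <- (pow1 n). apply pow_incr; lra.
Qed.

(** Coefficients of [(F z - F 0) / z]. *)
Definition shift (a : nat -> C) (n : nat) : C := a (S n).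

Lemma adm_shift (a : nat -> C) : adm a -> adm (shift a).
Proof.
  intros Ha r Hr. destruct (Ha ((1 + r) / 2) ltac:(lra)) as [K HK].
  exists (K / ((1 + r) / 2)). intro n.
  apply Rmult_le_reg_r with ((1 + r) / 2); [lra|].
  unfold Rdiv at 2; rewrite Rmult_assoc, (Rmult_assoc K), Rinv_l, Rmult_1_r by lra.
  eapply Rle_trans; [|apply (HK (S n))]. unfold shift.
  apply Rmult_le_compat_l; [apply Cmod_ge_0|]. simpl. rewrite Rmult_comm.
  apply Rmult_le_compat_l; [lra|]. apply pow_incr; lra.
Qed.

Lemma cps_shift (a : nat -> C) (z : C) :
  adm a -> Cmod z < 1 -> cps a z = (a 0%nat + z * cps (shift a) z)%C.
Proof.
  intros Ha Hz. apply cps_unique; auto.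
  replace (a 0%nat) with (a 0%nat * z ^ 0)%C by (simpl; ring).
  apply (cser_incr_1 (fun n => a n * z ^ n)%C).
  apply (cser_ext (fun n => z * (shift a n * z ^ n))%C).
  - intro n. unfold shift. rewrite Cpow_S. ring.
  - apply cser_scal, cps_correct; auto using adm_shift.
Qed.

Lemma cps_0 (a : nat -> C) : adm a -> cps a 0%C = a 0%nat.
Proof. intro Ha. rewrite cps_shift by (auto; rewrite Cmod_0; lra). ring. Qed.

Lemma cps_scal (k : C) (a : nat -> C) (z : C) : adm a -> Cmod z < 1 ->
  adm (fun n => k * a n)%C /\ cps (fun n => k * a n)%C z = (k * cps a z)%C.
Proof.
  intros Ha Hz. assert (adm (fun n => k * a n)%C).
  { intros r Hr. destruct (Ha r Hr) as [K HK]. exists (Cmod k * K). intro n.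
    rewrite Cmod_mult, Rmult_assoc. apply Rmult_le_compat_l; [apply Cmod_ge_0|apply HK]. }
  split; [assumption|]. apply cps_unique; auto.
  apply (cser_ext (fun n => k * (a n * z ^ n))%C); [intro; ring|].
  apply cser_scal, cps_correct; auto.
Qed.

(** Coefficients of the derivative. *)
Definition dcoef (a : nat -> C) (n : nat) : C := (RtoC (INR (S n)) * a (S n))%C.

Lemma INR_geom_bound (q : R) (n : nat) : 0 <= q < 1 -> INR n * q ^ n <= / (1 - q).
Proof.
  intro Hq. 
  assert (H : INR n * q ^ n <= sum_f_R0 (fun k => q ^ k) n).
  { induction n as [|n IH]; [simpl; lra|].
    rewrite S_INR, tech5.
    assert (0 <= q ^ n) by (apply pow_le; lra).
    assert (q ^ S n <= q ^ n) by (simpl; nra).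
    assert (INR n * q ^ S n <= INR n * q ^ n) by (apply Rmult_le_compat_l; [apply pos_INR|lra]).
    lra. }
  eapply Rle_trans; [exact H|]. rewrite tech3 by lra.
  assert (0 <= q ^ S n) by (apply pow_le; lra).
  apply Rmult_le_reg_r with (1 - q); [lra|]. rewrite Rinv_l by lra.
  unfold Rdiv; rewrite Rmult_assoc, Rinv_l by lra. lra.
Qed.

Lemma adm_mult_n (a : nat -> C) : adm a -> adm (fun n => RtoC (INR n) * a n)%C.
Proof.
  intros Ha r Hr. destruct (Ha ((1 + r) / 2) ltac:(lra)) as [K HK].
  set (q := r / ((1 + r) / 2)).
  assert (Hq : 0 <= q < 1).
  { unfold q; split.
    - apply Rmult_le_pos; [lra|]. apply Rlt_le, Rinv_0_lt_compat; lra.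
    - apply Rmult_lt_reg_r with ((1 + r) / 2); [lra|].
      unfold Rdiv at 1; rewrite Rmult_assoc, Rinv_l by lra. lra. }
  exists (K * / (1 - q)). intro n. rewrite Cmod_mult, Cmod_R, Rabs_pos_eq by apply pos_INR.
  replace r with ((1 + r) / 2 * q) at 1 by (unfold q; field; lra).
  rewrite Rpow_mult_distr.
  replace (INR n * Cmod (a n) * (((1 + r) / 2) ^ n * q ^ n))
    with ((Cmod (a n) * ((1 + r) / 2) ^ n) * (INR n * q ^ n)) by ring.
  apply Rmult_le_compat; try apply Rmult_le_pos; try apply Cmod_ge_0; try apply pos_INR;
    try (apply pow_le; lra); [apply HK|apply INR_geom_bound, Hq].
Qed.

Lemma adm_dcoef (a : nat -> C) : adm a -> adm (dcoef a).
Proof. intro Ha. exact (adm_shift _ (adm_mult_n a Ha)). Qed.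

(** The remainder of order 2 of a monomial. *)
Lemma monomial_remainder (z h : C) (r : R) (n : nat) :
  0 <= r -> Cmod z <= r -> Cmod z + Cmod h <= r ->
  Cmod ((z + h) ^ n - z ^ n - h * (RtoC (INR n) * z ^ pred n)) * r ^ 2
    <= Cmod h ^ 2 * (INR n ^ 2 * r ^ n).
Proof.
  intros Hr Hz Hzh.
  assert (Hzh' : Cmod (z + h) <= r) by (eapply Rle_trans; [apply Cmod_triangle|exact Hzh]).
  induction n as [|n IH].
  - simpl. replace (1 - 1 - h * (0 * 1))%C with (RtoC 0) by ring. rewrite Cmod_0. lra.
  - replace ((z + h) ^ S n - z ^ S n - h * (RtoC (INR (S n)) * z ^ pred (S n)))%C
      with ((z + h) * ((z + h) ^ n - z ^ n - h * (RtoC (INR n) * z ^ pred n))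
            + h ^ 2 * (RtoC (INR n) * z ^ pred n))%C.
    2:{ rewrite S_INR, RtoC_plus. destruct n as [|n]; simpl; [ring|].
        rewrite ?Cpow_S. ring. }
    eapply Rle_trans.
    { apply Rmult_le_compat_r; [apply pow_le, Hr|]. apply Cmod_triangle. }
    rewrite !(Cmod_mult (z + h)), !(Cmod_mult (h ^ 2)), Cmod_pow, (Cmod_mult (INR n)), Cmod_R,
      Cmod_pow, Rabs_pos_eq by apply pos_INR.
    rewrite Rmult_plus_distr_r.
    assert (T1 : Cmod (z + h) * Cmod ((z + h) ^ n - z ^ n - h * (RtoC (INR n) * z ^ pred n)) * r ^ 2
                 <= r * (Cmod h ^ 2 * (INR n ^ 2 * r ^ n))).
    { rewrite Rmult_assoc. apply Rmult_le_compat; try apply Cmod_ge_0; auto.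
      apply Rmult_le_pos; [apply Cmod_ge_0|apply pow_le, Hr]. }
    assert (T2 : Cmod h ^ 2 * (INR n * Cmod z ^ pred n) * r ^ 2 <= Cmod h ^ 2 * (INR n * r ^ S n)).
    { rewrite Rmult_assoc. apply Rmult_le_compat_l; [apply pow2_ge_0|].
      rewrite Rmult_assoc. destruct n as [|n]; [simpl; lra|].
      apply Rmult_le_compat_l; [apply pos_INR|].
      simpl pred. replace (r ^ S (S n)) with (r ^ n * r ^ 2) by (simpl; ring).
      apply Rmult_le_compat_r; [apply pow_le, Hr|]. apply pow_incr; split; [apply Cmod_ge_0|exact Hz]. }
    eapply Rle_trans; [apply Rplus_le_compat; [exact T1|exact T2]|].
    rewrite S_INR.
    replace (r * (Cmod h ^ 2 * (INR n ^ 2 * r ^ n)) + Cmod h ^ 2 * (INR n * r ^ S n))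
      with (Cmod h ^ 2 * ((INR n ^ 2 + INR n) * r ^ S n)) by (simpl; ring).
    apply Rmult_le_compat_l; [apply pow2_ge_0|]. apply Rmult_le_compat_r; [apply pow_le, Hr|].
    pose proof (pos_INR n). nra.
Qed.

(** Term by term differentiation. *)
Lemma cps_derive (a : nat -> C) (z : C) :
  adm a -> Cmod z < 1 -> cdiff (cps a) z (cps (dcoef a) z).
Proof.
  intros Ha Hz. pose proof (Cmod_ge_0 z) as Pz.
  set (r := (1 + Cmod z) / 2).
  assert (Hr : 0 < r < 1) by (unfold r; lra).
  assert (An2 : adm (fun n => RtoC (INR n) * (RtoC (INR n) * a n))%C) by
    (apply adm_mult_n, adm_mult_n, Ha).
  destruct (adm_summable _ r An2 ltac:(lra)) as [S HS].
  assert (PS : 0 <= S).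
  { apply (is_series_nonneg _ _ (fun n => Rmult_le_pos _ _ (Cmod_ge_0 _)
      (pow_le r n (Rlt_le _ _ (proj1 Hr)))) HS). }
  (* the derived series, indexed as the original one *)
  assert (Hd : cser (fun n => a n * (RtoC (INR n) * z ^ pred n))%C (cps (dcoef a) z)).
  { replace (cps (dcoef a) z) with (a 0%nat * (RtoC (INR 0) * z ^ pred 0) + cps (dcoef a) z)%C
      by (simpl; ring).
    apply (cser_incr_1 (fun n => a n * (RtoC (INR n) * z ^ pred n))%C).
    apply (cser_ext (fun n => dcoef a n * z ^ n)%C).
    - intro n. unfold dcoef. simpl pred. ring.
    - apply cps_correct; [apply adm_dcoef, Ha|exact Hz]. }
  assert (Bd : forall h, Cmod h < 1 - r ->
     Cmod (cps a (z + h)%C - cps a z - h * cps (dcoef a) z) <= S / r ^ 2 * Cmod h ^ 2).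
  { intros h Hh. assert (Hzh : Cmod z + Cmod h <= r) by (unfold r in *; lra).
    assert (Hzh' : Cmod (z + h) < 1).
    { eapply Rle_lt_trans; [apply Cmod_triangle|lra]. }
    assert (HX : cser (fun n => a n * ((z + h) ^ n - z ^ n - h * (RtoC (INR n) * z ^ pred n)))%C
       (cps a (z + h)%C + -1 * cps a z + - h * cps (dcoef a) z)%C).
    { apply (cser_ext (fun n => (a n * (z + h) ^ n + -1 * (a n * z ^ n))
                 + - h * (a n * (RtoC (INR n) * z ^ pred n)))%C); [intro; ring|].
      repeat apply cser_plus; try apply cser_scal; try (apply cps_correct; assumption).
      exact Hd. }
    replace (cps a (z + h)%C - cps a z - h * cps (dcoef a) z)%C with
      (cps a (z + h)%C + -1 * cps a z + - h * cps (dcoef a) z)%C by ring.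
    apply (cser_le _ (fun n => (Cmod h ^ 2 / r ^ 2) *
        (Cmod (RtoC (INR n) * (RtoC (INR n) * a n)) * r ^ n)) _ _ HX).
    - intro n. pose proof (monomial_remainder z h r n ltac:(lra) ltac:(unfold r; lra) Hzh) as M.
      rewrite Cmod_mult.
      rewrite (Cmod_mult (INR n)), (Cmod_mult (INR n)), Cmod_R, Rabs_pos_eq by apply pos_INR.
      apply Rmult_le_reg_r with (r ^ 2); [apply pow_lt; lra|].
      replace (Cmod h ^ 2 / r ^ 2 * (INR n * (INR n * Cmod (a n)) * r ^ n) * r ^ 2)
        with (Cmod (a n) * (Cmod h ^ 2 * (INR n ^ 2 * r ^ n))) by (field; lra).
      rewrite Rmult_assoc. apply Rmult_le_compat_l; [apply Cmod_ge_0|exact M].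
    - replace (S / r ^ 2 * Cmod h ^ 2) with ((Cmod h ^ 2 / r ^ 2) * S) by (field; lra).
      apply (is_series_scal_l (Cmod h ^ 2 / r ^ 2) _ _ HS). }
  assert (PM : 0 <= S / r ^ 2).
  { apply Rmult_le_pos; [exact PS|]. apply Rlt_le, Rinv_0_lt_compat, pow_lt; lra. }
  set (M := S / r ^ 2) in *.
  intros eps He. exists (Rmin (1 - r) (eps / (1 + M))).
  assert (0 < eps / (1 + M)) by (apply Rdiv_lt_0_compat; lra).
  split; [apply Rmin_pos; lra|]. intros h Hh.
  pose proof (Rmin_l (1 - r) (eps / (1 + M))). pose proof (Rmin_r (1 - r) (eps / (1 + M))).
  eapply Rle_trans; [apply Bd; lra|].
  pose proof (Cmod_ge_0 h).
  assert (M * Cmod h <= eps).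
  { apply Rle_trans with ((1 + M) * (eps / (1 + M))); [|right; field; lra].
    apply Rmult_le_compat; lra. }
  simpl. rewrite Rmult_1_r, <- Rmult_assoc. apply Rmult_le_compat_r; lra.
Qed.

Lemma cps_hol2 (a : nat -> C) : adm a -> hol2 (cps a).
Proof.
  intro Ha. exists (cps (dcoef a)). split; [|exists (cps (dcoef (dcoef a)))];
    intros z [_ Hz]; apply cps_derive; auto using adm_dcoef.
Qed.

Lemma cps_bounded (a : nat -> C) : adm a ->
  exists S, forall z, Cmod z < 1 / 2 -> Cmod (cps a z) <= S.
Proof.
  intro Ha. destruct (adm_summable a (1 / 2) Ha ltac:(lra)) as [S HS].
  exists S. intros z Hz.
  apply (cser_le _ _ _ _ (cps_correct a z Ha ltac:(lra))
    (fun n => cps_term_bound a z (1 / 2) n ltac:(lra)) HS).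
Qed.

(** Taylor's formula of order 5, with the remainder in closed form. *)
Lemma cps_taylor (a : nat -> C) (z : C) : adm a -> Cmod z < 1 ->
  cps a z = (a 0%nat + a 1%nat * z + a 2%nat * z ^ 2 + a 3%nat * z ^ 3 + a 4%nat * z ^ 4
             + z ^ 5 * cps (fun n => a (5 + n)%nat) z)%C.
Proof.
  intros Ha Hz. rewrite (cps_shift a) by assumption.
  do 4 (rewrite (cps_shift (shift _)) by auto 10 using adm_shift).
  change (cps (fun n => a (5 + n)%nat) z) with (cps (shift (shift (shift (shift (shift a))))) z).
  unfold shift. ring.
Qed.

Lemma adm_shift5 (a : nat -> C) : adm a -> adm (fun n => a (5 + n)%nat).
Proof.
  intro Ha. change (adm (shift (shift (shift (shift (shift a)))))). auto 10 using adm_shift.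
Qed.

Lemma cps_taylor_bigO (a : nat -> C) : adm a ->
  bigO 5 (fun z => cps a z - (a 0%nat + a 1%nat * z + a 2%nat * z ^ 2 + a 3%nat * z ^ 3
                              + a 4%nat * z ^ 4))%C.
Proof.
  intro Ha.
  apply (bigO_ext_loc 5 (fun z => z ^ 5 * cps (fun n => a (5 + n)%nat) z)%C _ 1); [lra| |].
  - intros z _ Hz. rewrite (cps_taylor a z Ha Hz). ring.
  - apply bigO_pow_mult. destruct (cps_bounded _ (adm_shift5 a Ha)) as [S HS].
    exists S, (1 / 2). split; [lra|]. intros z _ Hz. simpl. rewrite Rmult_1_r. auto.
Qed.

Lemma pow_n_Cpow (z : C) (n : nat) : pow_n (K := C_AbsRing) z n = (z ^ n)%C.
Proof. induction n as [|n IH]; [reflexivity|]. simpl. rewrite IH. reflexivity. Qed.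

(** The coefficients of a power series that converges in the whole disk, whatever
    its sum. *)
Lemma is_pseries_adm (a : nat -> C) (f : C -> C) :
  (forall z : C, Cmod z < 1 -> is_pseries (K := C_AbsRing) (V := C_NormedModule) a z (f z)) ->
  adm a /\ (forall z, Cmod z < 1 -> f z = cps a z).
Proof.
  intro H.
  assert (H' : forall z, Cmod z < 1 -> cser (fun n => a n * z ^ n)%C (f z)).
  { intros z Hz. specialize (H z Hz). unfold is_pseries in H. apply is_series_cser in H.
    eapply cser_ext; [|exact H]. intro n. cbv beta. rewrite pow_n_Cpow.
    change (z ^ n * a n = a n * z ^ n)%C. ring. }
  assert (Ha : adm a).
  { intros r Hr. assert (Hr' : Cmod (RtoC r) < 1) by (rewrite Cmod_R; apply Rabs_def1; lra).
    destruct (H' _ Hr') as [S1 S2].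
    assert (B : forall u : nat -> R, (exists l, is_series u l) -> exists M, forall n, Rabs (u n) <= M).
    { intros u [l Hl]. assert (L := ex_series_lim_0 _ (ex_intro _ l Hl)).
      destruct (filterlim_bounded u (ex_intro _ 0 L)) as [M HM]. exists M. exact HM. }
    destruct (B _ (ex_intro _ _ S1)) as [M1 HM1]. destruct (B _ (ex_intro _ _ S2)) as [M2 HM2].
    exists (M1 + M2). intro n.
    replace (Cmod (a n) * r ^ n) with (Cmod (a n * RtoC r ^ n)).
    2:{ rewrite Cmod_mult, Cmod_pow, Cmod_R, Rabs_pos_eq by lra. reflexivity. }
    specialize (HM1 n). specialize (HM2 n). cbv beta in HM1, HM2.
    set (w := (a n * RtoC r ^ n)%C) in *.
    pose proof (Rabs_pos (Re w)). pose proof (Rabs_pos (Im w)).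
    apply Rsqr_incr_0_var; [|lra]. rewrite !Rsqr_pow2, Cmod_sqr.
    rewrite <- (pow2_abs (Re w)), <- (pow2_abs (Im w)). nra. }
  split; [exact Ha|]. intros z Hz. symmetry. apply cps_unique; auto.
Qed.

(** * The power series of the principal branch of the arctangent *)

(** Coefficients of [1 / (1 + z ^ 2)], the derivative of the arctangent. *)
Fixpoint dat (n : nat) : C :=
  match n with O => 1%C | S O => 0%C | S (S m) => (- dat m)%C end.

(** Coefficients of the arctangent. *)
Definition atc (n : nat) : C :=
  match n with O => 0%C | S m => (dat m / RtoC (INR (S m)))%C end.

Lemma Cmod_dat (n : nat) : Cmod (dat n) <= 1.
Proof.
  assert (H : Cmod (dat n) <= 1 /\ Cmod (dat (S n)) <= 1).
  { induction n as [|n [IH1 IH2]].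
    - simpl. rewrite Cmod_1, Cmod_0. lra.
    - split; [exact IH2|]. change (dat (S (S n))) with (- dat n)%C. rewrite Cmod_opp. exact IH1. }
  apply H.
Qed.

Lemma RtoC_INR_S_neq0 (n : nat) : RtoC (INR (S n)) <> 0%C.
Proof. intro E. apply RtoC_inj in E. apply (not_0_INR (S n)); [lia|exact E]. Qed.

Lemma Cmod_atc (n : nat) : Cmod (atc n) <= 1.
Proof.
  destruct n as [|n]; [simpl; rewrite Cmod_0; lra|].
  unfold atc. rewrite Cmod_div by apply RtoC_INR_S_neq0.
  rewrite Cmod_R, Rabs_pos_eq by apply pos_INR.
  assert (1 <= INR (S n)) by (rewrite S_INR; pose proof (pos_INR n); lra).
  apply Rmult_le_reg_r with (INR (S n)); [lra|].
  unfold Rdiv; rewrite Rmult_assoc, Rinv_l by lra. pose proof (Cmod_dat n). lra.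
Qed.

Lemma atc_low : atc 1 = 1%C /\ atc 2 = 0%C /\ atc 3 = (- / 3)%C /\ atc 4 = 0%C.
Proof.
  unfold atc. rewrite !INR_IZR_INZ. simpl dat. simpl Z.of_nat. repeat split; field.
Qed.

Lemma adm_dat : adm dat.
Proof. apply (adm_bound dat 1), Cmod_dat. Qed.

Lemma adm_atc : adm atc.
Proof. apply (adm_bound atc 1), Cmod_atc. Qed.

Lemma cps_ext (a b : nat -> C) (z : C) : (forall n, a n = b n) -> cps a z = cps b z.
Proof.
  intro E. unfold cps. f_equal; apply Series_ext; intro n; rewrite E; reflexivity.
Qed.

Lemma dcoef_atc (n : nat) : dcoef atc n = dat n.
Proof. unfold dcoef, atc. field. apply RtoC_INR_S_neq0. Qed.

Lemma one_plus_sq_neq0 (z : C) : Cmod z < 1 -> (1 + z ^ 2)%C <> 0%C.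
Proof.
  intros Hz. replace (1 + z ^ 2)%C with (1 - (- z ^ 2))%C by ring.
  apply one_minus_neq0. rewrite Cmod_opp, Cmod_pow. pose proof (Cmod_ge_0 z). nra.
Qed.

Lemma cps_dat (z : C) : Cmod z < 1 -> cps dat z = (/ (1 + z ^ 2))%C.
Proof.
  intro Hz. assert (E : (cps dat z * (1 + z ^ 2) = 1)%C).
  { assert (E0 : cps dat z = (1 + z * (0 + z * (-1 * cps dat z)))%C).
    { rewrite cps_shift at 1 by auto using adm_dat.
      rewrite (cps_shift (shift dat)) by auto using adm_shift, adm_dat.
      rewrite (cps_ext (shift (shift dat)) (fun n => -1 * dat n)%C)
        by (intro n; unfold shift; simpl; ring).
      rewrite (proj2 (cps_scal (-1) dat z adm_dat Hz)). reflexivity. }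
    replace (cps dat z * (1 + z ^ 2))%C with (cps dat z + z ^ 2 * cps dat z)%C by ring.
    rewrite E0 at 1. ring. }
  assert (N := one_plus_sq_neq0 z Hz).
  replace (cps dat z) with (cps dat z * (1 + z ^ 2) * / (1 + z ^ 2))%C by (field; exact N).
  rewrite E. ring.
Qed.

(** On the right half plane the principal argument is an arctangent. *)
Lemma Carg_atan (z : C) : 0 < Re z -> Carg z = atan (Im z / Re z).
Proof.
  intro Hr. assert (Nz : z <> 0%C) by (intro E; rewrite E in Hr; simpl in Hr; lra).
  assert (Pm : 0 < Cmod z) by (apply Cmod_gt_0; exact Nz).
  set (u := Re z / Cmod z).
  assert (Pu : 0 < u) by (apply Rdiv_lt_0_compat; assumption).
  assert (Eacos : acos u = atan (Rabs (Im z) / Re z)).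
  { rewrite acos_atan by exact Pu. f_equal.
    replace (1 - u²) with ((Rabs (Im z) / Cmod z)²).
    - rewrite sqrt_Rsqr; [unfold u; field; lra|].
      apply Rmult_le_pos; [apply Rabs_pos|]. apply Rlt_le, Rinv_0_lt_compat, Pm.
    - rewrite !Rsqr_pow2. unfold u, Rdiv. rewrite !Rpow_mult_distr, pow2_abs.
      apply Rmult_eq_reg_r with (Cmod z ^ 2); [|apply pow_nonzero; lra].
      rewrite Rmult_minus_distr_r, !Rmult_assoc, <- Rpow_mult_distr, Rinv_l, pow1 by lra.
      rewrite Cmod_sqr. ring. }
  unfold Carg. fold u. destruct (Rle_dec 0 (Im z)) as [P|N].
  - rewrite Eacos, Rabs_pos_eq by exact P. reflexivity.
  - rewrite Eacos, Rabs_left by lra. rewrite <- atan_opp. f_equal. field; lra.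
Qed.

Lemma Cdiv_coord (a b : C) : Re (a / b)%C = (Re a * Re b + Im a * Im b) / (Re b ^ 2 + Im b ^ 2) /\
  Im (a / b)%C = (Im a * Re b - Re a * Im b) / (Re b ^ 2 + Im b ^ 2).
Proof.
  destruct a as [a1 a2], b as [b1 b2]. simpl. unfold Rdiv.
  set (N := / (b1 * (b1 * 1) + b2 * (b2 * 1))). split; ring.
Qed.

Lemma half_ln_sqr (r : R) : 0 <= r -> / 2 * ln (r ^ 2) = ln r.
Proof.
  intros [P|<-].
  - simpl. rewrite Rmult_1_r, ln_mult by exact P. field.
  - (* the logarithm is 0 outside the positive half line *)
    rewrite pow_i by lia. unfold ln. destruct (Rlt_dec 0 0) as [H|_]; [destruct (Rlt_irrefl _ H)|ring].
Qed.

(** The logarithm along a ray that starts at 1. *)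
Lemma Clog_ray (u : C) (t : R) : Rabs t * Cmod u < 1 ->
  is_derive (fun s : R => Re (Clog (1 + RtoC s * u))%C) t (Re (u / (1 + RtoC t * u))%C) /\
  is_derive (fun s : R => Im (Clog (1 + RtoC s * u))%C) t (Im (u / (1 + RtoC t * u))%C).
Proof.
  intro Ht. set (p := Re u). set (q := Im u).
  assert (Hc : forall s : R, Re (1 + RtoC s * u)%C = 1 + s * p /\ Im (1 + RtoC s * u)%C = s * q).
  { intro s. rewrite re_plus, im_plus, re_scal_l, im_scal_l.
    change (Re 1%C) with 1. change (Im 1%C) with 0. fold p q. split; ring. }
  assert (Hp : 0 < 1 + t * p).
  { pose proof (re_le_Cmod (RtoC t * u)%C) as B. rewrite Cmod_mult, Cmod_R, re_scal_l in B.
    fold p in B. apply Rabs_le_between in B. lra. }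
  assert (HN : 0 < (1 + t * p) ^ 2 + (t * q) ^ 2).
  { pose proof (pow2_ge_0 (t * q)). assert (0 < (1 + t * p) ^ 2) by (apply pow_lt; exact Hp). lra. }
  destruct (Cdiv_coord u (1 + RtoC t * u)%C) as [Er Ei].
  destruct (Hc t) as [Ht1 Ht2]. rewrite Ht1, Ht2 in Er, Ei. fold p q in Er, Ei.
  rewrite Er, Ei. split.
  - apply (is_derive_ext (fun s : R => / 2 * ln ((1 + s * p) ^ 2 + (s * q) ^ 2))).
    + intro s. unfold Clog. simpl Re. destruct (Hc s) as [E1 E2].
      rewrite <- E1, <- E2, <- Cmod_sqr. apply half_ln_sqr, Cmod_ge_0.
    + auto_derive; [exact HN|]. field. lra.
  - apply (is_derive_ext_loc (fun s : R => atan (s * q / (1 + s * p)))).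
    + set (d := (1 + t * p) / (1 + Rabs p)). pose proof (Rabs_pos p).
      assert (Pd : 0 < d) by (apply Rdiv_lt_0_compat; lra).
      exists (mkposreal d Pd). intros s Hs. change (Rabs (s - t) < d) in Hs.
      destruct (Hc s) as [E1 E2].
      assert (B : Rabs ((s - t) * p) < 1 + t * p).
      { rewrite Rabs_mult. apply Rle_lt_trans with (Rabs (s - t) * (1 + Rabs p)).
        - apply Rmult_le_compat_l; [apply Rabs_pos|lra].
        - apply Rlt_le_trans with (d * (1 + Rabs p)); [apply Rmult_lt_compat_r; lra|].
          right; unfold d; field; lra. }
      apply Rabs_def2 in B.
      unfold Clog. simpl Im. rewrite Carg_atan; rewrite E1; [rewrite E2; reflexivity|lra].
    + auto_derive.
      * lra.
      * simpl in HN. field. split; [|lra]. nra.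
Qed.

Lemma div_2i_coord (a : C) : Re (a / (2 * Ci))%C = Im a / 2 /\ Im (a / (2 * Ci))%C = - Re a / 2.
Proof.
  destruct (Cdiv_coord a (2 * Ci)%C) as [-> ->].
  replace (Re (2 * Ci)%C) with 0 by (simpl; ring). replace (Im (2 * Ci)%C) with 2 by (simpl; ring).
  split; field.
Qed.

(** On the disk the principal branch is the sum of its Taylor series: both have
    the same derivative along the rays that start at the origin. *)
Lemma Carctan_cps (w : C) : Cmod w < 1 -> Carctan w = cps atc w.
Proof.
  intro Hw.
  set (u := (Ci * w)%C). set (u' := (- (Ci * w))%C).
  assert (Hu : Cmod u = Cmod w) by (unfold u; rewrite Cmod_mult, Cmod_Ci; ring).
  assert (Hu' : Cmod u' = Cmod w) by (unfold u'; rewrite Cmod_opp; exact Hu).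
  assert (Hray : forall s : R, Carctan (RtoC s * w) =
     ((Clog (1 + RtoC s * u) - Clog (1 + RtoC s * u')) / (2 * Ci))%C).
  { intro s. unfold Carctan.
    replace (1 + Ci * (RtoC s * w))%C with (1 + RtoC s * u)%C by (unfold u; ring).
    replace (1 - Ci * (RtoC s * w))%C with (1 + RtoC s * u')%C by (unfold u'; ring).
    reflexivity. }
  assert (Hsmall : forall t, Rabs t <= 1 -> Rabs t * Cmod w < 1).
  { intros t Ht. pose proof (Cmod_ge_0 w). pose proof (Rabs_pos t). nra. }
  assert (Hder : forall t, Rabs t <= 1 ->
    is_derive (fun s : R => Re (Carctan (RtoC s * w)) - Re (cps atc (0 + RtoC s * w)%C)) t 0 /\
    is_derive (fun s : R => Im (Carctan (RtoC s * w)) - Im (cps atc (0 + RtoC s * w)%C)) t 0).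
  { intros t Ht. specialize (Hsmall t Ht).
    destruct (Clog_ray u t ltac:(rewrite Hu; exact Hsmall)) as [A1 A2].
    destruct (Clog_ray u' t ltac:(rewrite Hu'; exact Hsmall)) as [B1 B2].
    assert (Hm : Cmod (0 + RtoC t * w) < 1) by (rewrite Cplus_0_l, Cmod_mult, Cmod_R; exact Hsmall).
    destruct (cdiff_line (cps atc) 0 w _ t (cps_derive atc _ adm_atc Hm)) as [D1 D2].
    rewrite (cps_ext _ _ _ dcoef_atc), (cps_dat _ Hm), Cplus_0_l in D1, D2.
    rewrite Cplus_0_l, Cmod_mult, Cmod_R in Hm.
    (* the two derivatives agree *)
    assert (E : (u / (1 + RtoC t * u) - u' / (1 + RtoC t * u') =
                 (w * / (1 + (RtoC t * w) ^ 2)) * (2 * Ci))%C).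
    { assert (N1 : (1 + RtoC t * u)%C <> 0%C).
      { replace (1 + RtoC t * u)%C with (1 - (- (RtoC t * u)))%C by ring.
        apply one_minus_neq0. rewrite Cmod_opp, Cmod_mult, Cmod_R, Hu. exact Hm. }
      assert (N2 : (1 + RtoC t * u')%C <> 0%C).
      { replace (1 + RtoC t * u')%C with (1 - (- (RtoC t * u')))%C by ring.
        apply one_minus_neq0. rewrite Cmod_opp, Cmod_mult, Cmod_R, Hu'. exact Hm. }
      assert (Ec : (Ci * Ci)%C = (- (1))%C).
      { unfold Ci, Cmult, Copp; simpl. apply C_eq_coord; simpl; ring. }
      assert (EP : (1 + (RtoC t * w) ^ 2 = (1 + RtoC t * u) * (1 + RtoC t * u'))%C).
      { unfold u, u'. replace ((1 + RtoC t * (Ci * w)) * (1 + RtoC t * - (Ci * w)))%C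
          with (1 - (Ci * Ci) * (RtoC t * w) ^ 2)%C by ring. rewrite Ec. ring. }
      rewrite EP. replace u' with (- u)%C in * by reflexivity.
      replace (w * / ((1 + RtoC t * u) * (1 + RtoC t * - u)) * (2 * Ci))%C
        with (2 * u * / ((1 + RtoC t * u) * (1 + RtoC t * - u)))%C by (unfold u; ring).
      field. auto. }
    assert (E1 : (w * / (1 + (RtoC t * w) ^ 2) =
      (u / (1 + RtoC t * u) - u' / (1 + RtoC t * u')) / (2 * Ci))%C).
    { rewrite E. generalize (w * / (1 + (RtoC t * w) ^ 2))%C. intro X. field. apply Ci_nz. }
    rewrite E1 in D1, D2. destruct (div_2i_coord (u / (1 + RtoC t * u) - u' / (1 + RtoC t * u'))%C)
      as [F1 F2]. rewrite F1 in D1. rewrite F2 in D2.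
    unfold Cminus in D1, D2. rewrite im_plus, im_opp in D1. rewrite re_plus, re_opp in D2.
    assert (Lin : forall (F G H : R -> R) (k f g h : R), is_derive F t f -> is_derive G t g ->
       is_derive H t h -> k * (f - g) - h = 0 -> is_derive (fun s => k * (F s - G s) - H s) t 0).
    { intros F G H k f g h DF DG DH <-.
      exact (is_derive_minus _ _ _ _ _ (is_derive_scal _ _ k _ (is_derive_minus _ _ _ _ _ DF DG)) DH). }
    split.
    - eapply is_derive_ext; [|apply (Lin _ _ _ (/ 2) _ _ _ A2 B2 D1); field].
      intro s. cbv beta. rewrite Hray.
      rewrite (proj1 (div_2i_coord (Clog (1 + RtoC s * u) - Clog (1 + RtoC s * u')))).
      unfold Cminus. rewrite im_plus, im_opp.
      match goal with |- ?a = ?b => change (@eq R a b) end. field.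
    - eapply is_derive_ext; [|apply (Lin _ _ _ (- / 2) _ _ _ A1 B1 D2); field].
      intro s. cbv beta. rewrite Hray.
      rewrite (proj2 (div_2i_coord (Clog (1 + RtoC s * u) - Clog (1 + RtoC s * u')))).
      unfold Cminus. rewrite re_plus, re_opp.
      match goal with |- ?a = ?b => change (@eq R a b) end. field. }
  assert (H0 : Carctan (RtoC 0 * w) = cps atc (0 + RtoC 0 * w)%C).
  { replace (0 + RtoC 0 * w)%C with (RtoC 0) by ring. rewrite cps_0 by apply adm_atc.
    rewrite Hray. replace (1 + RtoC 0 * u)%C with (RtoC 1) by ring.
    replace (1 + RtoC 0 * u')%C with (RtoC 1) by ring.
    unfold Cdiv, Cminus. rewrite Cplus_opp_r. apply Cmult_0_l. }
  assert (K1 := derive_zero_unit_interval _ (fun t Ht => proj1 (Hder t Ht))).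
  assert (K2 := derive_zero_unit_interval _ (fun t Ht => proj2 (Hder t Ht))). cbv beta in K1, K2.
  rewrite H0 in K1, K2. rewrite !Cplus_0_l, !Cmult_1_l in K1, K2.
  apply C_eq_coord; lra.
Qed.

(** * The upper bound *)

(** A polynomial bound that holds on (0,1) extends to 1 by continuity. *)
Lemma bound_at_one (h2 h3 h4 h5 h6 : C) (B : R) :
  (forall r, 0 < r < 1 ->
     Cmod (RtoC (r ^ 2) * h2 + RtoC (r ^ 3) * h3 + RtoC (r ^ 4) * h4 + RtoC (r ^ 5) * h5
           + RtoC (r ^ 6) * h6) <= B) ->
  Cmod (h2 + h3 + h4 + h5 + h6) <= B.
Proof.
  intro H. apply le_epsilon. intros e He.
  set (S := Cmod h2 + Cmod h3 + Cmod h4 + Cmod h5 + Cmod h6).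
  assert (PS : 0 <= S) by (unfold S; pose proof (Cmod_ge_0 h2); pose proof (Cmod_ge_0 h3);
    pose proof (Cmod_ge_0 h4); pose proof (Cmod_ge_0 h5); pose proof (Cmod_ge_0 h6); lra).
  set (k := Rmin (1 / 2) (e / (6 * (1 + S)))).
  assert (Pe : 0 < e / (6 * (1 + S))) by (apply Rdiv_lt_0_compat; lra).
  assert (Pk : 0 < k) by (apply Rmin_pos; lra).
  assert (k <= 1 / 2) by apply Rmin_l.
  assert (Hk : 6 * k * S <= e).
  { assert (k <= e / (6 * (1 + S))) by apply Rmin_r.
    apply Rle_trans with (6 * (e / (6 * (1 + S))) * (1 + S)); [|right; field; lra].
    apply Rmult_le_compat; lra. }
  specialize (H (1 - k) ltac:(lra)).
  assert (Pw : forall n h, (n <= 6)%nat -> Cmod (RtoC (1 - (1 - k) ^ n) * h) <= 6 * k * Cmod h).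
  { intros n h Hn. rewrite Cmod_mult, Cmod_R. apply Rmult_le_compat_r; [apply Cmod_ge_0|].
    assert (Hp : 1 - INR n * k <= (1 - k) ^ n <= 1).
    { clear Hn. induction n as [|n IH]; [simpl; lra|]. rewrite S_INR. simpl pow.
      pose proof (pos_INR n). split.
      - assert (0 <= INR n * k * k) by (apply Rmult_le_pos; [apply Rmult_le_pos|]; lra).
        apply Rle_trans with ((1 - k) * (1 - INR n * k)); [nra|].
        apply Rmult_le_compat_l; lra.
      - nra. }
    rewrite Rabs_pos_eq by lra.
    assert (INR n <= 6) by (replace 6 with (INR 6) by (simpl; ring); apply le_INR, Hn).
    assert (INR n * k <= 6 * k) by (apply Rmult_le_compat_r; lra). lra. }
  replace (h2 + h3 + h4 + h5 + h6)%C with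
    ((RtoC ((1 - k) ^ 2) * h2 + RtoC ((1 - k) ^ 3) * h3 + RtoC ((1 - k) ^ 4) * h4
      + RtoC ((1 - k) ^ 5) * h5 + RtoC ((1 - k) ^ 6) * h6)
     + (RtoC (1 - (1 - k) ^ 2) * h2 + RtoC (1 - (1 - k) ^ 3) * h3 + RtoC (1 - (1 - k) ^ 4) * h4
      + RtoC (1 - (1 - k) ^ 5) * h5 + RtoC (1 - (1 - k) ^ 6) * h6))%C
    by (rewrite !(RtoC_minus 1); ring).
  eapply Rle_trans; [apply Cmod_triangle|].
  apply Rplus_le_compat; [exact H|].
  eapply Rle_trans; [|exact Hk].
  unfold S. rewrite !Rmult_plus_distr_l.
  repeat (eapply Rle_trans; [apply Cmod_triangle|apply Rplus_le_compat]); try (apply Pw; lia).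
Qed.

(** The bound for the first coefficients of a Schwarz function, given by an
    expansion at the origin. The Schur algorithm is applied to [r omega z / z]. *)
Lemma schwarz_coefficients_bound (omega : C -> C) (c d e g : C) :
  hol2 omega -> (forall z, in_disk z -> Cmod (omega z) <= Cmod z) ->
  bigO 5 (fun z => omega z - (c * z + d * z ^ 2 + e * z ^ 3 + g * z ^ 4))%C ->
  Cmod (H_schwarz c d e g) <= 16.
Proof.
  intros Hol Hle HO.
  assert (Hr : forall r, 0 < r < 1 ->
     Cmod (H_schwarz (RtoC r * c) (RtoC r * d) (RtoC r * e) (RtoC r * g)) <= 16).
  { intros r Hr.
    destruct (schur_parameters (fun z => RtoC r * (omega z * / z))%C r
      (RtoC r * c) (RtoC r * d) (RtoC r * e) (RtoC r * g)) as (x & y & w & Hc & Hx & Hy & Hw & -> & -> & ->).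
    - apply hol2_mult; [apply hol2_const|]. apply hol2_mult; [exact Hol|].
      apply (hol2_inv (fun z => z)); [intros z Hz; apply Hz|apply hol2_id].
    - lra.
    - intros z [Nz Hz]. assert (Pz : 0 < Cmod z) by (apply Cmod_gt_0; exact Nz).
      rewrite !Cmod_mult, Cmod_R, Rabs_pos_eq, Cmod_inv by (auto; lra).
      rewrite <- (Rmult_1_r r) at 2. apply Rmult_le_compat_l; [lra|].
      rewrite <- (Rinv_r (Cmod z)) by lra. apply Rmult_le_compat_r;
        [apply Rlt_le, Rinv_0_lt_compat, Pz|apply Hle, Hz].
    - apply (bigO_ext 4 (fun z => RtoC r * ((omega z - (c * z + d * z ^ 2 + e * z ^ 3 + g * z ^ 4)) / z))%C).
      + intros z Nz. field. exact Nz.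
      + apply bigO_scal, bigO_div_id, HO.
    - apply schur_parameter_bound; assumption. }
  set (h2 := (- 16 * e ^ 2 + 18 * (d * g))%C).
  set (h3 := (- 9 * d ^ 3 + 24 * (c * d * e) - 18 * (c ^ 2 * g))%C).
  set (h4 := (56 / 3 * (c ^ 3 * e) - 27 * (c ^ 2 * d ^ 2))%C).
  set (h5 := (13 * (c ^ 4 * d))%C). set (h6 := (- (49 / 9) * c ^ 6)%C).
  replace (H_schwarz c d e g) with (h2 + h3 + h4 + h5 + h6)%C
    by (unfold H_schwarz, h2, h3, h4, h5, h6; ring).
  apply bound_at_one. intros r Hr'. specialize (Hr r Hr').
  match goal with |- Cmod ?a <= _ => replace a with
    (H_schwarz (RtoC r * c) (RtoC r * d) (RtoC r * e) (RtoC r * g)); [exact Hr|] end.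
  unfold H_schwarz, h2, h3, h4, h5, h6. rewrite !RtoC_pow. ring.
Qed.

Lemma ex_derive_cdiff (f : C -> C) (z : C) :
  ex_derive (K := C_AbsRing) (V := C_NormedModule) f z -> exists l, cdiff f z l.
Proof. intros [l Hl]. exists l. apply is_derive_cdiff, Hl. Qed.

(** The Schwarz function of a member of the class is twice differentiable: by the
    chain rule its derivative is [q' (1 + omega ^ 2)]. *)
Lemma omega_hol2 (omega q : C -> C) :
  analytic_on_disk omega -> (forall z, in_disk z -> in_disk (omega z)) -> hol2 q ->
  (forall z, pdisk z -> cps atc (omega z) = q z) -> hol2 omega.
Proof.
  intros Ha Hin (q1 & Hq & Hq1) E.
  set (f1 := fun z => (q1 z * (1 + omega z * omega z))%C).
  assert (Hf1 : forall z, pdisk z -> cdiff omega z (f1 z)).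
  { intros z Hz. destruct (ex_derive_cdiff omega z (Ha z (proj2 Hz))) as [l Hl].
    assert (Hw := Hin z (proj2 Hz)).
    assert (D : cdiff (fun w => cps atc (omega w)) z (l * cps (dcoef atc) (omega z))%C).
    { apply cdiff_comp; [|exact Hl]. apply cps_derive; [apply adm_atc|exact Hw]. }
    rewrite (cps_ext _ _ _ dcoef_atc), (cps_dat _ Hw) in D.
    assert (D' : cdiff (fun w => cps atc (omega w)) z (q1 z)).
    { assert (Pz : 0 < Cmod z) by (apply Cmod_gt_0, Hz).
      apply (cdiff_ext_loc q _ z _ (Rmin (Cmod z) (1 - Cmod z))); [|intros h Hh|apply Hq, Hz].
      - apply Rmin_pos; [exact Pz|]. pose proof (proj2 Hz). lra.
      - symmetry. apply E. apply pdisk_near; assumption. }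
    replace (f1 z) with l; [exact Hl|].
    assert (N := one_plus_sq_neq0 _ Hw).
    unfold f1. rewrite (cdiff_unique _ _ _ _ D' D).
    replace (1 + omega z * omega z)%C with (1 + omega z ^ 2)%C by (simpl; ring). field; exact N. }
  exists f1. split; [exact Hf1|].
  assert (Io : hol1 omega) by (exists f1; exact Hf1).
  apply hol1_mult; [exact Hq1|]. apply hol1_plus; [apply hol1_const|]. apply hol1_mult; exact Io.
Qed.

(** For [f = z F] the logarithmic derivative is [1 + z F' / F]. *)
Lemma zdlog_quotient (f : C -> C) (b : nat -> C) (z : C) :
  adm b -> (forall w, Cmod w < 1 -> f w = (w * cps b w)%C) -> pdisk z -> cps b z <> 0%C ->
  zdlog f z = (1 + z * cps (dcoef b) z / cps b z)%C.
Proof.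
  intros Hb Hf [Nz Hz] NF. unfold zdlog. destruct (Ceq_dec z 0) as [E|_]; [contradiction|].
  assert (D : cdiff f z (cps b z + z * cps (dcoef b) z)%C).
  { apply (cdiff_ext_loc (fun w => w * cps b w)%C _ z _ (1 - Cmod z)); [lra| |].
    - intros h Hh. symmetry. apply Hf. eapply Rle_lt_trans; [apply Cmod_triangle|lra].
    - replace (cps b z + z * cps (dcoef b) z)%C with (1 * cps b z + z * cps (dcoef b) z)%C by ring.
      apply (cdiff_mult (fun w => w) (cps b)); [apply cdiff_id|apply cps_derive; assumption]. }
  rewrite (is_C_derive_unique f z _ (proj2 (is_derive_cdiff _ _ _) D)).
  rewrite Hf by exact Hz. field. auto.
Qed.

(** Expansion of the logarithmic derivative [z F' / F] of [F = 1 + b1 z + ...]. *)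
Lemma log_derivative_expansion (b : nat -> C) (p1 p2 p3 p4 : C) :
  adm b -> b 0%nat = 1%C ->
  p1 = b 1%nat -> p2 = (2 * b 2%nat - b 1%nat * p1)%C ->
  p3 = (3 * b 3%nat - b 1%nat * p2 - b 2%nat * p1)%C ->
  p4 = (4 * b 4%nat - b 1%nat * p3 - b 2%nat * p2 - b 3%nat * p1)%C ->
  (forall z, Cmod z < 1 -> cps b z <> 0%C) ->
  bigO 5 (fun z => z * cps (dcoef b) z / cps b z
                   - (p1 * z + p2 * z ^ 2 + p3 * z ^ 3 + p4 * z ^ 4))%C.
Proof.
  intros Hb Hb0 E1 E2 E3 E4 NF.
  set (P := fun z : C => (p1 * z + p2 * z ^ 2 + p3 * z ^ 3 + p4 * z ^ 4)%C).
  assert (TF := cps_taylor_bigO b Hb). assert (TD := cps_taylor_bigO _ (adm_dcoef b Hb)).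
  assert (HP : bigO 0 P).
  { unfold P. repeat apply bigO_plus; apply bigO_scal; [apply (bigO_le 0 1); [lia|apply bigO_id]|..];
      (eapply bigO_le; [apply Nat.le_0_l|apply bigO_pow]). }
  assert (HI : bigO 0 (fun z => / cps b z)%C).
  { apply (bigO_inv _ 1%C); [apply C1_nz|].
    apply (bigO_ext 1 (fun z => (cps b z - (b 0%nat + b 1%nat * z + b 2%nat * z ^ 2 + b 3%nat * z ^ 3
              + b 4%nat * z ^ 4)) + z ^ 1 * ((b 1%nat + b 2%nat * z + b 3%nat * z ^ 2)
              + z ^ 3 * b 4%nat))%C).
    - intros z _. rewrite Hb0. ring.
    - apply bigO_plus; [eapply bigO_le; [|exact TF]; lia|]. apply bigO_pow_mult.
      apply bigO_plus; [apply bigO_quadratic|].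
      eapply bigO_le; [|apply (bigO_pow_mult 3), bigO_const]; lia. }
  assert (HN : bigO 5 (fun z => z * cps (dcoef b) z - P z * cps b z)%C).
  { set (Q := fun z : C => (5 * b 5%nat - (p1 * b 4%nat + p2 * b 3%nat + p3 * b 2%nat + p4 * b 1%nat)
         + - (p2 * b 4%nat + p3 * b 3%nat + p4 * b 2%nat) * z
         + - (p3 * b 4%nat + p4 * b 3%nat) * z ^ 2 + z ^ 3 * (- (p4 * b 4%nat)))%C).
    apply (bigO_ext 5 (fun z => (z * (cps (dcoef b) z - (dcoef b 0%nat + dcoef b 1%nat * z
         + dcoef b 2%nat * z ^ 2 + dcoef b 3%nat * z ^ 3 + dcoef b 4%nat * z ^ 4))
       - P z * (cps b z - (b 0%nat + b 1%nat * z + b 2%nat * z ^ 2 + b 3%nat * z ^ 3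
              + b 4%nat * z ^ 4))) + z ^ 5 * Q z)%C).
    - intros z _. unfold Q, P, dcoef. rewrite Hb0, E4, E3, E2, E1. simpl INR.
      rewrite ?RtoC_plus. ring.
    - apply bigO_plus; [apply bigO_minus|].
      + apply (bigO_mult 0 5); [|exact TD]. eapply bigO_le; [|apply bigO_id]; lia.
      + apply (bigO_mult 0 5); assumption.
      + apply bigO_pow_mult. apply bigO_plus; [apply bigO_quadratic|].
        eapply bigO_le; [|apply (bigO_pow_mult 3), bigO_const]; lia. }
  apply (bigO_ext_loc 5 (fun z => (z * cps (dcoef b) z - P z * cps b z) * / cps b z)%C _ 1); [lra| |].
  - intros z _ Hz. unfold P. field. apply NF, Hz.
  - apply (bigO_mult 5 0); assumption.
Qed.

(** Expansion of [omega] from that of [arctan omega]: the approximation of [omega]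
    to order 3 determines [omega ^ 3], hence [omega], to order 5. *)
Lemma omega_expansion (omega q : C -> C) (p1 p2 p3 p4 : C) :
  (forall z, in_disk z -> Cmod (omega z) <= Cmod z) ->
  (forall z, pdisk z -> cps atc (omega z) = q z) ->
  bigO 5 (fun z => q z - (p1 * z + p2 * z ^ 2 + p3 * z ^ 3 + p4 * z ^ 4))%C ->
  bigO 5 (fun z => omega z - (p1 * z + p2 * z ^ 2 + (p3 + p1 ^ 3 / 3) * z ^ 3
                              + (p4 + p1 ^ 2 * p2) * z ^ 4))%C.
Proof.
  intros Hle E Hq.
  assert (Hom : bigO 1 omega).
  { exists 1, 1. split; [lra|]. intros z _ Hz. simpl. rewrite Rmult_1_l, Rmult_1_r. apply Hle, Hz. }
  assert (HR : bigO 5 (fun z => cps atc (omega z) - (omega z - omega z ^ 3 / 3))%C).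
  { apply (bigO_ext_loc 5 (fun z => (omega z * omega z * omega z * omega z * omega z)
        * cps (fun n => atc (5 + n)%nat) (omega z))%C _ 1); [lra| |].
    - intros z _ Hz. rewrite (cps_taylor atc (omega z) adm_atc).
      + change (atc 0) with (RtoC 0). destruct atc_low as (-> & -> & -> & ->). field.
      + eapply Rle_lt_trans; [apply Hle, Hz|exact Hz].
    - apply (bigO_mult 5 0).
      + apply (bigO_mult 4 1); [apply (bigO_mult 3 1); [apply (bigO_mult 2 1);
          [apply (bigO_mult 1 1)|]|]|]; exact Hom.
      + destruct (cps_bounded _ (adm_shift5 atc adm_atc)) as [S HS].
        exists S, (1 / 2). split; [lra|]. intros z _ Hz. simpl. rewrite Rmult_1_r. apply HS.
        eapply Rle_lt_trans; [apply Hle; unfold in_disk; lra|exact Hz]. }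
  set (P := fun z : C => (p1 * z + p2 * z ^ 2 + p3 * z ^ 3 + p4 * z ^ 4)%C) in *.
  set (W := fun z : C => (p1 * z + p2 * z ^ 2)%C).
  (* the equation omega = P + omega ^ 3 / 3 up to order 5 *)
  assert (H5 : bigO 5 (fun z => omega z - (P z + omega z ^ 3 / 3))%C).
  { apply (bigO_ext_loc 5 (fun z => (q z - P z) - (cps atc (omega z) - (omega z - omega z ^ 3 / 3)))%C
      _ 1); [lra| |].
    - intros z Nz Hz. rewrite E by (split; assumption). ring.
    - apply bigO_minus; assumption. }
  assert (HW : bigO 1 W).
  { apply bigO_plus; apply bigO_scal; [apply bigO_id|]. eapply bigO_le; [|apply bigO_pow]; lia. }
  assert (H3 : bigO 3 (fun z => omega z - W z)%C).
  { apply (bigO_ext 3 (fun z => (omega z - (P z + omega z ^ 3 / 3))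
       + (z ^ 3 * (p3 + p4 * z + 0 * z ^ 2) + / 3 * (omega z * omega z * omega z)))%C).
    - intros z _. unfold P, W. field.
    - apply bigO_plus; [eapply bigO_le; [|exact H5]; lia|]. apply bigO_plus.
      + apply bigO_pow_mult, bigO_quadratic.
      + apply bigO_scal. apply (bigO_mult 2 1); [apply (bigO_mult 1 1)|]; exact Hom. }
  apply (bigO_ext 5 (fun z => (omega z - (P z + omega z ^ 3 / 3))
     + (/ 3 * ((omega z - W z) * (omega z * omega z + omega z * W z + W z * W z))
        + z ^ 5 * (p1 * p2 ^ 2 + p2 ^ 3 / 3 * z + 0 * z ^ 2)))%C).
  - intros z _. unfold P, W. field.
  - apply bigO_plus; [exact H5|]. apply bigO_plus.
    + apply bigO_scal. apply (bigO_mult 3 2); [exact H3|].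
      repeat apply bigO_plus; apply (bigO_mult 1 1); assumption.
    + apply bigO_pow_mult, bigO_quadratic.
Qed.

Theorem H3_upper_bound (f : C -> C) (a : nat -> C) :
  class_S_tau f -> normalized_expansion f a -> Cmod (H3_1 a) <= 1 / 9.
Proof.
  intros (_ & Hnz & omega & Hom & Hin & _ & Hle & Hsub) (Ha0 & Ha1 & Hps).
  destruct (is_pseries_adm a f Hps) as [Ha Hfa].
  set (b := shift a). assert (Hb : adm b) by (apply adm_shift, Ha).
  assert (Hf : forall z, Cmod z < 1 -> f z = (z * cps b z)%C).
  { intros z Hz. rewrite Hfa, cps_shift, Ha0 by assumption. fold b. ring. }
  assert (Hb0 : b 0%nat = 1%C) by exact Ha1.
  assert (NF : forall z, Cmod z < 1 -> cps b z <> 0%C).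
  { intros z Hz E. destruct (Ceq_dec z 0) as [->|N].
    - rewrite cps_0, Hb0 in E by exact Hb. exact (C1_nz E).
    - apply (Hnz z Hz N). rewrite Hf, E by exact Hz. ring. }
  set (q := fun z => (z * cps (dcoef b) z / cps b z)%C).
  assert (Eq : forall z, pdisk z -> cps atc (omega z) = q z).
  { intros z Hz. rewrite <- Carctan_cps by (apply Hin, Hz).
    assert (S1 := Hsub z (proj2 Hz)). cbv beta in S1.
    rewrite (zdlog_quotient f b z Hb Hf Hz (NF z (proj2 Hz))) in S1. fold (q z) in S1.
    replace (Carctan (omega z)) with ((1 + Carctan (omega z)) - 1)%C by ring.
    rewrite <- S1. ring. }
  assert (Hq : hol2 q).
  { apply (hol2_ext (fun z => (z * cps (dcoef b) z) * / cps b z)%C); [reflexivity|].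
    apply hol2_mult; [apply hol2_mult; [apply hol2_id|apply cps_hol2, adm_dcoef, Hb]|].
    apply hol2_inv; [intros z Hz; apply NF, Hz|apply cps_hol2, Hb]. }
  assert (Hol := omega_hol2 omega q Hom Hin Hq Eq).
  pose (p1 := b 1%nat). pose (p2 := (2 * b 2%nat - b 1%nat * p1)%C).
  pose (p3 := (3 * b 3%nat - b 1%nat * p2 - b 2%nat * p1)%C).
  pose (p4 := (4 * b 4%nat - b 1%nat * p3 - b 2%nat * p2 - b 3%nat * p1)%C).
  assert (HO := omega_expansion omega q p1 p2 p3 p4 Hle Eq
    (log_derivative_expansion b p1 p2 p3 p4 Hb Hb0 eq_refl eq_refl eq_refl eq_refl NF)).
  assert (B := schwarz_coefficients_bound omega _ _ _ _ Hol Hle HO).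
  assert (EH : H_schwarz p1 p2 (p3 + p1 ^ 3 / 3) (p4 + p1 ^ 2 * p2) = (144 * H3_1 a)%C).
  { unfold H_schwarz, H3_1, p4, p3, p2, p1, b, shift. field. }
  rewrite EH, Cmod_mult, Cmod_R, Rabs_pos_eq in B by lra. lra.
Qed.

(** * Products of power series and first order differential equations *)

Lemma constant_on_disk (f : C -> C) (z : C) :
  (forall w, Cmod w < 1 -> cdiff f w 0%C) -> Cmod z < 1 -> f z = f 0%C.
Proof.
  intros H Hz.
  assert (D : forall t, Rabs t <= 1 ->
    is_derive (fun s : R => Re (f (0 + RtoC s * z)%C)) t 0 /\
    is_derive (fun s : R => Im (f (0 + RtoC s * z)%C)) t 0).
  { intros t Ht. assert (Hw : Cmod (0 + RtoC t * z) < 1).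
    { rewrite Cplus_0_l, Cmod_mult, Cmod_R. pose proof (Cmod_ge_0 z). pose proof (Rabs_pos t). nra. }
    destruct (cdiff_line f 0 z 0 t (H _ Hw)) as [D1 D2]. rewrite Cmult_0_r in D1, D2.
    split; assumption. }
  assert (K1 := derive_zero_unit_interval _ (fun t Ht => proj1 (D t Ht))).
  assert (K2 := derive_zero_unit_interval _ (fun t Ht => proj2 (D t Ht))).
  cbv beta in K1, K2.
  replace (0 + RtoC 1 * z)%C with z in K1, K2 by ring.
  replace (0 + RtoC 0 * z)%C with (RtoC 0) in K1, K2 by ring.
  apply C_eq_coord; assumption.
Qed.

(** The Cauchy product of two sequences. *)
Definition conv (a b : nat -> C) (n : nat) : C :=
  sum_n (G := C_AbelianMonoid) (fun k => a k * b (n - k)%nat)%C n.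

Lemma cser_conv (a b : nat -> C) (l m : C) :
  cser a l -> cser b m -> ex_series (fun n => Cmod (a n)) -> ex_series (fun n => Cmod (b n)) ->
  cser (conv a b) (l * m)%C.
Proof.
  intros [A1 A2] [B1 B2] Sa Sb.
  assert (Dom : forall (u : nat -> C) (P : C -> R), (forall w, Rabs (P w) <= Cmod w) ->
     ex_series (fun n => Cmod (u n)) -> ex_series (fun n => Rabs (P (u n)))).
  { intros u P HP Hu.
    apply (ex_series_le (K := R_AbsRing) (V := R_CompleteNormedModule) _ (fun n => Cmod (u n)));
      [|exact Hu].
    intro n. change (Rabs (Rabs (P (u n))) <= Cmod (u n)). rewrite Rabs_Rabsolu. apply HP. }
  assert (PR := fun w => proj1 (coord_le_Cmod w)). assert (PI := fun w => proj2 (coord_le_Cmod w)).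
  assert (RR := is_series_mult _ _ _ _ A1 B1 (Dom a Re PR Sa) (Dom b Re PR Sb)).
  assert (II := is_series_mult _ _ _ _ A2 B2 (Dom a Im PI Sa) (Dom b Im PI Sb)).
  assert (RI := is_series_mult _ _ _ _ A1 B2 (Dom a Re PR Sa) (Dom b Im PI Sb)).
  assert (IR := is_series_mult _ _ _ _ A2 B1 (Dom a Im PI Sa) (Dom b Re PR Sb)).
  split.
  - rewrite re_mult. eapply is_series_ext; [|exact (is_series_minus _ _ _ _ RR II)].
    intro n. unfold conv. rewrite (proj1 (sum_n_coord _ n)), sum_n_Reals.
    change (sum_f_R0 (fun k => Re (a k) * Re (b (n - k)%nat)) n
            - sum_f_R0 (fun k => Im (a k) * Im (b (n - k)%nat)) n
            = sum_f_R0 (fun k => Re (a k * b (n - k)%nat)%C) n).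
    rewrite <- minus_sum. apply sum_eq. intros k _. rewrite re_mult. reflexivity.
  - rewrite im_mult. eapply is_series_ext; [|exact (is_series_plus _ _ _ _ RI IR)].
    intro n. unfold conv. rewrite (proj2 (sum_n_coord _ n)), sum_n_Reals.
    change (sum_f_R0 (fun k => Re (a k) * Im (b (n - k)%nat)) n
            + sum_f_R0 (fun k => Im (a k) * Re (b (n - k)%nat)) n
            = sum_f_R0 (fun k => Im (a k * b (n - k)%nat)%C) n).
    rewrite <- plus_sum. apply sum_eq. intros k _. rewrite im_mult. reflexivity.
Qed.

Lemma cps_conv (a b : nat -> C) (z : C) : adm a -> adm b -> adm (conv a b) -> Cmod z < 1 ->
  cps (conv a b) z = (cps a z * cps b z)%C.
Proof.
  intros Ha Hb Hc Hz. apply cps_unique; auto.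
  assert (Abs : forall u, adm u -> ex_series (fun n => Cmod (u n * z ^ n))).
  { intros u Hu. eapply ex_series_ext; [|apply (adm_summable u (Cmod z) Hu)].
    - intro n. cbv beta. rewrite Cmod_mult, Cmod_pow. reflexivity.
    - split; [apply Cmod_ge_0|exact Hz]. }
  eapply cser_ext; [|apply (cser_conv _ _ _ _ (cps_correct a z Ha Hz) (cps_correct b z Hb Hz)
    (Abs a Ha) (Abs b Hb))].
  intro n. unfold conv.
  transitivity (sum_n (G := C_AbelianMonoid) (fun k => (z ^ n) * (a k * b (n - k)%nat))%C n).
  - apply (sum_n_ext_loc (G := C_AbelianMonoid)). intros k Hk.
    replace (z ^ n)%C with (z ^ k * z ^ (n - k))%C by (rewrite <- Cpow_add_r; f_equal; lia).
    match goal with |- ?u = ?v => change (@eq C u v) end. ring.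
  - etransitivity; [exact (sum_n_mult_l (K := C_Ring) (z ^ n)%C
      (fun k => a k * b (n - k)%nat)%C n)|]. apply Cmult_comm.
Qed.

(** The coefficients of the solution of [F' = s F], [F 0 = 1]: the list of the
    first [n + 1] of them, in reverse order. *)
Fixpoint ode_list (s : nat -> C) (n : nat) : list C :=
  match n with
  | O => [RtoC 1]
  | S m => (sum_n (G := C_AbelianMonoid) (fun k => s k * nth k (ode_list s m) (RtoC 0))%C m
            / RtoC (INR (S m)))%C :: ode_list s m
  end.

Definition ode_coef (s : nat -> C) (n : nat) : C := nth 0 (ode_list s n) (RtoC 0).

Lemma ode_list_nth (s : nat -> C) (n k : nat) : (k <= n)%nat ->
  nth k (ode_list s n) (RtoC 0) = ode_coef s (n - k).
Proof.
  revert k; induction n as [|n IH]; intros [|k] Hk; try reflexivity; [lia|].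
  simpl ode_list. simpl nth. rewrite IH by lia. reflexivity.
Qed.

(** The equation [F' = s F] for the coefficients. *)
Lemma ode_coef_S (s : nat -> C) (n : nat) : dcoef (ode_coef s) n = conv s (ode_coef s) n.
Proof.
  unfold dcoef. unfold ode_coef at 1. cbn [ode_list nth].
  assert (Cancel : forall T : C, (RtoC (INR (S n)) * (T / RtoC (INR (S n))))%C = T)
    by (intro T; field; apply RtoC_INR_S_neq0).
  rewrite Cancel. unfold conv. apply (sum_n_ext_loc (G := C_AbelianMonoid)). intros k Hk.
  rewrite ode_list_nth by lia. reflexivity.
Qed.

Lemma sum_n_Cmod_le (u : nat -> C) (n : nat) :
  (forall k, Cmod (u k) <= 1) -> Cmod (sum_n (G := C_AbelianMonoid) u n) <= INR (S n).
Proof.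
  intro H. induction n as [|n IH].
  - rewrite sum_O. specialize (H 0%nat). simpl. exact H.
  - rewrite sum_Sn, S_INR. eapply Rle_trans; [apply Cmod_triangle|].
    apply Rplus_le_compat; auto.
Qed.

Lemma Cmod_ode_coef (s : nat -> C) (n : nat) :
  (forall k, Cmod (s k) <= 1) -> Cmod (ode_coef s n) <= 1.
Proof.
  intro Hs.
  assert (H : forall k, Cmod (nth k (ode_list s n) (RtoC 0)) <= 1).
  { induction n as [|n IH]; intros [|k].
    - simpl. rewrite Cmod_1; lra.
    - simpl. destruct k; rewrite Cmod_0; lra.
    - cbn [ode_list nth]. rewrite Cmod_div by apply RtoC_INR_S_neq0.
      rewrite Cmod_R, Rabs_pos_eq by apply pos_INR.
      assert (P : 0 < INR (S n)) by (apply lt_0_INR; lia).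
      apply Rmult_le_reg_r with (INR (S n)); [exact P|].
      unfold Rdiv; rewrite Rmult_assoc, Rinv_l, Rmult_1_r, Rmult_1_l by lra.
      apply sum_n_Cmod_le. intro k. rewrite Cmod_mult.
      rewrite <- (Rmult_1_r 1). apply Rmult_le_compat; auto using Cmod_ge_0.
    - simpl. apply IH. }
  apply H.
Qed.

Lemma adm_ode (s : nat -> C) : (forall k, Cmod (s k) <= 1) -> adm (ode_coef s).
Proof. intro Hs. apply (adm_bound _ 1). intro n. apply Cmod_ode_coef, Hs. Qed.

Lemma cps_ode (s : nat -> C) (z : C) : (forall k, Cmod (s k) <= 1) -> Cmod z < 1 ->
  cps (dcoef (ode_coef s)) z = (cps s z * cps (ode_coef s) z)%C.
Proof.
  intros Hs Hz. assert (Hb := adm_ode s Hs).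
  assert (Hc : adm (conv s (ode_coef s))).
  { intros r Hr. destruct (adm_dcoef _ Hb r Hr) as [K HK]. exists K. intro n.
    rewrite <- ode_coef_S. apply HK. }
  rewrite <- (cps_conv s (ode_coef s) z (adm_bound s 1 Hs) Hb Hc Hz).
  apply cps_ext, ode_coef_S.
Qed.

(** The solution does not vanish: its product with the solution for [- s] is 1. *)
Lemma cps_ode_neq0 (s : nat -> C) (z : C) : (forall k, Cmod (s k) <= 1) -> Cmod z < 1 ->
  cps (ode_coef s) z <> 0%C.
Proof.
  intros Hs Hz.
  set (s' := fun n => (-1 * s n)%C).
  assert (Hs' : forall k, Cmod (s' k) <= 1).
  { intro k. unfold s'. rewrite Cmod_mult, Cmod_R, Rabs_left by lra. specialize (Hs k). lra. }
  assert (E : (cps (ode_coef s) z * cps (ode_coef s') z = 1)%C).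
  { rewrite (constant_on_disk (fun w => cps (ode_coef s) w * cps (ode_coef s') w)%C z); [| |exact Hz].
    - rewrite !cps_0 by auto using adm_ode. unfold ode_coef; simpl. ring.
    - intros w Hw.
      replace (RtoC 0) with (cps (dcoef (ode_coef s)) w * cps (ode_coef s') w
        + cps (ode_coef s) w * cps (dcoef (ode_coef s')) w)%C.
      + apply cdiff_mult; apply cps_derive; auto using adm_ode.
      + rewrite !cps_ode by assumption. unfold s' at 2.
        rewrite (proj2 (cps_scal (-1) s w (adm_bound s 1 Hs) Hw)). ring. }
  intro E0. rewrite E0, Cmult_0_l in E. symmetry in E. exact (C1_nz E).
Qed.

(** * The extremal function *)

(** Coefficients of the derivative [3 z ^ 2 / (1 + z ^ 6)] of [arctan (z ^ 3)], which
    change sign under a shift by 6. *)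
Fixpoint dcube (n : nat) : C :=
  match n with
  | 2%nat => 3%C
  | S (S (S (S (S (S m))))) => (- dcube m)%C
  | _ => 0%C
  end.

(** Coefficients of [arctan (z ^ 3) / z]. *)
Definition scube (n : nat) : C := (dcube n / RtoC (INR (S n)))%C.

Lemma Cmod_dcube (n : nat) : Cmod (dcube n) <= 3 /\ ((n < 2)%nat -> dcube n = 0%C).
Proof.
  assert (H : forall k, Cmod (dcube k) <= 3 /\ Cmod (dcube (1 + k)) <= 3 /\ Cmod (dcube (2 + k)) <= 3
     /\ Cmod (dcube (3 + k)) <= 3 /\ Cmod (dcube (4 + k)) <= 3 /\ Cmod (dcube (5 + k)) <= 3).
  { induction k as [|k IH].
    - simpl. rewrite Cmod_0, Cmod_R, Rabs_pos_eq by lra. lra.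
    - destruct IH as (H0 & H1 & H2 & H3 & H4 & H5).
      repeat split; try assumption. simpl. rewrite Cmod_opp. exact H0. }
  split; [apply H|]. intro Hn. destruct n as [|[|n]]; try reflexivity. lia.
Qed.

Lemma Cmod_scube (n : nat) : Cmod (scube n) <= 1.
Proof.
  destruct (Cmod_dcube n) as [H1 H2]. unfold scube.
  rewrite Cmod_div by apply RtoC_INR_S_neq0. rewrite Cmod_R, Rabs_pos_eq by apply pos_INR.
  assert (P : 0 < INR (S n)) by (apply lt_0_INR; lia).
  apply Rmult_le_reg_r with (INR (S n)); [exact P|].
  unfold Rdiv; rewrite Rmult_assoc, Rinv_l, Rmult_1_r, Rmult_1_l by lra.
  destruct (Nat.lt_ge_cases n 2) as [L|G].
  - rewrite H2, Cmod_0 by exact L. lra.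
  - eapply Rle_trans; [exact H1|]. replace 3 with (INR 3) by (simpl; ring). apply le_INR; lia.
Qed.

Lemma cps_dcube (z : C) : Cmod z < 1 -> cps dcube z = (3 * z ^ 2 * / (1 + (z ^ 3) ^ 2))%C.
Proof.
  intro Hz. assert (Ad : adm dcube) by (apply (adm_bound dcube 3); intro; apply Cmod_dcube).
  assert (E : (cps dcube z = 3 * z ^ 2 + z ^ 6 * (-1 * cps dcube z))%C).
  { rewrite (cps_taylor dcube z Ad Hz) at 1. rewrite (cps_shift _ z (adm_shift5 _ Ad) Hz).
    rewrite (cps_ext (shift (fun n => dcube (5 + n))) (fun n => -1 * dcube n)%C)
      by (intro n; unfold shift; simpl; ring).
    rewrite (proj2 (cps_scal (-1) dcube z Ad Hz)). simpl dcube. ring. }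
  assert (N : (1 + (z ^ 3) ^ 2)%C <> 0%C).
  { apply one_plus_sq_neq0. rewrite Cmod_pow. pose proof (Cmod_ge_0 z).
    apply Rle_lt_trans with (Cmod z); [|exact Hz]. simpl. nra. }
  assert (E' : (cps dcube z * (1 + (z ^ 3) ^ 2) = 3 * z ^ 2)%C).
  { replace (cps dcube z * (1 + (z ^ 3) ^ 2))%C with (cps dcube z + z ^ 6 * cps dcube z)%C by ring.
    rewrite E at 1. ring. }
  rewrite <- E'. field. exact N.
Qed.

Lemma Cmod_cube (z : C) : Cmod z < 1 -> Cmod (z ^ 3) <= Cmod z.
Proof. intro Hz. rewrite Cmod_pow. pose proof (Cmod_ge_0 z). simpl. nra. Qed.

Lemma cps_scube (z : C) : Cmod z < 1 -> (z * cps scube z)%C = cps atc (z ^ 3)%C.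
Proof.
  intro Hz.
  set (P := fun n : nat => match n with O => RtoC 0 | S m => scube m end).
  assert (AP : adm P).
  { apply (adm_bound P 1). intros [|n]; [simpl; rewrite Cmod_0; lra|apply Cmod_scube]. }
  assert (EP : forall w, Cmod w < 1 -> cps P w = (w * cps scube w)%C).
  { intros w Hw. rewrite cps_shift by assumption.
    change (shift P) with scube. simpl. ring. }
  assert (ED : forall n, dcoef P n = dcube n).
  { intro n. unfold dcoef, P, scube. field. apply RtoC_INR_S_neq0. }
  assert (Hc : forall w, Cmod w < 1 -> Cmod (w ^ 3) < 1).
  { intros w Hw. eapply Rle_lt_trans; [apply Cmod_cube, Hw|exact Hw]. }
  assert (K := constant_on_disk (fun w => cps P w + -1 * cps atc (w ^ 3))%C z).
  cbv beta in K. rewrite <- EP by exact Hz.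
  replace (cps P z) with ((cps P z + -1 * cps atc (z ^ 3)) + cps atc (z ^ 3))%C by ring.
  rewrite K; [|clear K Hz z; intros w Hw|exact Hz].
  - replace (0 ^ 3)%C with (RtoC 0) by (simpl; ring).
    rewrite !cps_0 by auto using adm_atc. simpl. ring.
  - assert (D3 : cdiff (fun v => v ^ 3)%C w (3 * w ^ 2)%C).
    { assert (D := cdiff_mult _ _ w _ _ (cdiff_mult _ _ w _ _ (cdiff_id w) (cdiff_id w)) (cdiff_id w)).
      cbv beta in D. apply (cdiff_ext_loc (fun v => v * v * v)%C _ w _ 1); [lra|intros; ring|].
      replace (3 * w ^ 2)%C with ((1 * w + w * 1) * w + w * w * 1)%C by ring. exact D. }
    assert (D4 := cdiff_comp (cps atc) (fun v => v ^ 3)%C w _ _ (cps_derive atc _ adm_atc (Hc w Hw)) D3).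
    assert (D5 := cdiff_mult _ _ w _ _ (cdiff_const (-1) w) D4).
    assert (D6 := cdiff_plus _ _ w _ _ (cps_derive P w AP Hw) D5).
    rewrite (cps_ext _ _ _ ED), (cps_dcube w Hw), (cps_ext _ _ _ dcoef_atc), (cps_dat _ (Hc w Hw)) in D6.
    match type of D6 with cdiff _ _ ?l => replace (RtoC 0) with l; [exact D6|ring] end.
Qed.

(** The extremal function [z exp (int_0^z arctan (t ^ 3) / t dt)], of the form [z F] with
    [F' = (arctan (z ^ 3) / z) F], and its coefficients. *)
Definition extremal_coef (n : nat) : C :=
  match n with O => 0%C | S m => ode_coef scube m end.
Definition extremal (z : C) : C := (z * cps (ode_coef scube) z)%C.

Lemma cps_is_pseries (a : nat -> C) (z : C) : adm a -> Cmod z < 1 ->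
  is_pseries (K := C_AbsRing) (V := C_NormedModule) a z (cps a z).
Proof.
  intros Ha Hz. unfold is_pseries. apply is_series_cser.
  eapply cser_ext; [|apply (cps_correct a z Ha Hz)]. intro n. cbv beta.
  etransitivity; [apply Cmult_comm|]. rewrite <- pow_n_Cpow. reflexivity.
Qed.

Lemma extremal_expansion : normalized_expansion extremal extremal_coef.
Proof.
  assert (Hb := adm_ode scube Cmod_scube).
  assert (Ha : adm extremal_coef).
  { apply (adm_bound _ 1). intros [|n]; simpl; [rewrite Cmod_0; lra|].
    apply Cmod_ode_coef, Cmod_scube. }
  split; [reflexivity|]. split; [reflexivity|]. intros z Hz.
  replace (extremal z) with (cps extremal_coef z); [apply cps_is_pseries; assumption|].
  rewrite cps_shift by assumption. change (shift extremal_coef) with (ode_coef scube).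
  unfold extremal. simpl. ring.
Qed.

Lemma extremal_class : class_S_tau extremal.
Proof.
  assert (Hb := adm_ode scube Cmod_scube).
  assert (NF : forall z, Cmod z < 1 -> cps (ode_coef scube) z <> 0%C) by
    (intros; apply cps_ode_neq0; auto using Cmod_scube).
  split; [split; [|exists extremal_coef; apply extremal_expansion]|split].
  - intros z Hz. eexists. apply is_derive_cdiff.
    apply (cdiff_mult (fun w => w)); [apply cdiff_id|apply cps_derive; assumption].
  - intros z Hz N. apply Cmult_neq_0; [exact N|apply NF, Hz].
  - exists (fun z => (z ^ 3)%C). repeat split.
    + intros z Hz. eexists. apply is_derive_cdiff.
      apply (cdiff_ext_loc (fun v => v * v * v)%C _ z _ 1); [lra|intros; ring|].
      repeat apply cdiff_mult; apply cdiff_id.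
    + intros z Hz. eapply Rle_lt_trans; [apply Cmod_cube, Hz|exact Hz].
    + simpl. ring.
    + intros z Hz. apply Cmod_cube, Hz.
    + intros z Hz. rewrite Carctan_cps by (eapply Rle_lt_trans; [apply Cmod_cube, Hz|exact Hz]).
      destruct (Ceq_dec z 0) as [->|N].
      * unfold zdlog. destruct (Ceq_dec 0 0) as [_|F]; [|contradiction F; reflexivity].
        replace (0 ^ 3)%C with (RtoC 0) by (simpl; ring).
        rewrite cps_0 by apply adm_atc. simpl. ring.
      * rewrite (zdlog_quotient extremal (ode_coef scube) z Hb (fun _ _ => eq_refl) (conj N Hz) (NF z Hz)).
        rewrite cps_ode by auto using Cmod_scube. rewrite <- cps_scube by exact Hz.
        field. apply NF, Hz.
Qed.

Lemma extremal_H3 : Cmod (H3_1 extremal_coef) = 1 / 9.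
Proof.
  assert (E0 : ode_coef scube 0 = 1%C) by reflexivity.
  assert (s0 : scube 0 = 0%C) by (unfold scube; simpl dcube; field; apply RtoC_INR_S_neq0).
  assert (s1 : scube 1 = 0%C) by (unfold scube; simpl dcube; field; apply RtoC_INR_S_neq0).
  assert (s2 : scube 2 = 1%C).
  { unfold scube. simpl dcube. rewrite INR_IZR_INZ. simpl Z.of_nat. field. }
  assert (s3 : scube 3 = 0%C) by (unfold scube; simpl dcube; field; apply RtoC_INR_S_neq0).
  assert (Rec : forall n l, conv scube (ode_coef scube) n = l ->
     ode_coef scube (S n) = (l / RtoC (INR (S n)))%C).
  { intros n l <-. rewrite <- ode_coef_S. unfold dcoef. field. apply RtoC_INR_S_neq0. }
  assert (E1 : ode_coef scube 1 = 0%C).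
  { rewrite (Rec 0%nat 0%C).
    - field. apply RtoC_INR_S_neq0.
    - unfold conv. rewrite sum_O, s0. ring. }
  assert (E2 : ode_coef scube 2 = 0%C).
  { rewrite (Rec 1%nat 0%C).
    - field. apply RtoC_INR_S_neq0.
    - unfold conv. rewrite sum_Sn, sum_O. change plus with Cplus. rewrite s0, s1. ring. }
  assert (E3 : ode_coef scube 3 = (/ 3)%C).
  { rewrite (Rec 2%nat 1%C).
    - rewrite INR_IZR_INZ. simpl Z.of_nat. field.
    - unfold conv. rewrite !sum_Sn, sum_O. change plus with Cplus. rewrite s0, s1, s2.
      simpl Nat.sub. rewrite E0. ring. }
  assert (E4 : ode_coef scube 4 = 0%C).
  { rewrite (Rec 3%nat 0%C).
    - field. apply RtoC_INR_S_neq0.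
    - unfold conv. rewrite !sum_Sn, sum_O. change plus with Cplus. rewrite s0, s1, s2, s3.
      simpl Nat.sub. rewrite E1. ring. }
  unfold H3_1. simpl extremal_coef. rewrite E1, E2, E3, E4.
  match goal with |- Cmod ?a = _ => replace a with (RtoC (- (1 / 9))) end.
  - rewrite Cmod_R, Rabs_left by lra. lra.
  - rewrite RtoC_opp, RtoC_div by lra. field.
Qed.

Theorem theorem4p7 :
  (forall (f : C -> C) (a : nat -> C),
      class_S_tau f -> normalized_expansion f a -> Cmod (H3_1 a) <= 1 / 9) /\
  (forall M : R,
      (forall (f : C -> C) (a : nat -> C),
          class_S_tau f -> normalized_expansion f a -> Cmod (H3_1 a) <= M) ->
      1 / 9 <= M).
Proof.
  split; [exact H3_upper_bound|]. intros M HM.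
  rewrite <- extremal_H3. apply (HM extremal); [apply extremal_class|apply extremal_expansion].
Qed.
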